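(* Let $k\ge2$ and $m\ge2$ be integers. Then, for $h$ sufficiently small, the discrete inf-sup property INF-SUP$(b_h,k,m)$ holds if and only if the discrete inf-sup property INF-SUP$(b_h,1,m)$ holds.
   Context: Geometry. $\Gamma\subset\mathbb R^3$ is a connected compact smooth two-dimensional surface without boundary, $d$ is the signed distance function to $\Gamma$ (negative in the interior), $U_\delta=\{x\in\mathbb R^3: |d(x)|<\delta\}$, $\mathbf n=\nabla d$, and $\pi(x)=x-d(x)\mathbf n(x)$ is the closest point projection; $\delta>0$ is small enough that the decomposition $x=\pi(x)+d(x)\mathbf n(x)$ is unique on $U_\delta$. $\{\Gamma_h\}_{h>0}$ is a family of polyhedral surfaces with triangular faces whose vertices lie on $\Gamma$; $\mathcal T_h$ is the set of faces of $\Gamma_h$, $\{\mathcal T_h\}$ is shape regular and quasi-uniform, and $h$ is the maximal diameter of the triangles. For $k\ge1$, $\pi_k:\Gamma_h\to\mathbb R^3$ is the continuous piecewise polynomial map given on each $T\in\mathcal T_h$ by $\pi_k(x)=\sum_j\pi(x_j)\phi^k_j(x)$, where $\phi_j^k$ is the Lagrange basis of polynomials of degree $k$ on $T$ with nodes $x_j$. $\Gamma_h^k=\pi_k(\Gamma_h)$ (so $\Gamma_h^1=\Gamma_h$), with surface measure $ds_{hk}$, outward unit normal $\mathbf n_h^k$ (a.e.) and $\mathbf P_h^k=\mathbf I-\mathbf n_h^k(\mathbf n_h^k)^T$. It is understood that $h$ is small enough that $\Gamma_h^k\subset U_\delta$ and $\pi_k:\Gamma_h\to\Gamma_h^k$,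 $\pi:\Gamma_h^k\to\Gamma$ are bijective. For $v$ on $\Gamma_h^k$, $v^\ell$ is its extension constant along $\mathbf n$, and for scalar $q$ on $\Gamma_h^k$, $\nabla_{\Gamma_h^k}q=\mathbf P_h^k\nabla q^\ell$ (a.e.). $b_h(\mathbf v,q)=\int_{\Gamma_h^k}\mathbf v\cdot\nabla_{\Gamma_h^k}q\,ds_{hk}$. Norm: $|\!|\!|\mathbf v|\!|\!|_k^2=\|\mathbf v\|_{H^1(\Gamma_h^k)}^2+h^{-2}\|\mathbf n\cdot\mathbf v\|_{L^2(\Gamma_h^k)}^2$, with the usual componentwise $H^1$-norm (full surface gradient of each component). Finite element spaces (depending on $k$, $m$). $V_h^j=\{\chi\in C(\Gamma_h):\chi|_T\in P_j\ \forall T\in\mathcal T_h\}$. $\mathbf V_h=\{\mathbf v_h\in C(\Gamma_h^k)^3:\mathbf v_h\circ\pi_k\in(V_h^m)^3\}$, $Q_h=\{q_h\in C(\Gamma_h^k):q_h\circ\pi_k\in V_h^{m-1}\}$, $Q_{h,0}=\{q_h\in Q_h:\int_{\Gamma_h^k}q_h\,ds_{hk}=0\}$. INF-SUP$(b_h,k,m)$, for $k\ge 1$, is the property: there is a constant $c_*>0$ independent of $h$ such that, for all sufficiently small $h$, $\sup_{\mathbf v_h\in\mathbf V_h}\frac{b_h(\mathbf v_h,q_h)}{|\!|\!|\mathbf v_h|\!|\!|_k}\ge c_*\|q_h\|_{L^2(\Gamma_h^k)}$ for all $q_h\in Q_{h,0}$ (supremum over nonzero $\mathbf v_h$; the value of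 $c_*$ and the smallness threshold for $h$ may be different for different $k$). *)

(* Defs.v *)
From HB Require Import structures.
From mathcomp Require Import all_boot all_order all_algebra.
From mathcomp Require Import all_classical all_reals all_analysis.

Set Implicit Arguments.
Unset Strict Implicit.
Unset Printing Implicit Defensive.

Import Order.TTheory GRing.Theory Num.Theory.
Import numFieldNormedType.Exports.

Local Open Scope classical_set_scope.
Local Open Scope ring_scope.

Section Euclidean.
Context {R : realType}.
Local Notation pt := 'rV[R]_3.

Definition dot (u v : pt) : R := \sum_i u 0 i * v 0 i.

(* The library norm `|u| on 'rV[R]_3 is the sup norm; the Euclidean one is
   used for every metric quantity below. *)
Definition enorm (u : pt) : R := Num.sqrt (dot u u).

(* Indices are added in 'I_3, i.e. modulo 3. *)
Definition cross (u v : pt) : pt :=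
  \row_(i < 3) (u 0 (i + 1) * v 0 (i + 2%:R) - u 0 (i + 2%:R) * v 0 (i + 1)).

Definition basis_vec (i : 'I_3) : pt := delta_mx 0 i.

Definition grad (f : pt -> R) (x : pt) : pt := \row_i 'D_(basis_vec i) f x.

(* For U open: all partial derivatives of order at most n exist and are
   continuous at every point of U. *)
Fixpoint Cn_on (n : nat) (U : set pt) (f : pt -> R) : Prop :=
  (forall x, U x -> {for x, continuous f}) /\
  (if n is n'.+1 then
     forall i, (forall x, U x -> derivable f x (basis_vec i)) /\
               Cn_on n' U (fun x => 'D_(basis_vec i) f x)
   else True).

Definition smooth_on (U : set pt) (f : pt -> R) : Prop :=
  forall n, Cn_on n U f.

End Euclidean.

Section Surface.
Context {R : realType}.
Local Notation pt := 'rV[R]_3.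
Implicit Types Gamma : set pt.

(* Locally a regular level set of a smooth function. *)
Definition smooth_closed_surface Gamma : Prop :=
  [/\ Gamma !=set0, compact Gamma, connected Gamma &
    forall p, Gamma p -> exists (U : set pt) (f : pt -> R),
      [/\ open U, U p, smooth_on U f,
          (forall x, U x -> grad f x != 0) &
          (forall x, U x -> (Gamma x <-> f x = 0))]].

Definition dist Gamma (x : pt) : R := inf [set enorm (x - y) | y in Gamma].

Definition inside Gamma : set pt :=
  [set x | ~ Gamma x /\ bounded_set (connected_component (~` Gamma) x)].

Definition sdist Gamma (x : pt) : R :=
  if x \in inside Gamma then - dist Gamma x else dist Gamma x.

Definition U_ Gamma (delta : R) : set pt := [set x | `|sdist Gamma x| < delta].

Definition normal Gamma (x : pt) : pt := grad (sdist Gamma) x.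

Definition closest_pt Gamma (x : pt) : pt := x - sdist Gamma x *: normal Gamma x.

(* Smoothness of the signed distance gives a meaning to n = grad d on the
   whole of U_delta. *)
Definition tubular Gamma (delta : R) : Prop :=
  [/\ 0 < delta, smooth_on (U_ Gamma delta) (sdist Gamma) &
    forall x, U_ Gamma delta x -> forall p t,
      [/\ Gamma p, `|t| < delta & x = p + t *: normal Gamma p] <->
      (p = closest_pt Gamma x /\ t = sdist Gamma x)].

End Surface.

Section Mesh.
Context {R : realType}.
Local Notation pt := 'rV[R]_3.
(* A triangle is the matrix whose rows are its three vertices, so that
   l *m T is the point with barycentric coordinates l. *)
Local Notation triangle := 'M[R]_3.
Implicit Types (T : triangle) (Th : seq triangle).

Definition plane T : set pt := [set l *m T | l in [set l : pt | \sum_i l 0 i = 1]].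

Definition hull T (I : set 'I_3) : set pt :=
  [set l *m T | l in [set l : pt | [/\ \sum_i l 0 i = 1,
     forall i, 0 <= l 0 i & forall i, ~ I i -> l 0 i = 0]]].

Definition tri T : set pt := hull T setT.

Definition diam T : R := sup [set enorm (x - y) | x in tri T & y in tri T].

Definition nondegenerate T : bool :=
  row_free (row_mx T (const_mx 1 : 'cV[R]_3)).

(* x *m pinvmx solves l *m T = x, \sum_i l i = 1 for x in the plane of T. *)
Definition bary T (x : pt) : pt :=
  row_mx x (const_mx 1 : 'M[R]_1) *m pinvmx (row_mx T (const_mx 1 : 'cV[R]_3)).

(* Two distinct faces meet in the (possibly empty) common face spanned by
   their common vertices. *)
Definition conforming Th : Prop :=
  forall T T', T \in Th -> T' \in Th -> T != T' ->
    tri T <> tri T' /\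
    tri T `&` tri T' =
      hull T [set i | exists j, row i T = row j T'].

Definition polyhedral (Gamma : set pt) Th : Prop :=
  [/\ uniq Th, conforming Th,
      forall T, T \in Th -> nondegenerate T &
      forall T i, T \in Th -> Gamma (row i T)].

Definition meshsize Th : R := \big[Num.max/0]_(T <- Th) diam T.

Definition polysurf Th : set pt :=
  [set x | exists2 T, T \in Th & tri T x].

(* sigma * diam T bounds the inradius of T from below. *)
Definition shape_regular (H : set R) (Th : R -> seq triangle) : Prop :=
  exists2 sigma : R, 0 < sigma & forall h, H h -> forall T, T \in Th h ->
    exists c : pt, plane T c /\
      [set x | plane T x /\ enorm (x - c) <= sigma * diam T] `<=` tri T.

Definition quasi_uniform (H : set R) (Th : R -> seq triangle) : Prop :=
  exists2 c : R, 0 < c & forall h, H h -> forall T, T \in Th h ->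
    c * h <= diam T.

(* H is the set of values taken by the mesh parameter h of the family. *)
Definition mesh_family (Gamma : set pt) (H : set R) (Th : R -> seq triangle)
    : Prop :=
  [/\ forall h, H h -> [/\ 0 < h, polyhedral Gamma (Th h) &
                           meshsize (Th h) = h],
      shape_regular H Th & quasi_uniform H Th].

End Mesh.

Section Lagrange.
Context {R : realType}.
Local Notation pt := 'rV[R]_3.
Local Notation triangle := 'M[R]_3.

(* Silvester's formula, in barycentric coordinates l, for the Lagrange basis
   polynomial of degree k attached to the node with barycentric coordinates
   al / k, where |al| = k; see lagrange_node. *)
Definition lagrange_basis (k : nat) (al : 'I_3 -> nat) (l : pt) : R :=
  \prod_i \prod_(j < al i) ((k%:R * l 0 i - j%:R) / j.+1%:R).

Definition node_bary (k : nat) (al : 'I_3 -> nat) : pt :=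
  \row_i ((al i)%:R / k%:R).

Lemma lagrange_node (k : nat) (al be : 'I_3 -> nat) :
  (0 < k)%N -> (\sum_i al i = k)%N -> (\sum_i be i = k)%N ->
  lagrange_basis k al (node_bary k be) = (if `[< al =1 be >] then 1 else 0).
Proof.
move=> k0 sal sbe; have kn0 : k%:R != 0 :> R by rewrite pnatr_eq0 -lt0n.
have fE i j : k%:R * node_bary k be 0 i - j%:R = (be i)%:R - j%:R :> R.
  by rewrite mxE mulrCA divff // mulr1.
case: asboolP => [eqab|neq].
  rewrite /lagrange_basis big1 // => i _.
  under eq_bigr => j _ do rewrite fE -eqab.
  rewrite prodf_div.
  have -> : \prod_(j < al i) ((al i)%:R - j%:R) =
            \prod_(j < al i) j.+1%:R :> R.
    rewrite (reindex_inj rev_ord_inj) /=; apply: eq_bigr => j _.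
    by rewrite natrB ?ltn_ord // opprB addrC subrK.
  by rewrite divff //; apply/prodf_neq0 => j _; rewrite pnatr_eq0.
have [i lti] : exists i, (be i < al i)%N.
  apply: contrapT => /forallNP noi; apply: neq.
  have le i : (al i <= be i)%N by rewrite leqNgt; apply/negP/noi.
  have [_] := @leqif_sum _ predT (fun i => al i == be i) al be
    (fun j _ => conj (le j) erefl).
  by rewrite sal sbe eqxx => /esym/forall_inP h i; apply/eqP/h.
rewrite /lagrange_basis (bigD1 i) //= (bigD1 (Ordinal lti)) //= fE subrr.
by rewrite !mul0r.
Qed.

(* The interpolant sum_j pi(x_j) phi_j^k on the single face T. *)
Definition proj_face (Gamma : set pt) (k : nat) (T : triangle) (x : pt) : pt :=
  \sum_(al : {ffun 'I_3 -> 'I_k.+1} | (\sum_i al i == k)%N)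
     lagrange_basis k (fun i => al i) (bary T x) *:
       closest_pt Gamma (node_bary k (fun i => al i) *m T).

(* By conformity the value does not depend on the face chosen among those
   containing x. *)
Definition proj_k (Gamma : set pt) (k : nat) (Th : seq triangle) (x : pt) : pt :=
  proj_face Gamma k (xget 0 [set T | T \in Th /\ tri T x]) x.

Definition surf_k (Gamma : set pt) (k : nat) (Th : seq triangle) : set pt :=
  proj_k Gamma k Th @` polysurf Th.

Definition admissible (Gamma : set pt) (delta : R) (k : nat)
    (Th : seq triangle) : Prop :=
  [/\ surf_k Gamma k Th `<=` U_ Gamma delta,
      set_bij (polysurf Th) (surf_k Gamma k Th) (proj_k Gamma k Th) &
      set_bij (surf_k Gamma k Th) Gamma (closest_pt Gamma)].

End Lagrange.

Section SurfaceCalculus.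
Context {R : realType}.
Local Notation pt := 'rV[R]_3.
Local Notation triangle := 'M[R]_3.
Variables (Gamma : set pt) (k : nat) (Th : seq triangle).

(* The open reference triangle: normals and surface gradients are only defined
   off the edges, which are negligible. *)
Definition ref_tri : set (R * R) :=
  [set s | [/\ 0 < s.1, 0 < s.2 & s.1 + s.2 < 1]].

(* The affine parametrization of T by the reference triangle. *)
Definition ref_map (T : triangle) (s : R * R) : pt :=
  (1 - s.1 - s.2) *: row 0 T + s.1 *: row 1 T + s.2 *: row 2%:R T.

Definition param (T : triangle) (s : R * R) : pt :=
  proj_face Gamma k T (ref_map T s).

Definition param_cross (T : triangle) (s : R * R) : pt :=
  cross ('D_((1, 0) : R * R) (param T) s) ('D_((0, 1) : R * R) (param T) s).

(* Integral over Gamma_h^k with respect to its surface measure: the faces are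
   the images of the reference triangle under the maps param T. *)
Definition surf_int (f : pt -> R) : R :=
  \sum_(T <- Th)
    \int[(lebesgue_measure \x lebesgue_measure)%E]_(s in ref_tri)
      (f (param T s) * enorm (param_cross T s)).

(* Unit normal to Gamma_h^k, defined (up to sign) off the edges. The
   orientation is irrelevant: the normal only enters through tangent_proj. *)
Definition normal_k (y : pt) : pt :=
  let: (T, s) := xget (0, (0, 0))
    [set z : triangle * (R * R) |
      [/\ z.1 \in Th, ref_tri z.2 & param z.1 z.2 = y]] in
  (enorm (param_cross T s))^-1 *: param_cross T s.

Definition tangent_proj (y : pt) : 'M[R]_3 :=
  1%:M - (normal_k y)^T *m normal_k y.

(* The extension of q from Gamma_h^k constant along n: the value at x is that
   of q at the point of Gamma_h^k with the same closest point on Gamma. *)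
Definition normal_ext (q : pt -> R) (x : pt) : R :=
  q (xget 0 [set y | surf_k Gamma k Th y /\ closest_pt Gamma y = closest_pt Gamma x]).

(* Row-vector form of P grad q^l; P is symmetric. *)
Definition surf_grad (q : pt -> R) (y : pt) : pt :=
  grad (normal_ext q) y *m tangent_proj y.

Definition L2norm (q : pt -> R) : R := Num.sqrt (surf_int (fun y => q y ^+ 2)).

Definition H1norm (v : pt -> pt) : R :=
  Num.sqrt (\sum_i (surf_int (fun y => v y 0 i ^+ 2) +
    surf_int (fun y => enorm (surf_grad (fun z => v z 0 i) y) ^+ 2))).

Definition triple_norm (h : R) (v : pt -> pt) : R :=
  Num.sqrt (H1norm v ^+ 2 +
            h ^- 2 * L2norm (fun y => dot (normal Gamma y) (v y)) ^+ 2).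

Definition b_form (v : pt -> pt) (q : pt -> R) : R :=
  surf_int (fun y => dot (v y) (surf_grad q y)).

End SurfaceCalculus.

Section FiniteElements.
Context {R : realType}.
Local Notation pt := 'rV[R]_3.
Local Notation triangle := 'M[R]_3.

(* Restrictions to A of the polynomials on R^3 of total degree at most j. *)
Definition poly_on (j : nat) (A : set pt) (f : pt -> R) : Prop :=
  exists c : {ffun 'I_3 -> 'I_j.+1} -> R, forall x, A x ->
    f x = \sum_(al : {ffun 'I_3 -> 'I_j.+1} | (\sum_i al i <= j)%N)
            c al * \prod_i x 0 i ^+ al i.

Definition Vscal (Th : seq triangle) (j : nat) : set (pt -> R) :=
  [set chi : pt -> R | {within polysurf Th, continuous chi} /\
             forall T, T \in Th -> poly_on j (tri T) chi].

(* Functions on Gamma_h^k are represented by total functions on R^3 of which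
   only the values on Gamma_h^k matter. *)
Definition Vh (Gamma : set pt) (k m : nat) (Th : seq triangle)
    : set (pt -> pt) :=
  [set v : pt -> pt | {within surf_k Gamma k Th, continuous v} /\
           forall i, Vscal Th m (fun x => v (proj_k Gamma k Th x) 0 i)].

Definition Qh (Gamma : set pt) (k m : nat) (Th : seq triangle)
    : set (pt -> R) :=
  [set q : pt -> R | {within surf_k Gamma k Th, continuous q} /\
           Vscal Th m.-1 (q \o proj_k Gamma k Th)].

Definition Qh0 (Gamma : set pt) (k m : nat) (Th : seq triangle)
    : set (pt -> R) :=
  [set q | Qh Gamma k m Th q /\ surf_int Gamma k Th q = 0].

(* A supremum in the extended reals: no junk value can arise. *)
Definition sup_quotient (Gamma : set pt) (k m : nat) (Th : seq triangle) (h : R)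
    (q : pt -> R) : \bar R :=
  ereal_sup [set (b_form Gamma k Th v q / triple_norm Gamma k Th h v)%:E
            | v in [set v : pt -> pt | Vh Gamma k m Th v /\
                    exists2 y, surf_k Gamma k Th y & v y != 0]].

Definition inf_sup (Gamma : set pt) (H : set R) (Th : R -> seq triangle)
    (k m : nat) : Prop :=
  exists2 c : R, 0 < c & exists2 h0 : R, 0 < h0 &
  forall h, H h -> h < h0 -> forall q, Qh0 Gamma k m (Th h) q ->
    ((c * L2norm Gamma k (Th h) q)%R%:E <=
       sup_quotient Gamma k m (Th h) h q)%E.

End FiniteElements.

(* Main.v *)
(** Transported to the reference triangle face by face, the finite element
    spaces on [Gamma_h^k] are the same for all degrees [k]; only the metric depends
    on [k]. The tangent vectors of the parametrization of a curved face differ from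
    the edges of the flat one by a multiple of size O(h^2) of the normal of [Gamma]
    at a vertex, up to O(h^3), and this normal is itself almost orthogonal to the
    face. So the change of metric enters the norms by bounded factors, and it
    enters [b_h(v, q)] by at most C h^2 (|n . v| + h |v|) |grad q| on the reference
    triangle. The norm of [v] weights [n . v] by 1/h, so an inverse inequality for
    [q] bounds the difference of the forms for two degrees by C h times the product
    of the norms, and for small h the inf-sup constant absorbs it. The functions [q]
    are corrected by constants, which [b_h] ignores, to have mean zero. *)

From mathcomp Require Import all_boot all_order all_algebra.
From mathcomp Require Import fingroup perm.
From mathcomp Require Import all_classical all_reals all_analysis measurable_realfun.
From mathcomp Require Import ring lra.
Require Import Defs.

Set Implicit Arguments.
Unset Strict Implicit.
Unset Printing Implicit Defensive.

Import Order.TTheory GRing.Theory Num.Theory.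
Import numFieldNormedType.Exports.

Local Open Scope classical_set_scope.
Local Open Scope ring_scope.

(** * Vectors and Lagrange interpolation *)

(** The powers of h shape the argument. The L2 norms on the surface are h times those on the
    reference triangle. An arbitrary change of the tangent vectors by O(h^2), which is O(h) relative
    to their length, could change [b_form] by C h^2 |v| |grad q|, that is, by C times the product of
    the norms: nothing would be small. The missing factor h comes from the direction of the change.
    The closest point projection displaces each interpolation node along the normal of [Gamma], and
    interpolation reproduces the affine face, so that only these displacements enter. No gain of
    accuracy with the degree is used: every positive degree, 1 included, is compared with the same
    density built from the edges of the face, and one transfer between two arbitrary degrees gives
    both implications. A second obstacle is that [surf_grad] differentiates a total function, the
    extension [normal_ext]. Before it can be computed in a chart, its differentiability must be
    proved, by an implicit function argument that uses the bijectivity in [admissible]. *)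

Section Vectors.
Context {R : realType}.
Local Notation pt := 'rV[R]_3.
Implicit Types (u v w a b : pt) (x y z c : R).

Lemma ord3P (i : 'I_3) : [\/ i = 0, i = 1 | i = 2%:R].
Proof.
case: i => [[|[|[|//]]] p]; [apply: Or31|apply: Or32|apply: Or33]; exact: val_inj.
Qed.

Lemma sum3E (V : nmodType) (F : 'I_3 -> V) : \sum_i F i = F 0 + F 1 + F 2%:R.
Proof.
rewrite !big_ord_recl big_ord0 addr0 addrA; congr (F _ + F _ + F _);
  exact: val_inj.
Qed.

Lemma prod3E (A : pzSemiRingType) (F : 'I_3 -> A) :
  \prod_i F i = F 0 * F 1 * F 2%:R.
Proof.
rewrite !big_ord_recl big_ord0 mulr1 mulrA; congr (F _ * F _ * F _);
  exact: val_inj.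
Qed.

Lemma rV3P u v : u 0 0 = v 0 0 -> u 0 1 = v 0 1 -> u 0 2%:R = v 0 2%:R -> u = v.
Proof. by move=> h0 h1 h2; apply/rowP => i; case: (ord3P i) => ->. Qed.

Lemma dotE u v :
  dot u v = u 0 0 * v 0 0 + u 0 1 * v 0 1 + u 0 2%:R * v 0 2%:R.
Proof. exact: sum3E. Qed.

Lemma cross0E u v : cross u v 0 0 = u 0 1 * v 0 2%:R - u 0 2%:R * v 0 1.
Proof. by rewrite mxE !add0r. Qed.

Lemma cross1E u v : cross u v 0 1 = u 0 2%:R * v 0 0 - u 0 0 * v 0 2%:R.
Proof.
rewrite mxE.
have -> : (1 + 1 : 'I_3) = 2%:R by apply: val_inj.
by have -> : (1 + 2%:R : 'I_3) = 0 by apply: val_inj.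
Qed.

Lemma cross2E u v : cross u v 0 2%:R = u 0 0 * v 0 1 - u 0 1 * v 0 0.
Proof.
rewrite mxE.
have -> : (2%:R + 1 : 'I_3) = 0 by apply: val_inj.
by have -> : (2%:R + 2%:R : 'I_3) = 1 by apply: val_inj.
Qed.

Definition crossE := (cross0E, cross1E, cross2E).

Lemma dotC u v : dot u v = dot v u.
Proof. by rewrite !dotE; ring. Qed.

Lemma dotDl u v w : dot (u + v) w = dot u w + dot v w.
Proof. by rewrite !dotE !mxE; ring. Qed.

Lemma dotDr u v w : dot u (v + w) = dot u v + dot u w.
Proof. by rewrite dotC dotDl !(dotC _ u). Qed.

Lemma dotZl c u v : dot (c *: u) v = c * dot u v.
Proof. by rewrite !dotE !mxE; ring. Qed.

Lemma dotZr c u v : dot u (c *: v) = c * dot u v.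
Proof. by rewrite dotC dotZl dotC. Qed.

Lemma dotNl u v : dot (- u) v = - dot u v.
Proof. by rewrite !dotE !mxE; ring. Qed.

Lemma dotBl u v w : dot (u - v) w = dot u w - dot v w.
Proof. by rewrite dotDl dotNl. Qed.

Lemma dot0l u : dot 0 u = 0.
Proof. by rewrite !dotE !mxE; ring. Qed.

Lemma dot_ge0 u : 0 <= dot u u.
Proof. by rewrite dotE !addr_ge0 // -expr2 sqr_ge0. Qed.

Lemma enorm_ge0 u : 0 <= enorm u.
Proof. exact: sqrtr_ge0. Qed.

Lemma enorm_sq u : enorm u ^+ 2 = dot u u.
Proof. exact/sqr_sqrtr/dot_ge0. Qed.

Lemma dot_cross a b :
  dot (cross a b) (cross a b) = dot a a * dot b b - dot a b ^+ 2.
Proof. by rewrite !dotE !crossE; ring. Qed.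

Lemma normv_coord u (i : 'I_3) : `|u 0 i| <= `|u|.
Proof.
rewrite {2}/Num.norm /= mx_normrE.
exact: (le_bigmax _ (fun ij => `|u ij.1 ij.2|) (0, i)).
Qed.

Lemma normv_le u c : 0 <= c -> (forall i, `|u 0 i| <= c) -> `|u| <= c.
Proof.
move=> c0 h; rewrite /Num.norm /= mx_normrE; apply: bigmax_le => // -[i j] _ /=.
by rewrite (ord1 i).
Qed.

Lemma normv_le_enorm u : `|u| <= enorm u.
Proof.
apply: normv_le => [|i]; first exact: enorm_ge0.
rewrite -sqrtr_sqr ler_wsqrtr // dotE.
by case: (ord3P i) => ->; have := sqr_ge0 (u 0 0); have := sqr_ge0 (u 0 1);
  have := sqr_ge0 (u 0 2%:R); lra.
Qed.

Lemma dot_le_normv u : dot u u <= 3 * `|u| ^+ 2.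
Proof.
have h i : u 0 i * u 0 i <= `|u| ^+ 2.
  by rewrite -expr2 -real_normK ?num_real // lerXn2r ?nnegrE // normv_coord.
by rewrite dotE; have := h 0; have := h 1; have := h 2%:R; lra.
Qed.

Lemma normv_sq_le_dot u : `|u| ^+ 2 <= dot u u.
Proof. by rewrite -enorm_sq lerXn2r ?nnegrE ?enorm_ge0 ?normv_le_enorm. Qed.

(** The optimal constant is the square root of 3; 2 avoids the radical. *)
Lemma enorm_le_normv u : enorm u <= 2 * `|u|.
Proof.
rewrite -(@ler_pXn2r _ 2) ?nnegrE ?enorm_ge0 ?mulr_ge0 //.
by rewrite enorm_sq; have := dot_le_normv u; have := sqr_ge0 `|u|; lra.
Qed.

Lemma normr_dot_le u v : `|dot u v| <= 3 * `|u| * `|v|.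
Proof.
rewrite dotE; apply: le_trans (ler_normD _ _) _.
apply: le_trans (lerD (ler_normD _ _) (lexx _)) _; rewrite !normrM.
have h i : `|u 0 i| * `|v 0 i| <= `|u| * `|v| by rewrite ler_pM ?normv_coord.
by have := h 0; have := h 1; have := h 2%:R; lra.
Qed.

End Vectors.

(** * Generalized binomial coefficients and Vandermonde's convolution *)

Section GeneralizedBinomial.
Context {R : realType}.
Implicit Types x y : R.

(** The generalized binomial coefficient, polynomial in [x]; [lagrange_basis] is a product of three
    of them. *)
Definition gbinom x (a : nat) : R := \prod_(j < a) ((x - j%:R) / j.+1%:R).

Lemma gbinomS x a : a.+1%:R * gbinom x a.+1 = (x - a%:R) * gbinom x a.
Proof.
rewrite /gbinom big_ord_recr /= mulrCA [_.+1%:R * _]mulrC divfK ?pnatr_eq0 //.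
by rewrite mulrC.
Qed.

(** The absorption identity: a weight on the lower index becomes a shift of the upper argument. *)
Lemma gbinom_shift x a : a.+1%:R * gbinom x a.+1 = x * gbinom (x - 1) a.
Proof.
elim: a => [|a IH].
  by rewrite /gbinom big_ord1 big_ord0 divr1 subr0 mul1r mulr1.
rewrite gbinomS.
have a1 : a.+1%:R != 0 :> R by rewrite pnatr_eq0.
apply: (mulfI a1); rewrite mulrCA IH [RHS]mulrCA gbinomS.
by rewrite -(natr1 a); ring.
Qed.

(** Induction on [n]. The factor n + 1 is split as j + (n + 1 - j), and [gbinomS] lowers one index
    in each half; the resulting factors x - j and y - (n - j) add up to x + y - n. *)
Lemma gbinom_vandermonde x y n :
  \sum_(j < n.+1) gbinom x j * gbinom y (n - j) = gbinom (x + y) n.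
Proof.
elim: n => [|n IH]; first by rewrite big_ord1 /gbinom !big_ord0 mulr1.
have n1 : n.+1%:R != 0 :> R by rewrite pnatr_eq0.
apply: (mulfI n1); rewrite gbinomS -IH !mulr_sumr.
have -> : \sum_(i < n.+2) n.+1%:R * (gbinom x i * gbinom y (n.+1 - i)) =
   \sum_(i < n.+2) i%:R * gbinom x i * gbinom y (n.+1 - i) +
   \sum_(i < n.+2) gbinom x i * ((n.+1 - i)%:R * gbinom y (n.+1 - i)).
  rewrite -big_split /=; apply: eq_bigr => i _.
  have -> : n.+1%:R = i%:R + (n.+1 - i)%:R :> R.
    by rewrite -natrD subnKC // -ltnS.
  by ring.
rewrite big_ord_recl /= !mul0r add0r.
rewrite [X in _ + X]big_ord_recr /= subnn mul0r mulr0 addr0 -big_split /=.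
apply: eq_bigr => i _; have ilt : (i <= n)%N by rewrite -ltnS.
rewrite /bump leq0n add1n subSS gbinomS (subSn ilt) gbinomS.
by rewrite natrB //; ring.
Qed.

Local Notation gpoly K x := (\poly_(a < K.+1) gbinom x a).

(** [gpoly K x] is the binomial series of (1 + t)^x truncated after degree [K], and the coefficients
    of a product up to degree [K] do not see the truncation. *)
Lemma coef_gpolyM K n x y : (n <= K)%N ->
  (gpoly K x * gpoly K y)`_n = gbinom (x + y) n.
Proof.
move=> nK; rewrite coefM -gbinom_vandermonde; apply: eq_bigr => j _.
have jn : (j <= n)%N by rewrite -ltnS.
by rewrite !coef_poly !ifT // ltnS ?(leq_trans (leq_subr _ _)) ?(leq_trans jn).
Qed.

Lemma coef_mulr_trunc (p q r : {poly R}) K n : (n <= K)%N ->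
  (forall j, (j <= K)%N -> p`_j = q`_j) -> (p * r)`_n = (q * r)`_n.
Proof.
move=> nK pq; rewrite !coefM; apply: eq_bigr => j _.
by rewrite pq // (leq_trans _ nK) // -ltnS.
Qed.

(** Expanding the product of the three generating polynomials gives one term for each multi-index,
    and the coefficient of degree [K] selects those of total degree [K]. Sums over Lagrange nodes
    become Vandermonde convolutions in this way. *)
Lemma coef_prod3 K (F : 'I_3 -> nat -> R) :
  \sum_(al : {ffun 'I_3 -> 'I_K.+1} | (\sum_i al i == K)%N) \prod_i F i (al i) =
  ((\poly_(a < K.+1) F 0 a * \poly_(a < K.+1) F 1 a) * \poly_(a < K.+1) F 2%:R a)`_K.
Proof.
have -> : (\poly_(a < K.+1) F 0 a * \poly_(a < K.+1) F 1 a) *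
    \poly_(a < K.+1) F 2%:R a = \prod_i \sum_(a < K.+1) F i a *: 'X^a.
  by rewrite prod3E !poly_def.
rewrite bigA_distr_bigA /= coef_sum [RHS]big_mkcond /= [LHS]big_mkcond /=.
apply: eq_bigr => al _.
rewrite scaler_prod coefZ prodrXr coefXn eq_sym.
by case: eqP => _; rewrite ?mulr1 ?mulr0.
Qed.

End GeneralizedBinomial.

(** * Lagrange interpolation reproduces affine functions *)

Section LagrangeReproduction.
Context {R : realType}.
Local Notation pt := 'rV[R]_3.

Local Notation mi k := {ffun 'I_3 -> 'I_k.+1}.

Lemma lagrange_basisE k (al : 'I_3 -> nat) (l : pt) :
  lagrange_basis k al l = \prod_i gbinom (k%:R * l 0 i) (al i).
Proof. by []. Qed.

Lemma gbinom_nat k : gbinom (k%:R : R) k = 1.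
Proof.
rewrite /gbinom prodf_div (reindex_inj rev_ord_inj) /=.
rewrite (eq_bigr (fun j : 'I_k => j.+1%:R : R)).
  by rewrite divff //; apply/prodf_neq0 => j _; rewrite pnatr_eq0.
by move=> j _; rewrite natrB ?ltn_ord // opprB addrC subrK.
Qed.

Local Notation gpoly K x := (\poly_(a < K.+1) gbinom x a).

Lemma coef_gpolyM3 K n (x y z : R) : (n <= K)%N ->
  (gpoly K x * gpoly K y * gpoly K z)`_n = gbinom (x + y + z) n.
Proof.
move=> nK; rewrite (coef_mulr_trunc _ nK (q := gpoly K (x + y))).
  by rewrite coef_gpolyM.
by move=> j jK; rewrite coef_gpolyM // coef_poly ltnS jK.
Qed.

Lemma gpoly_weighted K (x : R) (j : nat) : (j <= K.+1)%N ->
  (\poly_(a < K.+2) (a%:R * gbinom x a))`_j = (x *: ('X * gpoly K (x - 1)))`_j.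
Proof.
move=> jK; rewrite coef_poly ltnS jK coefZ coefXM.
case: j jK => [|j] jK /=; first by rewrite mul0r mulr0.
by rewrite coef_poly jK gbinom_shift.
Qed.

(* The multiplication by al_i shifts one factor of Vandermonde's convolution. *)
Lemma lagrange_linear k (l : pt) (i : 'I_3) : (0 < k)%N -> \sum_i l 0 i = 1 ->
  \sum_(al : mi k | (\sum_i al i == k)%N)
    (al i)%:R / k%:R * lagrange_basis k (fun i => al i) l = l 0 i.
Proof.
case: k => // k _; rewrite sum3E => l1.
have k0 : k.+1%:R != 0 :> R by rewrite pnatr_eq0.
pose F (j : 'I_3) (a : nat) :=
  (if j == i then a%:R else 1) * gbinom (k.+1%:R * l 0 j) a.
rewrite (eq_bigr (fun al : mi k.+1 => k.+1%:R^-1 * \prod_j F j (al j))); last first.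
  move=> al _; rewrite lagrange_basisE /F big_split /= -big_mkcond /= big_pred1_eq.
  by rewrite mulrA [_^-1 * _]mulrC.
rewrite -mulr_sumr coef_prod3.
suff -> : ((\poly_(a < k.+2) F 0 a * \poly_(a < k.+2) F 1 a) *
    \poly_(a < k.+2) F 2%:R a)`_k.+1 = k.+1%:R * l 0 i by rewrite mulKf.
(* The weight turns x into x - 1 and lowers the degree by one, so what multiplies [x] is the
   coefficient of degree k in a product with upper arguments summing to k, which is 1. *)
have gE (x y z : R) : x + y + z = k.+1%:R ->
  ((\poly_(a < k.+2) (a%:R * gbinom x a) * gpoly k.+1 y) * gpoly k.+1 z)`_k.+1 = x.
  move=> xyz; rewrite -mulrA (coef_mulr_trunc _ (leqnn _) (gpoly_weighted x (K := k))).
  rewrite -scalerAl coefZ -mulrA coefXM /= mulrA.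
  rewrite -[X in _ = X]mulr1; congr (_ * _).
  have trc (w : R) j : (j <= k)%N -> (gpoly k.+1 w)`_j = (gpoly k w)`_j.
    by move=> jk; rewrite !coef_poly !ltnS jk leqW.
  rewrite -mulrA mulrC -mulrA (coef_mulr_trunc _ (leqnn k) (trc y)) mulrCA.
  rewrite (coef_mulr_trunc _ (leqnn k) (trc z)) mulrA coef_gpolyM3 //.
  rewrite (_ : _ + _ = k%:R) ?gbinom_nat //.
  by move: xyz; rewrite -natr1; lra.
have one j : j != i -> \poly_(a < k.+2) F j a = gpoly k.+1 (k.+1%:R * l 0 j).
  move=> /negbTE ji; apply/polyP => a; rewrite !coef_poly; case: ifP => // _.
  by rewrite /F ji mul1r.
have wt : \poly_(a < k.+2) F i a =
    \poly_(a < k.+2) (a%:R * gbinom (k.+1%:R * l 0 i) a).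
  by apply/polyP => a; rewrite !coef_poly; case: ifP => // _; rewrite /F eqxx.
have l1k : k.+1%:R * (l 0 0 + l 0 1 + l 0 2%:R) = k.+1%:R by rewrite l1 mulr1.
case: (ord3P i) => ie; rewrite ie in wt one *.
- by rewrite wt one // one // gE // -!mulrDr.
- rewrite wt one // one // [X in X * _]mulrC gE // -!mulrDr.
  by rewrite [X in _ * (X + _)]addrC.
- rewrite wt one // one // mulrC mulrA gE // -!mulrDr.
  by rewrite -addrA [X in _ * X]addrC.
Qed.

End LagrangeReproduction.

(** * Integrals over the reference triangle *)

Section ReferenceTriangle.
Context {R : realType}.
Implicit Types s : R * R.
Local Notation mu2 := (@lebesgue_measure R \x @lebesgue_measure R)%E.

Definition cref_tri : set (R * R) := [set s | [/\ 0 <= s.1, 0 <= s.2 & s.1 + s.2 <= 1]].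

Lemma sub_ref_tri : ref_tri `<=` cref_tri.
Proof. by move=> s [h1 h2 h3]; split; exact: ltW. Qed.

Lemma open_ref_tri : open (@ref_tri R).
Proof.
have -> : @ref_tri R = (fst @^-1` [set x | 0 < x] `&` snd @^-1` [set x | 0 < x]) `&`
    (fun s : R * R => s.1 + s.2) @^-1` [set x | x < 1].
  by apply/seteqP; split => s [] //= [].
apply: openI; first apply: openI.
- apply: open_comp => [s _|]; [exact: cvg_fst|exact: open_gt].
- apply: open_comp => [s _|]; [exact: cvg_snd|exact: open_gt].
- by apply: open_comp => [s _|]; [apply: cvgD; [exact: cvg_fst|exact: cvg_snd]|exact: open_lt].
Qed.

(** The sigma-algebra is that of the product, so an open set is written as a countable union of
    squares with rational centres and sides 2 / (n + 1). *)
Lemma open_measurable_plane (U : set (R * R)) : open U -> measurable U.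
Proof.
move=> oU.
pose B (i : rat * rat * nat) : set (R * R) :=
  [set` `]ratr i.1.1 - i.2.+1%:R^-1, ratr i.1.1 + i.2.+1%:R^-1[%R] `*`
  [set` `]ratr i.1.2 - i.2.+1%:R^-1, ratr i.1.2 + i.2.+1%:R^-1[%R].
(* Squares that leave [U] are replaced by the empty set, so that the union runs over a whole
   countable type. *)
pose C i := if `[< B i `<=` U >] then B i else set0.
have -> : U = \bigcup_i C i.
  apply/seteqP; split=> [x Ux|x [i _]]; last first.
    by rewrite /C; case: asboolP => // h; exact: h.
  have /nbhs_ballP[e /= e0 he] : nbhs x U by exact: open_nbhs_nbhs.
  have [k ke] : exists k : nat, k.+1%:R^-1 < e / 2 :> R.
    have e2 : 0 < e / 2 by rewrite divr_gt0.
    exists (Num.truncn (e / 2)^-1); rewrite invf_plt ?posrE ?invr_gt0 //.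
    by rewrite truncnS_gt.
  have k0 : 0 < k.+1%:R^-1 :> R by rewrite invr_gt0.
  set d := k.+1%:R^-1 in ke k0.
  have lt1 : x.1 - d < x.1 + d by lra.
  have [p] := rat_in_itvoo lt1.
  have lt2 : x.2 - d < x.2 + d by lra.
  have [q] := rat_in_itvoo lt2.
  rewrite !in_itv /= => /andP[q1 q2] /andP[p1 p2].
  exists (p, q, k) => //; rewrite /C asboolT.
    by split; rewrite /= in_itv /= -/d; apply/andP; split; lra.
  move=> y [/=]; rewrite !in_itv /= -/d => /andP[a1 a2] /andP[b1 b2].
  apply: he; split; rewrite /ball /= ltr_norml; apply/andP; split; lra.
apply: countable_bigcupT_measurable; first exact: countableP.
move=> i; rewrite /C; case: asboolP => // _.
exact: measurableX.
Qed.

Lemma continuous_measurable_ref (f : R * R -> R) :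
  (forall s, ref_tri s -> {for s, continuous f}) -> measurable_fun ref_tri f.
Proof.
move=> cf; apply: (measurability _ (RGenOInfty.measurableE R)).
move=> _ [_ [a ->] <-]; apply: open_measurable_plane.
rewrite openE => s [rs fs]; apply: filterI.
  by apply: open_nbhs_nbhs; split => //; exact: open_ref_tri.
by apply: cf => //; apply: open_nbhs_nbhs; split => //; exact: interval_open.
Qed.

(** Enough for integrability on the reference triangle and, unlike integrability itself, stable
    under products. *)
Definition regular (f : R * R -> R) : Prop :=
  (forall s, ref_tri s -> {for s, continuous f}) /\
  exists M, forall s, ref_tri s -> `|f s| <= M.

Lemma measurable_ref_tri : measurable (@ref_tri R).
Proof. apply: open_measurable_plane; exact: open_ref_tri. Qed.

Lemma mu2_box (A B : set R) : measurable A -> measurable B ->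
  mu2 (A `*` B) = (lebesgue_measure A * lebesgue_measure B)%E.
Proof. by move=> mA mB; rewrite product_measure1E. Qed.

Lemma mu2_ref_tri : (mu2 (@ref_tri R) <= 1)%E.
Proof.
have -> : 1%E = mu2 (`[(0:R), 1]%classic `*` `[(0:R), 1]%classic).
  rewrite mu2_box //.
  have -> : lebesgue_measure (`[(0:R), 1]%classic) = 1%E.
    by rewrite lebesgue_measure_itv /= lte_fin ltr01 oppr0 adde0.
  by rewrite mule1.
apply: le_measure; rewrite ?inE.
- exact: measurable_ref_tri.
- exact: measurableX.
- by move=> s [h1 h2 h3]; split; rewrite /= in_itv /=; apply/andP; split; lra.
Qed.

Lemma regular_integrable f : regular f -> mu2.-integrable ref_tri (EFin \o f).
Proof.
move=> [cf [M hM]]; apply: measurable_bounded_integrable.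
- exact: measurable_ref_tri.
- exact: le_lt_trans mu2_ref_tri (ltry _).
- exact: continuous_measurable_ref.
- exists M; split; first exact: num_real.
  by move=> x Mx s rs; apply: le_trans (hM s rs) _; exact: ltW.
Qed.

Lemma regularD f g : regular f -> regular g -> regular (fun s => f s + g s).
Proof.
move=> [cf [M hM]] [cg [N hN]]; split.
  by move=> s rs; apply: continuousD; [exact: cf|exact: cg].
exists (M + N) => s rs.
by apply: le_trans (ler_normD _ _) _; apply: lerD; [exact: hM|exact: hN].
Qed.

Lemma regularM f g : regular f -> regular g -> regular (fun s => f s * g s).
Proof.
move=> [cf [M hM]] [cg [N hN]]; split.
  by move=> s rs; apply: continuousM; [exact: cf|exact: cg].
exists (M * N) => s rs; rewrite normrM.
by apply: ler_pM => //; [exact: hM|exact: hN].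
Qed.

Lemma regular_cst c : regular (fun=> c).
Proof. by split=> [s _|]; [exact: cst_continuous|exists `|c|]. Qed.

Lemma regularX f n : regular f -> regular (fun s => f s ^+ n).
Proof.
move=> rf; elim: n => [|n IH]; first exact: (regular_cst 1).
rewrite (_ : (fun s => _) = (fun s => f s * f s ^+ n)); first exact: regularM.
by apply/funext => s; rewrite exprS.
Qed.

Lemma regularZ c f : regular f -> regular (fun s => c * f s).
Proof. exact: regularM (regular_cst c). Qed.

Lemma regularN f : regular f -> regular (fun s => - f s).
Proof.
move=> rf; rewrite (_ : (fun s => _) = (fun s => -1 * f s)); first exact: regularZ.
by apply/funext => s; rewrite mulN1r.
Qed.

Lemma regularB f g : regular f -> regular g -> regular (fun s => f s - g s).
Proof. by move=> rf rg; apply: regularD => //; exact: regularN. Qed.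

Lemma regular_sum (I : Type) (r : seq I) (P : pred I) (F : I -> R * R -> R) :
  (forall i, P i -> regular (F i)) -> regular (fun s => \sum_(i <- r | P i) F i s).
Proof.
move=> hF; elim: r => [|i r IH].
  rewrite (_ : (fun s => _) = (fun=> 0)); first exact: regular_cst.
  by apply/funext => s; rewrite big_nil.
rewrite (_ : (fun s => _) =
  (fun s => (if P i then F i s else 0) + \sum_(i <- r | P i) F i s)); last first.
  by apply/funext => s; rewrite big_cons; case: ifP; rewrite ?add0r.
apply: regularD => //; case Pi: (P i); [exact: hF|exact: (regular_cst 0)].
Qed.

Lemma regular_norm f : regular f -> regular (fun s => `|f s|).
Proof.
move=> [cf [M hM]]; split.
  move=> s rs; apply: (@continuous_comp _ _ _ f (fun x : R => `|x|)).
    exact: cf.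
  exact: norm_continuous.
by exists M => s rs; rewrite normr_id; exact: hM.
Qed.

Lemma regular_sqrt f : regular f -> regular (fun s => Num.sqrt (f s)).
Proof.
move=> [cf [M hM]]; split.
  move=> s rs; apply: (@continuous_comp _ _ _ f (@Num.sqrt R)).
    exact: cf.
  exact: sqrt_continuous.
exists (Num.sqrt M) => s rs; rewrite ger0_norm ?sqrtr_ge0 // ler_wsqrtr //.
exact: le_trans (ler_norm _) (hM _ rs).
Qed.

Lemma regularV f c : 0 < c -> (forall s, ref_tri s -> c <= f s) ->
  regular f -> regular (fun s => (f s)^-1).
Proof.
move=> c0 hc [cf _]; split.
  move=> s rs; apply: continuousV; last exact: cf.
  by rewrite gt_eqF // (lt_le_trans c0) // hc.
exists c^-1 => s rs; have f0 := lt_le_trans c0 (hc s rs).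
by rewrite ger0_norm ?invr_ge0 ?(ltW f0) // lef_pV2 ?posrE // hc.
Qed.

Lemma regular_fst : regular fst.
Proof.
split=> [s _|]; first exact: cvg_fst.
by exists 1 => s [h1 h2 h3]; rewrite ger0_norm; lra.
Qed.

Lemma regular_snd : regular snd.
Proof.
split=> [s _|]; first exact: cvg_snd.
by exists 1 => s [h1 h2 h3]; rewrite ger0_norm; lra.
Qed.

Definition rint (f : R * R -> R) : R := \int[mu2]_(s in ref_tri) f s.

Lemma rint_le f g : regular f -> regular g ->
  (forall s, ref_tri s -> f s <= g s) -> rint f <= rint g.
Proof.
move=> rf rg fg; apply: le_Rintegral => //; try exact: regular_integrable.
exact: measurable_ref_tri.
Qed.

Lemma rintD f g : regular f -> regular g ->
  rint (fun s => f s + g s) = rint f + rint g.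
Proof.
move=> rf rg; apply: RintegralD => //; try exact: regular_integrable.
exact: measurable_ref_tri.
Qed.

Lemma rintZ c f : regular f -> rint (fun s => c * f s) = c * rint f.
Proof.
move=> rf; apply: RintegralZl => //; try exact: regular_integrable.
exact: measurable_ref_tri.
Qed.

Lemma rint_eq f g : (forall s, ref_tri s -> f s = g s) -> rint f = rint g.
Proof. by move=> fg; apply: eq_Rintegral => s; rewrite inE; exact: fg. Qed.

Lemma rint_ge0 f : (forall s, ref_tri s -> 0 <= f s) -> 0 <= rint f.
Proof. by move=> f0; apply: Rintegral_ge0. Qed.

Lemma rint_cst_le c : 0 <= c -> rint (fun=> c) <= c.
Proof.
move=> c0; rewrite /rint Rintegral_cst; last exact: measurable_ref_tri.
rewrite ler_piMr // -lee_fin fineK ?mu2_ref_tri //.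
by rewrite ge0_fin_numE ?measure_ge0 // (le_lt_trans mu2_ref_tri) ?ltry.
Qed.

Lemma rint_norm_le f : regular f -> `|rint f| <= rint (fun s => `|f s|).
Proof.
move=> rf; apply: le_normr_Rintegral; last exact: regular_integrable.
exact: measurable_ref_tri.
Qed.

Lemma rint_sum (I : Type) (r : seq I) (P : pred I) (F : I -> R * R -> R) :
  (forall i, P i -> regular (F i)) ->
  rint (fun s => \sum_(i <- r | P i) F i s) = \sum_(i <- r | P i) rint (F i).
Proof.
move=> hF; elim: r => [|i r IH].
  rewrite big_nil (rint_eq (g := fun=> 0 * 0)).
    by rewrite rintZ ?mul0r //; exact: regular_cst.
  by move=> s _; rewrite big_nil mulr0.
rewrite big_cons; case: ifP => Pi; last first.
  by rewrite -IH; apply: rint_eq => s _; rewrite big_cons Pi.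
rewrite -IH -rintD; [|exact: hF|exact: regular_sum].
by apply: rint_eq => s _; rewrite big_cons Pi.
Qed.

(** By continuity [f] exceeds half of its value at [s0] on a small square inside the triangle, and
    squares have positive measure. *)
Lemma rint_gt0 f s0 : regular f -> (forall s, ref_tri s -> 0 <= f s) ->
  ref_tri s0 -> 0 < f s0 -> 0 < rint f.
Proof.
move=> rf f0 r0 fs0.
have : nbhs s0 (ref_tri `&` [set s | f s0 / 2 < f s]).
  apply: filterI.
    by apply: open_nbhs_nbhs; split => //; exact: open_ref_tri.
  apply: (rf.1 s0 r0 [set y | f s0 / 2 < y]); apply: open_nbhs_nbhs; split.
    exact: open_gt.
  by rewrite /=; lra.
move=> /nbhs_ballP[e /= e0 he].
pose B := `](s0.1 - e), (s0.1 + e)[%classic `*` `](s0.2 - e), (s0.2 + e)[%classic.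
have BE s : B s -> ref_tri s /\ f s0 / 2 < f s.
  move=> [/=]; rewrite !in_itv /= => /andP[a1 a2] /andP[b1 b2].
  by apply: he; split; rewrite /ball /= ltr_norml; apply/andP; split; lra.
have mB : measurable B by exact: measurableX.
have muB : mu2 B = ((2 * e) * (2 * e))%:E.
  rewrite mu2_box // !lebesgue_measure_itv /= !lte_fin !ifT; [|lra|lra].
  by rewrite -!EFinB -EFinM; congr (_%:E); ring.
have h1 : (\int[mu2]_(s in B) (f s0 / 2)%:E <= \int[mu2]_(s in ref_tri) (f s)%:E)%E.
  apply: (@le_trans _ _ (\int[mu2]_(s in B) (f s)%:E)%E).
    apply: ge0_le_integral => //.
    - by move=> s _; rewrite lee_fin; lra.
    - apply/measurable_EFinP; apply: (measurable_funS measurable_ref_tri).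
        by move=> s Bs; case: (BE s Bs).
      exact: continuous_measurable_ref rf.1.
    - by move=> s Bs; rewrite lee_fin ltW //; case: (BE s Bs).
  apply: ge0_subset_integral => //.
  - exact: measurable_ref_tri.
  - apply/measurable_EFinP; exact: continuous_measurable_ref rf.1.
  - by move=> s Bs; case: (BE s Bs).
rewrite integral_cst // in h1.
have {}h1 : ((f s0 / 2)%:E * mu2 B <= \int[mu2]_(s in ref_tri) (f s)%:E)%E := h1.
rewrite muB -EFinM in h1.
have hE : (\int[mu2]_(s in ref_tri) (f s)%:E)%E = (rint f)%:E.
  rewrite /rint /Rintegral fineK //; apply: integrable_fin_num.
    exact: measurable_ref_tri.
  exact: regular_integrable.
rewrite hE lee_fin in h1.
apply: lt_le_trans h1; rewrite mulr_gt0 ?divr_gt0 // mulr_gt0 // mulr_gt0 //.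
Qed.

End ReferenceTriangle.

(** * Polynomials on the reference triangle *)

Section PlanePolynomials.
Context {R : realType}.
Implicit Types s : R * R.
Local Notation N n := (n.+1 * n.+1)%N.

(* The coefficient of index [(n + 1) * i + j] is that of [s.1 ^+ i * s.2 ^+ j]. *)
Definition pmono n (a : nat) s : R := s.1 ^+ (a %/ n.+1) * s.2 ^+ (a %% n.+1).

(** The formal partial derivatives; at exponent 0 the truncated predecessor is harmless because of
    the vanishing factor in front. *)
Definition pmono1 n (a : nat) s : R :=
  (a %/ n.+1)%:R * s.1 ^+ (a %/ n.+1).-1 * s.2 ^+ (a %% n.+1).

Definition pmono2 n (a : nat) s : R :=
  s.1 ^+ (a %/ n.+1) * ((a %% n.+1)%:R * s.2 ^+ (a %% n.+1).-1).

Definition pev n (u : 'rV[R]_(N n)) s : R := \sum_a u 0 a * pmono n a s.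
Definition pev1 n (u : 'rV[R]_(N n)) s : R := \sum_a u 0 a * pmono1 n a s.
Definition pev2 n (u : 'rV[R]_(N n)) s : R := \sum_a u 0 a * pmono2 n a s.

(** The degree is bounded in each variable separately: a finite-dimensional space that contains all
    polynomials of total degree at most [n]. *)
Definition pfun n (f : R * R -> R) : Prop := exists u : 'rV[R]_(N n), f =1 pev u.

Lemma eq_pfun n f g : f =1 g -> pfun n f -> pfun n g.
Proof. by move=> fg [u hu]; exists u => s; rewrite -fg hu. Qed.

Lemma pfunD n f g : pfun n f -> pfun n g -> pfun n (fun s => f s + g s).
Proof.
move=> [u hu] [v hv]; exists (u + v) => s; rewrite hu hv /pev -big_split.
by apply: eq_bigr => a _; rewrite mxE mulrDl.
Qed.

Lemma pfunZ n c f : pfun n f -> pfun n (fun s => c * f s).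
Proof.
move=> [u hu]; exists (c *: u) => s; rewrite hu /pev mulr_sumr.
by apply: eq_bigr => a _; rewrite mxE mulrA.
Qed.

Lemma pfun_mono n i j : (i <= n)%N -> (j <= n)%N ->
  pfun n (fun s => s.1 ^+ i * s.2 ^+ j).
Proof.
move=> hi hj; have lt : (i * n.+1 + j < N n)%N.
  rewrite (@leq_trans (i.+1 * n.+1)) // ?leq_mul2r //.
  by rewrite mulSn addnC ltn_add2r ltnS.
exists (delta_mx 0 (Ordinal lt)) => s.
rewrite /pev (bigD1 (Ordinal lt)) //= big1 => [|a /negbTE na].
  rewrite mxE !eqxx mul1r addr0 /pmono divnMDl // divn_small ?ltnS // addn0.
  by rewrite modnMDl modn_small ?ltnS.
by rewrite mxE na andbF mul0r.
Qed.

Lemma pfun_cst n c : pfun n (fun=> c).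
Proof.
apply: eq_pfun (pfunZ c (pfun_mono (leq0n n) (leq0n n))) => s.
by rewrite !expr0 !mulr1.
Qed.

Lemma pfun_sum n (I : Type) (r : seq I) (P : pred I) (F : I -> R * R -> R) :
  (forall i, P i -> pfun n (F i)) -> pfun n (fun s => \sum_(i <- r | P i) F i s).
Proof.
move=> hF; elim: r => [|i r IH].
  by apply: eq_pfun (pfun_cst n 0) => s; rewrite big_nil.
case Pi: (P i); last by apply: eq_pfun IH => s; rewrite big_cons Pi.
by apply: eq_pfun (pfunD (hF i Pi) IH) => s; rewrite big_cons Pi.
Qed.

Lemma pfunM n m f g : pfun n f -> pfun m g -> pfun (n + m) (fun s => f s * g s).
Proof.
move=> [u hu] [v hv].
have h : pfun (n + m) (fun s => \sum_(a < N n) \sum_(b < N m)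
    u 0 a * v 0 b * (s.1 ^+ (a %/ n.+1 + b %/ m.+1) * s.2 ^+ (a %% n.+1 + b %% m.+1))).
  apply: pfun_sum => a _; apply: pfun_sum => b _; apply/pfunZ/pfun_mono.
    by apply: leq_add; rewrite -ltnS ltn_divLR.
  by apply: leq_add; rewrite -ltnS ltn_pmod.
apply: eq_pfun h => s; rewrite hu hv /pev mulr_suml; apply: eq_bigr => a _.
by rewrite mulr_sumr; apply: eq_bigr => b _; rewrite /pmono !exprD; ring.
Qed.

Lemma pfun_widen n m f : (n <= m)%N -> pfun n f -> pfun m f.
Proof.
move=> nm pf; have := pfunM pf (pfun_cst (m - n) 1); rewrite subnKC //.
by apply: eq_pfun => s; rewrite mulr1.
Qed.

Lemma pfun_affine a b c : pfun 1 (fun s => a + b * s.1 + c * s.2).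
Proof.
have h1 := pfunZ b (pfun_mono (leqnn 1) (leq0n 1)).
have h2 := pfunZ c (pfun_mono (leq0n 1) (leqnn 1)).
by apply: eq_pfun (pfunD (pfunD (pfun_cst 1 a) h1) h2) => s; rewrite !expr1 !expr0 mulr1 mul1r.
Qed.

Lemma pfunX n f e : pfun n f -> pfun (n * e) (fun s => f s ^+ e).
Proof.
move=> pf; elim: e => [|e IH]; first by rewrite muln0; exact: pfun_cst.
by rewrite mulnS; apply: eq_pfun (pfunM pf IH) => s; rewrite exprS.
Qed.

Lemma pfun_prod (I : Type) (r : seq I) (k : I -> nat) (F : I -> R * R -> R) :
  (forall i, pfun (k i) (F i)) ->
  pfun (\sum_(i <- r) k i) (fun s => \prod_(i <- r) F i s).
Proof.
move=> hF; elim: r => [|i r IH].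
  by rewrite big_nil; apply: eq_pfun (pfun_cst 0 1) => s; rewrite big_nil.
by rewrite big_cons; apply: eq_pfun (pfunM (hF i) IH) => s; rewrite big_cons.
Qed.

Lemma is_diff_fst s : is_diff s (fst : R * R -> R) fst.
Proof.
have c : continuous (fst : R * R -> R) by move=> t; exact: cvg_fst.
by apply: DiffDef; [exact: linear_differentiable|exact: diff_lin].
Qed.

Lemma is_diff_snd s : is_diff s (snd : R * R -> R) snd.
Proof.
have c : continuous (snd : R * R -> R) by move=> t; exact: cvg_snd.
by apply: DiffDef; [exact: linear_differentiable|exact: diff_lin].
Qed.

Lemma is_diff_pow i s (p : R * R -> R) : is_diff s p p ->
  is_diff s (fun t => p t ^+ i) (fun v => i%:R * p s ^+ i.-1 * p v).
Proof.
move=> hp; case: i => [|i].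
  have h : is_diff s (cst 1 : R * R -> R) 0 by exact: is_diff_cst.
  apply: is_diff_eq h _.
  by apply/funext => v; rewrite !mul0r.
have -> : (fun t => p t ^+ i.+1) = p ^+ i.+1 by apply/funext => t; rewrite exprfctE.
apply: is_diff_eq (is_diffX i hp) _.
by apply/funext => v; rewrite !fctE.
Qed.

Lemma is_diff_pmono n a s :
  is_diff s (pmono n a) (fun v => pmono1 n a s * v.1 + pmono2 n a s * v.2).
Proof.
have h1 := is_diff_pow (a %/ n.+1) (is_diff_fst s).
have h2 := is_diff_pow (a %% n.+1) (is_diff_snd s).
apply: is_diff_eq (is_diffM h1 h2) _.
apply/funext => v; rewrite /pmono1 /pmono2 !fctE /= -![_ *: _]/(_ * _).
by ring.
Qed.

Lemma is_diff_pev n (u : 'rV[R]_(N n)) s :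
  is_diff s (pev u) (fun v => pev1 u s * v.1 + pev2 u s * v.2).
Proof.
have hs (r : seq 'I_(N n)) : is_diff s (fun s => \sum_(a <- r) u 0 a * pmono n a s)
    (fun v => (\sum_(a <- r) u 0 a * pmono1 n a s) * v.1 +
              (\sum_(a <- r) u 0 a * pmono2 n a s) * v.2).
  elim: r => [|a r IH].
    under eq_fun do rewrite big_nil.
    apply: is_diff_eq (is_diff_cst _ _) _; apply/funext => v.
    by rewrite !big_nil !mul0r addr0.
  under eq_fun do rewrite big_cons.
  apply: is_diff_eq (is_diffD (is_diffZ (u 0 a) (is_diff_pmono n a s)) IH) _.
  apply/funext => v; rewrite !big_cons !fctE /= -![_ *: _]/(_ * _); ring.
exact: hs.
Qed.

Lemma continuous_pev n (u : 'rV[R]_(N n)) s : {for s, continuous (pev u)}.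
Proof. by apply: differentiable_continuous; have [] := is_diff_pev u s. Qed.

Lemma derive_pev n (u : 'rV[R]_(N n)) s v :
  'D_v (pev u) s = pev1 u s * v.1 + pev2 u s * v.2.
Proof.
by have [d h] := is_diff_pev u s; rewrite deriveE // h.
Qed.

Lemma pmono_regular n a : regular (pmono n a).
Proof. exact: regularM (regularX _ regular_fst) (regularX _ regular_snd). Qed.

Lemma pmono1_regular n a : regular (pmono1 n a).
Proof.
apply: regularM (regularX _ regular_snd).
exact: regularM (regular_cst _) (regularX _ regular_fst).
Qed.

Lemma pmono2_regular n a : regular (pmono2 n a).
Proof.
apply: regularM (regularX _ regular_fst) _.
exact: regularM (regular_cst _) (regularX _ regular_snd).
Qed.

Lemma pev_regular n (u : 'rV[R]_(N n)) : regular (pev u).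
Proof. by apply: regular_sum => a _; apply/regularZ/pmono_regular. Qed.

Lemma pev1_regular n (u : 'rV[R]_(N n)) : regular (pev1 u).
Proof. by apply: regular_sum => a _; apply/regularZ/pmono1_regular. Qed.

Lemma pev2_regular n (u : 'rV[R]_(N n)) : regular (pev2 u).
Proof. by apply: regular_sum => a _; apply/regularZ/pmono2_regular. Qed.

(* Kronecker's substitution [s = (t ^+ n.+1, t)] turns the [a]-th monomial into
   [t ^+ a]. *)
Lemma pev_ref_eq0 n (u : 'rV[R]_(N n)) :
  (forall s, ref_tri s -> pev u s = 0) -> u = 0.
Proof.
move=> h; pose p : {poly R} := \poly_(a < N n) (if insub a is Some i then u 0 i else 0).
have pE t : p.[t] = pev u (t ^+ n.+1, t).
  rewrite horner_poly; apply: eq_bigr => a _; rewrite valK /pmono /= -exprM -exprD.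
  by rewrite [X in _ = _ * _ ^+ (X + _)]mulnC -divn_eq.
have p0 : p = 0.
  apply/eqP; apply: contraT => pn0.
  (* At t = 1 / (m + 3) both coordinates of (t ^ n.+1, t) lie between 0 and 1/3, hence the point is
     in the open triangle. This gives [size p] distinct roots, one too many. *)
  pose rs := [seq (m.+3%:R)^-1 : R | m <- iota 0 (size p)].
  have : (size rs < size p)%N.
    apply: (max_poly_roots pn0).
      apply/allP => _ /mapP[m _ ->]; rewrite /root pE h //.
      have m3 : 3 <= m.+3%:R :> R by rewrite ler_nat.
      have t0 : 0 < m.+3%:R^-1 :> R by rewrite invr_gt0.
      have t1 : m.+3%:R^-1 <= 3^-1 :> R by rewrite lef_pV2 ?posrE.
      split => /=; rewrite ?exprn_gt0 //.
      have : m.+3%:R^-1 ^+ n.+1 <= m.+3%:R^-1 :> R.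
        rewrite exprS ler_piMr ?(ltW t0) // exprn_ile1 ?(ltW t0) //.
        by move: t1; set d := m.+3%:R^-1; lra.
      move: t1; set d := m.+3%:R^-1; set e := d ^+ _ => t1; lra.
    rewrite map_inj_uniq ?iota_uniq // => i j /invr_inj /eqP.
    by rewrite eqr_nat => /eqP[].
  by rewrite size_map size_iota ltnn.
apply/rowP => a; have : p`_a = 0 by rewrite p0 coef0.
by rewrite coef_poly ltn_ord valK mxE.
Qed.

(* The Gram matrix of the monomials is invertible, so the coefficients of a
   polynomial are moments of it. *)
Lemma pev_coef_le n : exists2 K : R, 0 < K & forall (u : 'rV[R]_(N n)) a,
  (u 0 a) ^+ 2 <= K * rint (fun s => pev u s ^+ 2).
Proof.
pose G : 'M[R]_(N n) := \matrix_(a, b) rint (fun s => pmono n a s * pmono n b s).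
have GE (u : 'rV[R]_(N n)) b : (u *m G) 0 b = rint (fun s => pev u s * pmono n b s).
  rewrite mxE [RHS](rint_eq (g := fun s => \sum_a u 0 a * (pmono n a s * pmono n b s))).
    rewrite rint_sum; last first.
      by move=> a _; apply: regularZ; apply: regularM; exact: pmono_regular.
    apply: eq_bigr => a _; rewrite mxE rintZ //.
    by apply: regularM; exact: pmono_regular.
  by move=> s _; rewrite /pev mulr_suml; apply: eq_bigr => a _; rewrite mulrA.
have Gu : G \in unitmx.
  rewrite -row_free_unit; apply: inj_row_free => u uG.
  have : rint (fun s => pev u s ^+ 2) = 0.
    rewrite (rint_eq (g := fun s => \sum_b u 0 b * (pev u s * pmono n b s))).
      rewrite rint_sum; last first.
        move=> b _; apply: regularZ; apply: regularM.
          exact: pev_regular.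
        exact: pmono_regular.
      apply: big1 => b _; rewrite rintZ; last first.
        by apply: regularM; [exact: pev_regular|exact: pmono_regular].
      by rewrite -GE uG mxE mulr0.
    move=> s _; rewrite expr2 {2}/pev mulr_sumr; apply: eq_bigr => b _.
    by rewrite mulrCA.
  move=> I0; apply: pev_ref_eq0 => s rs; apply: contrapT => /eqP p0.
  suff : 0 < rint (fun s => pev u s ^+ 2) by rewrite I0 ltxx.
  apply: (rint_gt0 (s0 := s)) => //.
  - exact: regularX (pev_regular u).
  - by move=> t _; exact: sqr_ge0.
  - by rewrite lt_neqAle sqr_ge0 eq_sym sqrf_eq0 p0.
pose A := invmx G; pose K0 := \sum_b \sum_a `|A b a|.
have K00 : 0 <= K0 by apply: sumr_ge0 => b _; apply: sumr_ge0 => a _.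
exists ((K0 + 1) ^+ 2); first by rewrite exprn_gt0 // ltr_wpDl.
move=> u a; set I := rint _.
have I0 : 0 <= I by apply: rint_ge0 => s _; exact: sqr_ge0.
(* The Cauchy-Schwarz inequality, from the integral of the square of [pev u - J * pmono n b]; the
   monomials have L2 norm at most 1. *)
have mom b : `|rint (fun s => pev u s * pmono n b s)| <= Num.sqrt I.
  rewrite -(@ler_pXn2r _ 2) ?nnegrE ?sqrtr_ge0 // sqr_sqrtr // real_normK ?num_real //.
  set J := rint _.
  have : 0 <= rint (fun s => (pev u s - J * pmono n b s) ^+ 2).
    by apply: rint_ge0 => s _; exact: sqr_ge0.
  have rp := pev_regular u; have rm := pmono_regular n b.
  rewrite (rint_eq (g := fun s => pev u s ^+ 2 +
     (- (2 * J) * (pev u s * pmono n b s) + J ^+ 2 * pmono n b s ^+ 2))); last first.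
    by move=> s _; ring.
  have r2 := regularX 2 rp; have r3 := regularM rp rm; have r4 := regularX 2 rm.
  rewrite rintD ?rintD ?rintZ //; last 3 first.
  - exact: regularZ.
  - exact: regularZ.
  - by apply: regularD; exact: regularZ.
  rewrite -/I -/J.
  have : rint (fun s => pmono n b s ^+ 2) <= 1.
    apply: le_trans (rint_cst_le ler01); apply: rint_le => //.
      exact: regular_cst.
    move=> s [h1 h2 h3]; rewrite exprn_ile1 // /pmono ?mulr_ge0 ?exprn_ge0 ?(ltW h1) ?(ltW h2) //.
    by rewrite mulr_ile1 ?exprn_ge0 ?exprn_ile1 //; lra.
  by have := sqr_ge0 J; nra.
have uE : u = (u *m G) *m A by rewrite mulmxK.
have : `|u 0 a| <= (K0 + 1) * Num.sqrt I.
  rewrite {1}uE mxE; apply: le_trans (ler_norm_sum _ _ _) _.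
  apply: (@le_trans _ _ (K0 * Num.sqrt I)); last first.
    by rewrite ler_wpM2r ?sqrtr_ge0 //; lra.
  rewrite mulr_suml; apply: ler_sum => b _; rewrite normrM GE mulrC.
  apply: ler_pM => //; rewrite (bigD1 a) //= lerDl; exact: sumr_ge0.
move=> h; rewrite -real_normK ?num_real // -[X in _ <= _ * X](sqr_sqrtr I0) -exprMn.
by rewrite lerXn2r ?nnegrE // mulr_ge0 ?sqrtr_ge0 //; lra.
Qed.

(** Equivalence of norms in finite dimension: the derivatives of the monomials are bounded on the
    triangle, and the coefficients are controlled by the L2 norm through [pev_coef_le]. *)
Lemma pev_inverse_inequality n : exists2 K : R, 0 < K & forall (u : 'rV[R]_(N n)) s,
  ref_tri s -> pev1 u s ^+ 2 + pev2 u s ^+ 2 <= K * rint (fun s => pev u s ^+ 2).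
Proof.
have [K K0 hK] := pev_coef_le n.
pose M : R := (N n)%:R * n%:R.
have M0 : 0 <= M by rewrite mulr_ge0.
exists (2 * M ^+ 2 * K + 1); first by rewrite ltr_wpDl // !mulr_ge0 ?sqr_ge0 // ltW.
move=> u s [s1 s2 s3]; set I := rint _.
have I0 : 0 <= I by apply: rint_ge0 => t _; exact: sqr_ge0.
have hu a : `|u 0 a| <= Num.sqrt (K * I).
  by rewrite -sqrtr_sqr ler_wsqrtr.
have pw (x : R) i : 0 < x -> x <= 1 -> 0 <= x ^+ i <= 1.
  by move=> x0 x1; rewrite exprn_ge0 ?exprn_ile1 // ltW.
have natle (i j : nat) : (i <= j)%N -> 0 <= (i%:R : R) <= j%:R.
  by move=> ij; rewrite ler0n ler_nat.
have bnd (F : nat -> R) : (forall a : 'I_(N n), 0 <= F a <= n%:R) ->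
    (\sum_a u 0 a * F a) ^+ 2 <= M ^+ 2 * (K * I).
  move=> hF; rewrite -[X in _ <= _ * X]sqr_sqrtr ?mulr_ge0 ?(ltW K0) // -exprMn.
  rewrite -real_normK ?num_real // lerXn2r ?nnegrE //.
    by rewrite mulr_ge0 ?sqrtr_ge0.
  apply: le_trans (ler_norm_sum _ _ _) _.
  apply: (@le_trans _ _ (\sum_(a < N n) (n%:R * Num.sqrt (K * I)))).
    apply: ler_sum => a _; rewrite normrM mulrC; case/andP: (hF a) => F0 F1.
    by apply: ler_pM => //; rewrite ger0_norm.
  by rewrite sumr_const card_ord /M -[in leRHS]mulrA [leRHS]mulr_natl.
have b1 : pev1 u s ^+ 2 <= M ^+ 2 * (K * I).
  apply: (bnd (fun a => pmono1 n a s)) => a.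
  have /andP[p1 p2] := pw s.1 (a %/ n.+1).-1 s1 ltac:(lra).
  have /andP[q1 q2] := pw s.2 (a %% n.+1)%N s2 ltac:(lra).
  have /natle/andP[r1 r2] : (a %/ n.+1 <= n)%N by rewrite -ltnS ltn_divLR.
  rewrite /pmono1 !mulr_ge0 //= (le_trans _ r2) // -mulrA ler_piMr //.
  by rewrite mulr_ile1.
have b2 : pev2 u s ^+ 2 <= M ^+ 2 * (K * I).
  apply: (bnd (fun a => pmono2 n a s)) => a.
  have /andP[p1 p2] := pw s.1 (a %/ n.+1)%N s1 ltac:(lra).
  have /andP[q1 q2] := pw s.2 (a %% n.+1).-1%N s2 ltac:(lra).
  have /natle/andP[r1 r2] : (a %% n.+1 <= n)%N by rewrite -ltnS ltn_pmod.
  rewrite /pmono2 !mulr_ge0 //= (le_trans _ r2) // mulrCA ler_piMr //.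
  by rewrite mulr_ile1.
by move: b1 b2 I0; nra.
Qed.

End PlanePolynomials.

(** * The tubular neighbourhood *)

Section MeanValue.
Context {R : realType}.
Local Notation pt := 'rV[R]_3.
Implicit Types (f : pt -> R) (x v : pt).

Lemma ler_between (c t : R) : 0 <= c <= t \/ t <= c <= 0 -> `|c| <= `|t|.
Proof.
case=> /andP[h1 h2]; last by rewrite !ler0_norm ?lerN2 //; lra.
by rewrite !ger0_norm //; lra.
Qed.

Lemma line_mvt f (z e : pt) (t : R) :
  (forall c : R, `|c| <= `|t| -> derivable f (z + c *: e) e) ->
  exists2 c : R, `|c| <= `|t| & f (z + t *: e) - f z = 'D_e f (z + c *: e) * t.
Proof.
move=> df; pose g (c : R) := f (z + c *: e).
have gE (c : R) : (fun h : R => h^-1 *: ((g \o shift c) (h *: (1 : R)) - g c)) =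
    (fun h : R => h^-1 *: ((f \o shift (z + c *: e)) (h *: e) - f (z + c *: e))).
  apply/funext => h; rewrite /g /= -[h *: 1]/(h * 1) mulr1; congr (_ *: (f _ - _)).
  by rewrite scalerDl addrCA.
have dg (c : R) : `|c| <= `|t| -> is_derive c 1 g ('D_e f (z + c *: e)).
  move=> ct; apply: DeriveDef.
    by rewrite /derivable gE; exact: df.
  by rewrite /derive gE.
have cg (a b : R) : (forall c : R, a <= c <= b -> `|c| <= `|t|) -> {within `[a, b], continuous g}.
  move=> ab; apply: derivable_within_continuous => c; rewrite in_itv /= => /ab ct.
  by have [] := dg c ct.
have [t0|t0] := leP 0 t.
  have bd (c : R) : 0 <= c <= t -> `|c| <= `|t| by move=> h; apply: ler_between; left.
  have dg' (c : R) : c \in `]0, t[ -> is_derive c 1 g ('D_e f (z + c *: e)).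
    rewrite in_itv /= => /andP[h1 h2]; apply/dg/bd; apply/andP; lra.
  have [c] := MVT_segment t0 dg' (cg _ _ bd).
  rewrite in_itv /= => /bd ct; rewrite subr0 => h; exists c => //.
  by rewrite -h /g scale0r addr0.
have bd (c : R) : t <= c <= 0 -> `|c| <= `|t| by move=> h; apply: ler_between; right.
have dg' (c : R) : c \in `]t, 0[ -> is_derive c 1 g ('D_e f (z + c *: e)).
  rewrite in_itv /= => /andP[h1 h2]; apply/dg/bd; apply/andP; lra.
have [c] := MVT_segment (ltW t0) dg' (cg _ _ bd).
rewrite in_itv /= => /bd ct h; exists c => //.
by move: h; rewrite /g scale0r addr0; lra.
Qed.

Lemma basis_vecE (i j : 'I_3) : (basis_vec i : pt) 0 j = (j == i)%:R.
Proof. by rewrite mxE eqxx /= eq_sym. Qed.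

Lemma rV3_basis v :
  v = v 0 0 *: basis_vec 0 + v 0 1 *: basis_vec 1 + v 0 2%:R *: basis_vec 2%:R.
Proof. by apply: rV3P; rewrite !mxE /=; ring. Qed.

(** Only partial derivatives are given, so the increment is taken along the three axes in turn, with
    one intermediate point for each. The path stays in the ball of radius |v| because the norm is
    the maximum norm. *)
Lemma coord_mvt f x v :
  (forall z, `|z - x| <= `|v| -> forall i, derivable f z (basis_vec i)) ->
  exists2 xi : 'I_3 -> pt, forall i, `|xi i - x| <= `|v| &
    f (x + v) - f x = \sum_i 'D_(basis_vec i) f (xi i) * v 0 i.
Proof.
move=> df.
have bnd (a b c : R) : `|a| <= `|v| -> `|b| <= `|v| -> `|c| <= `|v| ->
    `|a *: basis_vec 0 + b *: basis_vec 1 + c *: basis_vec 2%:R| <= `|v|.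
  move=> ha hb hc; apply: normv_le => // i.
  by case: (ord3P i) => ->; rewrite !mxE /= !(mulr1, mulr0, addr0, add0r).
have v0 : `|0 : R| <= `|v| by rewrite normr0.
have nz (z w : pt) : w - x = z -> `|z| <= `|v| -> `|w - x| <= `|v| by move=> ->.
pose x1 := x + v 0 0 *: basis_vec 0.
pose x2 := x1 + v 0 1 *: basis_vec 1.
have d0 c : `|c| <= `|v 0 0| -> `|x + c *: basis_vec 0 - x| <= `|v|.
  move=> h; apply: nz (bnd c 0 0 (le_trans h (normv_coord _ _)) v0 v0).
  by rewrite !scale0r !addr0 addrAC subrr add0r.
have d1 c : `|c| <= `|v 0 1| -> `|x1 + c *: basis_vec 1 - x| <= `|v|.
  move=> h; apply: nz (bnd (v 0 0) c 0 (normv_coord _ _) (le_trans h (normv_coord _ _)) v0).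
  by apply/rowP => i; rewrite !mxE; ring.
have d2 c : `|c| <= `|v 0 2%:R| -> `|x2 + c *: basis_vec 2%:R - x| <= `|v|.
  move=> h; apply: nz (bnd (v 0 0) (v 0 1) c (normv_coord _ _) (normv_coord _ _)
    (le_trans h (normv_coord _ _))).
  by apply/rowP => i; rewrite !mxE; ring.
have [c0 h0 e0] := line_mvt (fun c h => df _ (d0 c h) 0).
have [c1 h1 e1] := line_mvt (fun c h => df _ (d1 c h) 1).
have [c2 h2 e2] := line_mvt (fun c h => df _ (d2 c h) 2%:R).
exists (fun i : 'I_3 => if i == 0 then x + c0 *: basis_vec 0 else
  if i == 1 then x1 + c1 *: basis_vec 1 else x2 + c2 *: basis_vec 2%:R).
  by move=> i; case: (ord3P i) => -> /=; [exact: d0|exact: d1|exact: d2].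
rewrite sum3E /= -e0 -e1 -e2 -/x1 -/x2.
rewrite (_ : x + v = x2 + v 0 2%:R *: basis_vec 2%:R); last first.
  by rewrite {1}[v]rV3_basis /x2 /x1 !addrA.
by ring.
Qed.

Lemma sum3_le (F v : 'I_3 -> R) (M V : R) : 0 <= M ->
  (forall i, `|F i| <= M) -> (forall i, `|v i| <= V) ->
  `|\sum_i F i * v i| <= 3 * M * V.
Proof.
move=> M0 hF hv; apply: le_trans (ler_norm_sum _ _ _) _.
have h i : `|F i * v i| <= M * V by rewrite normrM ler_pM.
by rewrite sum3E; have := h 0; have := h 1; have := h 2%:R; lra.
Qed.

Lemma mvt_lipschitz f x v (M : R) : 0 <= M ->
  (forall z, `|z - x| <= `|v| -> forall i,
     derivable f z (basis_vec i) /\ `|'D_(basis_vec i) f z| <= M) ->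
  `|f (x + v) - f x| <= 3 * M * `|v|.
Proof.
move=> M0 h; have [xi hxi ->] := coord_mvt (fun z hz i => (h z hz i).1).
by apply: sum3_le => // i; [exact: (h _ (hxi i) i).2|exact: normv_coord].
Qed.

Lemma mvt_taylor f x v (M : R) : 0 <= M ->
  (forall z, `|z - x| <= `|v| -> forall i, derivable f z (basis_vec i) /\
     `|'D_(basis_vec i) f z - 'D_(basis_vec i) f x| <= M) ->
  `|f (x + v) - f x - dot (grad f x) v| <= 3 * M * `|v|.
Proof.
move=> M0 h; have [xi hxi ->] := coord_mvt (fun z hz i => (h z hz i).1).
rewrite /dot -sumrB.
under eq_bigr => i _ do rewrite [grad f x 0 i]mxE -mulrBl.
by apply: sum3_le => // i; [exact: (h _ (hxi i) i).2|exact: normv_coord].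
Qed.

Lemma near_ord3 (T : Type) (F : set_system T) {FF : Filter F} (P : 'I_3 -> T -> Prop) :
  (forall i, \forall x \near F, P i x) -> \forall x \near F, forall i, P i x.
Proof.
move=> h; near=> x => i.
by case: (ord3P i) => ->; near: x; exact: h.
Unshelve. all: by end_near. Qed.

Lemma near_ball_le (x : pt) (P : pt -> Prop) : (\forall z \near x, P z) ->
  exists2 e : R, 0 < e & forall z, `|z - x| < e -> P z.
Proof.
move=> /nbhs_normP[e /= e0 he]; exists e => // z hz; apply: he.
by rewrite /= distrC.
Qed.

Lemma near_dist_lt {V : normedModType R} (x : V) (e : R) : 0 < e ->
  \forall z \near x, `|z - x| < e.
Proof.
by move=> e0; apply/nbhs_normP; exists e => //= z; rewrite /= distrC.
Qed.

Lemma near_dist_pt (x : pt) (e : R) : 0 < e -> \forall z \near x, `|z - x| < e.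
Proof. exact: (@near_dist_lt 'rV[R]_3). Qed.

(** Differentiability in epsilon form; boundedness and linearity of [L] are stated separately where
    they are used. *)
Definition approx_lin {V W : normedModType R} (f : V -> W) (x : V) (L : V -> W) :=
  forall e : R, 0 < e -> \forall z \near x, `|f z - f x - L (z - x)| <= e * `|z - x|.

(** Near [x] the partial derivatives oscillate by at most e / 3, and [mvt_taylor] costs a factor
    3. *)
Lemma approx_lin_C1 (U : set pt) f x : open U -> U x -> Cn_on 1 U f ->
  approx_lin f x (dot (grad f x)).
Proof.
move=> oU Ux [_ df] e e0.
have e3 : 0 < e / 3 by rewrite divr_gt0.
have nr : \forall z \near x, forall i, derivable f z (basis_vec i) /\
     `|'D_(basis_vec i) f z - 'D_(basis_vec i) f x| <= e / 3.
  apply: (@near_ord3 _ (nbhs x) _ (fun i z => derivable f z (basis_vec i) /\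
     `|'D_(basis_vec i) f z - 'D_(basis_vec i) f x| <= e / 3)) => i; apply: filterI.
    near=> z; apply: (df i).1; near: z.
    by apply: open_nbhs_nbhs; split.
  have c := (df i).2.1 x Ux.
  by move/cvgrPdistC_le: c => /(_ _ e3).
have [r r0 hr] := near_ball_le nr.
near=> z.
have zr : `|z - x| < r by near: z; exact: near_dist_pt.
have -> : f z = f (x + (z - x)) by rewrite addrC subrK.
apply: le_trans (mvt_taylor (ltW e3) _) _.
  by move=> w hw; apply: hr; apply: le_lt_trans zr.
by rewrite mulrCA divff // mulr1.
Unshelve. all: by end_near. Qed.

Lemma approx_lin_bounded {V : normedModType R} (f : V -> R) (x : V) L (K : R) :
  approx_lin f x L -> (forall w, `|L w| <= K * `|w|) ->
  \forall z \near x, `|f z - f x| <= (K + 1) * `|z - x|.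
Proof.
move=> hf hL; near=> z.
have : `|f z - f x - L (z - x)| <= 1 * `|z - x| by near: z; exact: hf.
have := hL (z - x); have := ler_normD (f z - f x - L (z - x)) (L (z - x)).
by rewrite subrK; lra.
Unshelve. all: by end_near. Qed.

Lemma approx_linM {V : normedModType R} (f g : V -> R) (x : V) Lf Lg (K : R) : 0 <= K ->
  approx_lin f x Lf -> approx_lin g x Lg ->
  (forall w, `|Lf w| <= K * `|w|) -> (forall w, `|Lg w| <= K * `|w|) ->
  approx_lin (fun z => f z * g z) x (fun w => f x * Lg w + g x * Lf w).
Proof.
move=> K0 hf hg bf bg e e0.
(* [A] bounds the sum of the coefficients of the three error terms in the expansion of the product,
   each of size [d] times the distance. *)
pose A := `|f x| + `|g x| + (K + 1) ^+ 2 + 1.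
have K1 := sqr_ge0 (K + 1).
have f0 := normr_ge0 (f x); have g0 := normr_ge0 (g x).
have A0 : 0 < A by rewrite /A; lra.
pose d := e / A.
have d0 : 0 < d by rewrite divr_gt0.
near=> z.
have h1 : `|f z - f x - Lf (z - x)| <= d * `|z - x| by near: z; exact: hf.
have h2 : `|g z - g x - Lg (z - x)| <= d * `|z - x| by near: z; exact: hg.
have h3 : `|f z - f x| <= (K + 1) * `|z - x| by near: z; exact: approx_lin_bounded hf bf.
have h4 : `|g z - g x| <= (K + 1) * `|z - x| by near: z; exact: approx_lin_bounded hg bg.
have h5 : `|z - x| < d by near: z; exact: near_dist_lt.
have -> : f z * g z - f x * g x - (f x * Lg (z - x) + g x * Lf (z - x)) =
  f x * (g z - g x - Lg (z - x)) + g x * (f z - f x - Lf (z - x)) +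
  (f z - f x) * (g z - g x) by ring.
apply: le_trans (ler_normD _ _) _.
apply: le_trans (lerD (ler_normD _ _) (lexx _)) _; rewrite !normrM.
have z0 := normr_ge0 (z - x).
have k1 : `|f x| * `|g z - g x - Lg (z - x)| <= `|f x| * (d * `|z - x|).
  by rewrite ler_wpM2l.
have k2 : `|g x| * `|f z - f x - Lf (z - x)| <= `|g x| * (d * `|z - x|).
  by rewrite ler_wpM2l.
have k3 : `|f z - f x| * `|g z - g x| <= (K + 1) ^+ 2 * (d * `|z - x|).
  apply: (@le_trans _ _ (((K + 1) * `|z - x|) * ((K + 1) * `|z - x|))).
    exact: ler_pM.
  rewrite (_ : _ * _ = (K + 1) ^+ 2 * (`|z - x| * `|z - x|)); last by ring.
  by rewrite ler_wpM2l // ler_wpM2r // ltW.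
have -> : e = d * A by rewrite /d divfK // gt_eqF.
have dz : 0 <= d * `|z - x| by rewrite mulr_ge0 // ltW.
by rewrite /A; lra.
Unshelve. all: by end_near. Qed.

Lemma approx_linB {V W : normedModType R} (f g : V -> W) (x : V) Lf Lg :
  approx_lin f x Lf -> approx_lin g x Lg ->
  approx_lin (fun z => f z - g z) x (fun w => Lf w - Lg w).
Proof.
move=> hf hg e e0; have e2 : 0 < e / 2 by rewrite divr_gt0.
near=> z.
have h1 : `|f z - f x - Lf (z - x)| <= e / 2 * `|z - x| by near: z; exact: hf.
have h2 : `|g z - g x - Lg (z - x)| <= e / 2 * `|z - x| by near: z; exact: hg.
have -> : f z - g z - (f x - g x) - (Lf (z - x) - Lg (z - x)) =
  (f z - f x - Lf (z - x)) - (g z - g x - Lg (z - x)).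
  by rewrite !opprD !opprK (addrACA (f z)) (addrACA (f z - f x)).
by have := ler_normB (f z - f x - Lf (z - x)) (g z - g x - Lg (z - x)); lra.
Unshelve. all: by end_near. Qed.

Lemma approx_lin_row {V : normedModType R} (f : V -> pt) (x : V) (L : V -> pt) :
  (forall i, approx_lin (fun z => f z 0 i) x (fun w => L w 0 i)) -> approx_lin f x L.
Proof.
move=> h e e0; have FF : Filter (nbhs x) by typeclasses eauto.
have := @near_ord3 _ (nbhs x) FF _ (fun i => h i e e0).
apply: filterS => z hz; apply: normv_le => [|i]; first by rewrite mulr_ge0 // ltW.
by have := hz i; rewrite !mxE.
Qed.

Lemma approx_lin_coord (x : pt) i : approx_lin (fun z : pt => z 0 i) x (fun w => w 0 i).
Proof.
move=> e e0; near=> z; rewrite !mxE subrr normr0 mulr_ge0 //; exact: ltW.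
Unshelve. all: by end_near. Qed.

End MeanValue.

(** * Uniform estimates for the signed distance and the closest point projection *)

Section Tube.
Context {R : realType}.
Local Notation pt := 'rV[R]_3.
Variables (Gamma : set pt) (delta : R).
Hypotheses (surfG : smooth_closed_surface Gamma) (tubeG : tubular Gamma delta).
Local Notation d := (sdist Gamma).
Local Notation n := (normal Gamma).
Local Notation U := (U_ Gamma delta).

Lemma sdist0 p : Gamma p -> d p = 0.
Proof.
move=> Gp; have d0 : dist Gamma p = 0.
  apply/eqP; rewrite eq_le; apply/andP; split.
    apply: ge_inf; first by exists 0 => _ [y _ <-]; exact: enorm_ge0.
    by exists p => //; rewrite subrr /enorm dot0l sqrtr0.
  apply: lb_le_inf; first by exists (enorm (p - p)), p.
  by move=> _ [y _ <-]; exact: enorm_ge0.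
by rewrite /sdist d0 oppr0; case: ifP.
Qed.

Lemma tube_surface p : Gamma p -> U p.
Proof. by move=> Gp; rewrite /U_ /= sdist0 // normr0; case: tubeG. Qed.

Lemma closest_pt_mem x : U x -> Gamma (closest_pt Gamma x).
Proof.
move=> Ux; case: tubeG => _ _ /(_ x Ux (closest_pt Gamma x) (d x))[_ h].
by have [] := h (conj erefl erefl).
Qed.

Lemma open_tube : open U.
Proof.
case: tubeG => _ /(_ 0%N) [cd _] _; rewrite openE => x Ux.
have c := cd x Ux.
have e0 : 0 < delta - `|d x| by rewrite subr_gt0.
move/cvgrPdistC_lt: c => /(_ _ e0).
apply: filterS => z hz; rewrite /U_ /=.
by have := ler_normD (d z - d x) (d x); rewrite subrK; lra.
Qed.

Lemma normalE x i : n x 0 i = 'D_(basis_vec i) d x.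
Proof. by rewrite mxE. Qed.

Lemma normalE_fun i : (fun x => n x 0 i) = (fun x => 'D_(basis_vec i) d x).
Proof. by apply/funext => x; rewrite normalE. Qed.

(** Local bounds become uniform by compactness of [Gamma]. The bound is taken as the inverse of the
    radius, so that the single filter r -> 0+ carries both through the covering argument. *)
Lemma tube_bounds : exists2 r : R, 0 < r & exists2 M : R, 0 < M &
  forall p x, Gamma p -> `|x - p| < r ->
  [/\ U x, forall i, derivable d x (basis_vec i) /\ `|'D_(basis_vec i) d x| <= M &
    forall i j, derivable (fun z => n z 0 i) x (basis_vec j) /\
      `|'D_(basis_vec j) (fun z => n z 0 i) x| <= M].
Proof.
case: tubeG => _ sm _; case: surfG => _ cG _ _.
pose P (M : R) x := [/\ U x,
    forall i, derivable d x (basis_vec i) /\ `|'D_(basis_vec i) d x| <= M &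
    forall i j, derivable (fun z => n z 0 i) x (basis_vec j) /\
      `|'D_(basis_vec j) (fun z => n z 0 i) x| <= M].
have loc p : Gamma p -> exists2 K : R, 0 < K & \forall x \near p, P K x.
  move=> Gp; have Up := tube_surface Gp.
  have nU : \forall x \near p, U x by apply: open_nbhs_nbhs; split => //; exact: open_tube.
  have bnd (g : pt -> R) (K : R) : {for p, continuous g} -> `|g p| + 1 <= K ->
      \forall x \near p, `|g x| <= K.
    move=> c gK; move/cvgrPdistC_lt: c => /(_ _ ltr01).
    apply: filterS => z hz.
    by have := ler_normD (g z - g p) (g p); rewrite subrK; lra.
  pose K := 1 + \sum_i `|'D_(basis_vec i) d p| +
    \sum_i \sum_j `|'D_(basis_vec j) (fun z => n z 0 i) p|.
  have s1 : 0 <= \sum_i `|'D_(basis_vec i) d p| by exact: sumr_ge0.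
  have s2 : 0 <= \sum_i \sum_j `|'D_(basis_vec j) (fun z => n z 0 i) p|.
    by apply: sumr_ge0 => i _; exact: sumr_ge0.
  exists K; first by rewrite /K; lra.
  have [_ C2] := sm 2%N.
  have n1 : \forall x \near p, forall i,
      derivable d x (basis_vec i) /\ `|'D_(basis_vec i) d x| <= K.
    apply: (@near_ord3 _ (nbhs p) _ (fun i x =>
      derivable d x (basis_vec i) /\ `|'D_(basis_vec i) d x| <= K)) => i.
    apply: filterI; first by apply: filterS nU => x; exact: (C2 i).1.
    apply: bnd; first exact: (C2 i).2.1.
    rewrite /K (bigD1 i) //=.
    have : 0 <= \sum_(j < 3 | j != i) `|'D_(basis_vec j) d p| by exact: sumr_ge0.
    lra.
  have n2 : \forall x \near p, forall i j, derivable (fun z => n z 0 i) x (basis_vec j) /\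
      `|'D_(basis_vec j) (fun z => n z 0 i) x| <= K.
    apply: (@near_ord3 _ (nbhs p) _ (fun i x => forall j,
      derivable (fun z => n z 0 i) x (basis_vec j) /\
      `|'D_(basis_vec j) (fun z => n z 0 i) x| <= K)) => i.
    apply: (@near_ord3 _ (nbhs p) _ (fun j x => derivable (fun z => n z 0 i) x (basis_vec j) /\
      `|'D_(basis_vec j) (fun z => n z 0 i) x| <= K)) => j.
    have [_ /(_ j)[D2 [C _]]] := (C2 i).2; rewrite -normalE_fun in D2 C.
    apply: filterI; first by apply: filterS nU => x; exact: D2.
    apply: bnd; first exact: C.
    have hj : `|'D_(basis_vec j) (fun z => n z 0 i) p| <=
        \sum_k `|'D_(basis_vec k) (fun z => n z 0 i) p|.
      by rewrite (bigD1 j) //= lerDl; exact: sumr_ge0.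
    have hi : \sum_k `|'D_(basis_vec k) (fun z => n z 0 i) p| <=
        \sum_l \sum_k `|'D_(basis_vec k) (fun z => n z 0 l) p|.
      rewrite [leRHS](bigD1 i) //= lerDl; apply: sumr_ge0 => l _; exact: sumr_ge0.
    rewrite /K; lra.
  by near=> x; split; near: x.
have FF : Filter (0 : R)^'+ by typeclasses eauto.
have cov := (@compact_near_coveringP _ Gamma).1 cG R (0^'+)
  (fun r p => forall x, `|x - p| < r -> P r^-1 x) FF.
have : \forall r \near 0^'+, forall p, Gamma p -> forall x, `|x - p| < r -> P r^-1 x.
  apply: cov => p Gp; have [K K0 /near_ball_le[e e0 he]] := loc p Gp.
  exists ([set z | `|z - p| < e / 2], [set r | 0 < r < Num.min (e / 2) K^-1]).
    split=> /=; first by apply: near_dist_pt; rewrite divr_gt0.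
    have m0 : 0 < Num.min (e / 2) K^-1 by rewrite lt_min divr_gt0 ?invr_gt0.
    near=> r; apply/andP; split; near: r.
      exact: nbhs_right_gt.
    exact: nbhs_right_lt.
  move=> [z r] /= [hz /andP[r0]]; rewrite lt_min => /andP[r1 r2] x hx.
  have [|Ux D1 D2] := he x.
    by have := ler_normD (x - z) (z - p); rewrite addrA subrK; lra.
  have Kr : K <= r^-1 by rewrite -[K]invrK lef_pV2 ?posrE ?invr_gt0 // ltW.
  split=> // [i|i j]; first by have [? h] := D1 i; split=> //; exact: le_trans h Kr.
  by have [? h] := D2 i j; split=> //; exact: le_trans h Kr.
move=> h; have [r [r0 hr]] : exists r : R, 0 < r /\
    forall p, Gamma p -> forall x, `|x - p| < r -> P r^-1 x.
  near (0 : R)^'+ => r; exists r; split; near: r; [exact: nbhs_right_gt|exact: h].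
exists r => //; exists r^-1; first by rewrite invr_gt0.
by move=> p x Gp hx; exact: hr hx.
Unshelve. all: by end_near. Qed.

(* The differential of the closest point projection at [x]. *)
Definition dclosest x (w : pt) : pt := w - dot (n x) w *: n x -
  d x *: \row_i dot (grad (fun z => n z 0 i) x) w.

Lemma dclosestE x w i : dclosest x w 0 i =
  w 0 i - dot (n x) w * n x 0 i - d x * dot (grad (fun z => n z 0 i) x) w.
Proof.
have rowE (a : pt) (b : 'I_3 -> R) c e : (w - c *: a - e *: \row_j b j) 0 i =
    w 0 i - c * a 0 i - e * b i by rewrite !mxE.
exact: rowE.
Qed.

Lemma dclosestD x v w : dclosest x (v + w) = dclosest x v + dclosest x w.
Proof.
apply/rowP => i; rewrite [RHS]mxE !dclosestE [(v + w) 0 i]mxE !dotDr.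
by move: (n x) (grad _ x) => a b; ring.
Qed.

Lemma dclosestZ x c w : dclosest x (c *: w) = c *: dclosest x w.
Proof.
apply/rowP => i; rewrite [RHS]mxE !dclosestE [(c *: w) 0 i]mxE !dotZr.
by move: (n x) (grad _ x) => a b; ring.
Qed.

Lemma approx_lin_closest x : U x -> approx_lin (closest_pt Gamma) x (dclosest x).
Proof.
move=> Ux; case: tubeG => _ sm _.
have oU := open_tube.
have C1 : Cn_on 1 U d := sm 1%N.
have C2 i : Cn_on 1 U (fun z => n z 0 i).
  by have [_ /(_ i)[_]] := sm 2%N; rewrite normalE_fun.
apply: approx_lin_row => i.
pose K := 3 * `|n x| + 3 * `|grad (fun z => n z 0 i) x|.
have K1 := normr_ge0 (n x); have K2 := normr_ge0 (grad (fun z => n z 0 i) x).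
have := approx_linM (K := K) _ (approx_lin_C1 oU Ux C1) (approx_lin_C1 oU Ux (C2 i)) _ _.
rewrite -/(n x) => /(_ _ _ _) hM.
have {}hM : approx_lin (fun z => d z * n z 0 i) x
    (fun w => d x * dot (grad (fun z => n z 0 i) x) w + n x 0 i * dot (n x) w).
  apply: hM; first by rewrite /K; lra.
    move=> w; apply: le_trans (normr_dot_le _ _) _; rewrite ler_wpM2r //.
    by rewrite /K; lra.
  move=> w; apply: le_trans (normr_dot_le _ _) _; rewrite ler_wpM2r //.
  by rewrite /K; lra.
have := approx_linB (approx_lin_coord x i) hM.
congr (approx_lin _ _ _); apply/funext => z.
  by rewrite /closest_pt; move: (n z) => a; rewrite !mxE.
by rewrite dclosestE; move: (n x) (grad _ x) => a b; ring.
Qed.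

(** The distance vanishes at [p] and its gradient is Lipschitz, hence the quadratic remainder. The
    last bound reads off [dclosest]: it differs from the identity by a normal component and by a
    term with the factor d, which is small near the surface. *)
Lemma tube_geometry : exists2 r : R, 0 < r & exists2 C : R, 0 < C &
  forall p x, Gamma p -> `|x - p| < r ->
  [/\ U x, `|n x| <= C, `|n x - n p| <= C * `|x - p|,
      `|d x - dot (n p) (x - p)| <= C * `|x - p| ^+ 2 &
      forall w, `|dclosest x w - w| <= C * (`|dot (n x) w| + `|d x| * `|w|)].
Proof.
have [r r0 [M M0 hM]] := tube_bounds.
(* The largest constant met is 9 M: the Lipschitz constant 3 M of the normal enters the Taylor
   remainder with another factor 3. *)
exists r => //; exists (10 * M) => [|p x Gp hx]; first by rewrite mulr_gt0.
have [Ux D1 D2] := hM p x Gp hx.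
have xE : x = p + (x - p) by rewrite addrC subrK.
have lip z i : `|z - p| < r -> `|n z 0 i - n p 0 i| <= 3 * M * `|z - p|.
  move=> hz; rewrite {1}(_ : z = p + (z - p)); last by rewrite addrC subrK.
  apply: (mvt_lipschitz (f := fun z => n z 0 i)); first exact: ltW.
  by move=> w hw j; have [_ _] := hM p w Gp (le_lt_trans hw hz).
have x0 := normr_ge0 (x - p).
have n10 : `|n x| <= M.
  by apply: normv_le => [|i]; [exact: ltW|rewrite normalE; exact: (D1 i).2].
split => //.
- by apply: le_trans n10 _; lra.
- apply: (@le_trans _ _ (3 * M * `|x - p|)); last by rewrite ler_wpM2r //; lra.
  apply: normv_le => [|i]; first by rewrite !mulr_ge0 // ltW.
  have -> : (n x - n p) 0 i = n x 0 i - n p 0 i by move: (n x) (n p) => a b; rewrite !mxE.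
  exact: lip.
- have := @mvt_taylor _ d p (x - p) (3 * M * `|x - p|).
  rewrite -xE (sdist0 Gp) subr0 => h; apply: le_trans (h _ _) _.
  + by rewrite !mulr_ge0 // ltW.
  + move=> z hz i; have hz' := le_lt_trans hz hx.
    have [_ /(_ i)[? _] _] := hM p z Gp hz'; split => //; rewrite -!normalE.
    by apply: le_trans (lip z i hz') _; rewrite ler_wpM2l //; lra.
  + by rewrite expr2; have := mulr_ge0 (ltW M0) (mulr_ge0 x0 x0); lra.
move=> w; have w0 := normr_ge0 w; have nw0 := normr_ge0 (dot (n x) w).
have d0 := normr_ge0 (d x).
apply: normv_le => [|i]; first by rewrite mulr_ge0 ?addr_ge0 ?mulr_ge0 // ltW.
have -> : (dclosest x w - w) 0 i =
    - (dot (n x) w * n x 0 i + d x * dot (grad (fun z => n z 0 i) x) w).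
  rewrite [LHS]mxE dclosestE [(- w) 0 i]mxE.
  by move: (n x) (grad _ x) => a b; ring.
rewrite normrN; apply: le_trans (ler_normD _ _) _; rewrite !normrM.
have h1 : `|dot (n x) w| * `|n x 0 i| <= `|dot (n x) w| * M.
  by rewrite ler_wpM2l // (le_trans (normv_coord _ _)).
have g1 : `|grad (fun z => n z 0 i) x| <= M.
  by apply: normv_le => [|j]; [exact: ltW|rewrite mxE; exact: (D2 i j).2].
have h2 : `|d x| * `|dot (grad (fun z => n z 0 i) x) w| <= `|d x| * (3 * M * `|w|).
  rewrite ler_wpM2l // (le_trans (normr_dot_le _ _)) // ler_wpM2r //.
  by rewrite ler_wpM2l.
have h3 := mulr_ge0 d0 (mulr_ge0 (ltW M0) w0).
have h4 := mulr_ge0 nw0 (ltW M0).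
lra.
Qed.

Lemma continuous_normal x i : U x -> {for x, continuous (fun z => n z 0 i)}.
Proof.
move=> Ux; case: tubeG => _ /(_ 1%N)[_ /(_ i)[_ [c _]]] _.
by rewrite normalE_fun; exact: c.
Qed.

End Tube.

(** * Parametrized faces *)

Section Faces.
Context {R : realType}.
Local Notation pt := 'rV[R]_3.
Local Notation triangle := 'M[R]_3.
Implicit Types (T : triangle) (s : R * R) (l : pt) (Gamma : set pt).

Definition lam s : pt := (1 - s.1 - s.2) *: basis_vec 0 + s.1 *: basis_vec 1 +
  s.2 *: basis_vec 2%:R.

Lemma lamE s : (lam s 0 0 = 1 - s.1 - s.2) * (lam s 0 1 = s.1) * (lam s 0 2%:R = s.2).
Proof. by rewrite !mxE /=; do !split; ring. Qed.

Lemma lam_sum s : \sum_i lam s 0 i = 1.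
Proof. by rewrite sum3E !lamE; ring. Qed.

Lemma lam_inj s s' : lam s = lam s' -> s = s'.
Proof.
move=> e; have := congr1 (fun l : pt => l 0 1) e; have := congr1 (fun l : pt => l 0 2%:R) e.
by rewrite /= !lamE; case: s s' {e} => ? ? [? ?] /= -> ->.
Qed.

Lemma mulmx_rows l T : l *m T = l 0 0 *: row 0 T + l 0 1 *: row 1 T + l 0 2%:R *: row 2%:R T.
Proof. by rewrite mulmx_sum_row sum3E. Qed.

Lemma ref_mapE T s : ref_map T s = lam s *m T.
Proof. by rewrite mulmx_rows !lamE. Qed.

Lemma lam_surj l : \sum_i l 0 i = 1 -> l = lam (l 0 1, l 0 2%:R).
Proof. by rewrite sum3E => h; apply: rV3P; rewrite !lamE //=; lra. Qed.

Lemma cref_lam s : cref_tri s <-> forall i, 0 <= lam s 0 i.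
Proof.
split=> [[h1 h2 h3] i|h].
  by case: (ord3P i) => ->; rewrite !lamE //; lra.
by have := h 0; have := h 1; have := h 2%:R; rewrite !lamE; split; lra.
Qed.

Lemma ref_lam s : ref_tri s <-> forall i, 0 < lam s 0 i.
Proof.
split=> [[h1 h2 h3] i|h].
  by case: (ord3P i) => ->; rewrite !lamE //; lra.
by have := h 0; have := h 1; have := h 2%:R; rewrite !lamE; split; lra.
Qed.

Lemma triP T x : tri T x <-> exists2 s, cref_tri s & x = ref_map T s.
Proof.
split=> [[l [l1 l0 _] <-]|[s rs ->]].
  exists (l 0 1, l 0 2%:R); last by rewrite ref_mapE -lam_surj.
  by apply/cref_lam => i; rewrite -lam_surj.
rewrite ref_mapE; exists (lam s) => //; split=> //.
- exact: lam_sum.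
- exact/cref_lam.
- by move=> i /(_ I).
Qed.

Definition edge1 T : pt := row 1 T - row 0 T.
Definition edge2 T : pt := row 2%:R T - row 0 T.

Lemma ref_map_edge T s : ref_map T s = row 0 T + (s.1 *: edge1 T + s.2 *: edge2 T).
Proof. by apply/rowP => i; rewrite !mxE; ring. Qed.

Lemma bary_mulmx T l : nondegenerate T -> \sum_i l 0 i = 1 -> bary T (l *m T) = l.
Proof.
move=> nT l1; rewrite /bary.
have -> : row_mx (l *m T) (const_mx 1 : 'M[R]_1) =
    l *m row_mx T (const_mx 1 : 'cV[R]_3).
  rewrite mul_mx_row; congr row_mx; apply/matrixP => i j.
  rewrite [LHS]mxE -[LHS]l1 [RHS]mxE; apply: eq_bigr => a _.
  by rewrite [const_mx _ _ _]mxE mulr1 (ord1 i).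
by rewrite mulmxKp.
Qed.

Lemma mulmx_face_inj T l l' : nondegenerate T -> \sum_i l 0 i = 1 ->
  \sum_i l' 0 i = 1 -> l *m T = l' *m T -> l = l'.
Proof. by move=> nT h h' e; rewrite -(bary_mulmx nT h) e bary_mulmx. Qed.

Lemma ref_map_inj T s s' : nondegenerate T -> ref_map T s = ref_map T s' -> s = s'.
Proof.
move=> nT; rewrite !ref_mapE => e; apply: lam_inj.
exact: (mulmx_face_inj nT (lam_sum _) (lam_sum _) e).
Qed.

Local Notation mi k := {ffun 'I_3 -> 'I_k.+1}.

Definition node (k : nat) (al : mi k) : pt := node_bary k (fun i => al i).

Definition pi_node Gamma k T (al : mi k) : pt := closest_pt Gamma (node al *m T).

Definition lagr k (al : mi k) s : R := lagrange_basis k (fun i => al i) (lam s).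

Lemma proj_faceE Gamma k T l : nondegenerate T -> \sum_i l 0 i = 1 ->
  proj_face Gamma k T (l *m T) =
  \sum_(al : mi k | (\sum_i al i == k)%N)
    lagrange_basis k (fun i => al i) l *: pi_node Gamma T al.
Proof. by move=> nT l1; rewrite /proj_face bary_mulmx. Qed.

Lemma paramE Gamma k T s : nondegenerate T ->
  param Gamma k T s =
  \sum_(al : mi k | (\sum_i al i == k)%N) lagr al s *: pi_node Gamma T al.
Proof. by move=> nT; rewrite /param ref_mapE proj_faceE // lam_sum. Qed.

Lemma node_sum k (al : mi k) : (0 < k)%N -> (\sum_i al i == k)%N -> \sum_i node al 0 i = 1.
Proof.
move=> k0 /eqP sal; under eq_bigr do rewrite mxE.
by rewrite -mulr_suml -natr_sum sal divff // pnatr_eq0 -lt0n.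
Qed.

Lemma node_ge0 k (al : mi k) i : 0 <= node al 0 i.
Proof. by rewrite mxE divr_ge0. Qed.

Lemma lagr_reproduce k T s : (0 < k)%N ->
  \sum_(al : mi k | (\sum_i al i == k)%N) lagr al s *: (node al *m T) = ref_map T s.
Proof.
move=> k0; rewrite ref_mapE.
under eq_bigr do rewrite scalemxAl.
rewrite -mulmx_suml; congr (_ *m _); apply/rowP => i.
rewrite summxE -[RHS](lagrange_linear i k0 (lam_sum s)).
by apply: eq_bigr => al _; rewrite !mxE mulrC.
Qed.

Local Notation N k := ((3 * k).+1 * (3 * k).+1)%N.

Lemma lam_pfun i : pfun 1 (fun s => lam s 0 i).
Proof.
case: (ord3P i) => ->.
- by apply: eq_pfun (pfun_affine 1 (-1) (-1)) => s; rewrite lamE; ring.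
- by apply: eq_pfun (pfun_affine 0 1 0) => s; rewrite lamE; ring.
- by apply: eq_pfun (pfun_affine 0 0 1) => s; rewrite lamE; ring.
Qed.

(** Each of the three factors is counted with degree [k] instead of [al i], so that the bound 3 k is
    the same for all basis functions. *)
Lemma lagr_pfun k (al : mi k) : pfun (3 * k) (lagr al).
Proof.
have h i : pfun k (fun s => \prod_(j < al i) ((k%:R * lam s 0 i - j%:R) / j.+1%:R)).
  have hj (j : 'I_(al i)) : pfun 1 (fun s => (k%:R * lam s 0 i - j%:R) / j.+1%:R).
    apply: eq_pfun (pfunZ j.+1%:R^-1 (pfunD (pfunZ k%:R (lam_pfun i)) (pfun_cst 1 (- j%:R)))) => s.
    by rewrite mulrC.
  have := pfun_prod (index_enum _) hj; apply: pfun_widen.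
  by rewrite sum1_card card_ord -ltnS.
have := pfun_prod (index_enum _) h; rewrite sum_nat_const card_ord.
exact: eq_pfun.
Qed.

Definition lagr_coef k (al : mi k) : 'rV[R]_(N k) := projT1 (cid (lagr_pfun al)).

Lemma lagr_coefE k (al : mi k) : lagr al =1 pev (lagr_coef al).
Proof. exact: projT2 (cid (lagr_pfun al)). Qed.

(** The monomials and their derivatives are bounded on the closed triangle, and there are finitely
    many multi-indices of a given degree. *)
Lemma lagr_bounded k : exists2 K : R, 0 < K & forall (al : mi k) s, cref_tri s ->
  [/\ `|pev (lagr_coef al) s| <= K, `|pev1 (lagr_coef al) s| <= K &
      `|pev2 (lagr_coef al) s| <= K].
Proof.
pose B (al : mi k) : R := \sum_a `|lagr_coef al 0 a| * (3 * k).+1%:R.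
have B0 al : 0 <= B al by apply: sumr_ge0 => a _; rewrite mulr_ge0.
exists (1 + \sum_al B al); first by rewrite ltr_pwDl // sumr_ge0.
move=> al s [s1 s2 s3].
have BK : B al <= 1 + \sum_al B al.
  rewrite (bigD1 al) //= addrCA lerDl addr_ge0 // sumr_ge0 //.
have pw (x : R) i : 0 <= x -> x <= 1 -> 0 <= x ^+ i <= 1.
  by move=> x0 x1; rewrite exprn_ge0 ?exprn_ile1.
have key (F : nat -> R) : (forall a : 'I_(N k), 0 <= F a <= (3 * k).+1%:R) ->
    `|\sum_a lagr_coef al 0 a * F a| <= 1 + \sum_al B al.
  move=> hF; apply: le_trans BK; apply: le_trans (ler_norm_sum _ _ _) _.
  apply: ler_sum => a _; rewrite normrM; case/andP: (hF a) => F0 F1.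
  by rewrite ler_wpM2l // ger0_norm.
have natle (i : nat) : (i <= 3 * k)%N -> 0 <= (i%:R : R) <= (3 * k).+1%:R.
  by move=> ij; rewrite ler0n ler_nat leqW.
have one : 1 <= (3 * k).+1%:R :> R by rewrite ler1n.
have s11 : s.1 <= 1 by lra.
have s21 : s.2 <= 1 by lra.
split.
- apply: (key (fun a => pmono (3 * k) a s)) => a.
  have /andP[p1 p2] := pw s.1 (a %/ (3 * k).+1)%N s1 s11.
  have /andP[q1 q2] := pw s.2 (a %% (3 * k).+1)%N s2 s21.
  by rewrite /pmono mulr_ge0 //= (le_trans _ one) // mulr_ile1.
- apply: (key (fun a => pmono1 (3 * k) a s)) => a.
  have /andP[p1 p2] := pw s.1 (a %/ (3 * k).+1).-1%N s1 s11.
  have /andP[q1 q2] := pw s.2 (a %% (3 * k).+1)%N s2 s21.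
  have /natle/andP[r1 r2] : (a %/ (3 * k).+1 <= 3 * k)%N by rewrite -ltnS ltn_divLR.
  rewrite /pmono1 !mulr_ge0 //= (le_trans _ r2) // -mulrA ler_piMr //.
  by rewrite mulr_ile1.
- apply: (key (fun a => pmono2 (3 * k) a s)) => a.
  have /andP[p1 p2] := pw s.1 (a %/ (3 * k).+1)%N s1 s11.
  have /andP[q1 q2] := pw s.2 (a %% (3 * k).+1).-1%N s2 s21.
  have /natle/andP[r1 r2] : (a %% (3 * k).+1 <= 3 * k)%N by rewrite -ltnS ltn_pmod.
  rewrite /pmono2 !mulr_ge0 //= (le_trans _ r2) // mulrCA ler_piMr //.
  by rewrite mulr_ile1.
Qed.

Definition param_coef Gamma k T (i : 'I_3) : 'rV[R]_(N k) :=
  \sum_(al : mi k | (\sum_i al i == k)%N) pi_node Gamma T al 0 i *: lagr_coef al.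

Lemma pev_sum (I : Type) n (r : seq I) (P : pred I) (c : I -> R)
    (u : I -> 'rV[R]_(n.+1 * n.+1)) :
  (pev (\sum_(i <- r | P i) c i *: u i) =1 fun s => \sum_(i <- r | P i) c i * pev (u i) s) *
  (pev1 (\sum_(i <- r | P i) c i *: u i) =1 fun s => \sum_(i <- r | P i) c i * pev1 (u i) s) *
  (pev2 (\sum_(i <- r | P i) c i *: u i) =1 fun s => \sum_(i <- r | P i) c i * pev2 (u i) s).
Proof.
have key (F : nat -> R * R -> R) s :
    \sum_a (\sum_(i <- r | P i) c i *: u i) 0 a * F a s =
    \sum_(i <- r | P i) c i * (\sum_a u i 0 a * F a s).
  under [RHS]eq_bigr do rewrite mulr_sumr.
  rewrite exchange_big /=; apply: eq_bigr => a _.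
  rewrite summxE mulr_suml; apply: eq_bigr => i _.
  by rewrite mxE mulrA.
by do !split; move=> s; rewrite /pev /pev1 /pev2 key.
Qed.

Lemma param_coefE Gamma k T s i : nondegenerate T ->
  param Gamma k T s 0 i = pev (param_coef Gamma k T i) s.
Proof.
move=> nT; rewrite paramE // summxE pev_sum; apply: eq_bigr => al _.
by rewrite mxE mulrC lagr_coefE.
Qed.

Definition dparam1 Gamma k T s : pt := \row_i pev1 (param_coef Gamma k T i) s.
Definition dparam2 Gamma k T s : pt := \row_i pev2 (param_coef Gamma k T i) s.

Lemma derive_param Gamma k T s v : nondegenerate T ->
  'D_v (param Gamma k T) s = v.1 *: dparam1 Gamma k T s + v.2 *: dparam2 Gamma k T s.
Proof.
move=> nT.
have coE i : (fun t => param Gamma k T t 0 i) = pev (param_coef Gamma k T i).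
  by apply/funext => t; rewrite param_coefE.
rewrite derive_mx.
  apply/rowP => i; rewrite !mxE (_ : (fun t => _) = pev (param_coef Gamma k T i)).
    by rewrite derive_pev mulrC [X in _ + X]mulrC.
  by rewrite -coE.
apply/derivable_mxP => i j; rewrite (ord1 i) (_ : (fun t => _) = pev (param_coef Gamma k T j)).
  by apply: diff_derivable; have [] := is_diff_pev (param_coef Gamma k T j) s.
by rewrite -coE.
Qed.

Lemma param_crossE Gamma k T s : nondegenerate T ->
  param_cross Gamma k T s = cross (dparam1 Gamma k T s) (dparam2 Gamma k T s).
Proof.
by move=> nT; rewrite /param_cross !derive_param //= !scale0r !scale1r addr0 add0r.
Qed.

(** The partial derivatives are read off from the differential of the function, without comparing
    coefficient vectors. *)
Lemma pev_affine_derive n (u : 'rV[R]_(n.+1 * n.+1)) (a b c : R) :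
  (forall s, pev u s = a + b * s.1 + c * s.2) ->
  (forall s, pev1 u s = b) /\ (forall s, pev2 u s = c).
Proof.
move=> h; have hD s v : 'D_v (pev u) s = b * v.1 + c * v.2.
  have -> : pev u = (cst a + b *: (fst : R * R -> R)) + c *: (snd : R * R -> R).
    by apply/funext => t; rewrite h !fctE.
  have f1 := is_diff_fst s; have f2 := is_diff_snd s.
  have hd := is_diffD (is_diffD (is_diff_cst a s) (is_diffZ b f1)) (is_diffZ c f2).
  by have [d e] := hd; rewrite deriveE // e !fctE add0r.
split=> s.
  by have := hD s (1, 0); rewrite derive_pev /= !mulr1 !mulr0 !addr0.
by have := hD s (0, 1); rewrite derive_pev /= !mulr1 !mulr0 !add0r.
Qed.

(* Lagrange interpolation reproduces the affine map [ref_map T], so only the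
   displacements of the nodes enter. *)
Lemma param_sub_affine Gamma k T s : (0 < k)%N -> nondegenerate T ->
  [/\ param Gamma k T s - ref_map T s = \sum_(al : mi k | (\sum_i al i == k)%N)
        pev (lagr_coef al) s *: (pi_node Gamma T al - node al *m T),
      dparam1 Gamma k T s - edge1 T = \sum_(al : mi k | (\sum_i al i == k)%N)
        pev1 (lagr_coef al) s *: (pi_node Gamma T al - node al *m T) &
      dparam2 Gamma k T s - edge2 T = \sum_(al : mi k | (\sum_i al i == k)%N)
        pev2 (lagr_coef al) s *: (pi_node Gamma T al - node al *m T)].
Proof.
move=> k0 nT.
have aff i t : pev (\sum_(al : mi k | (\sum_i al i == k)%N)
    (node al *m T) 0 i *: lagr_coef al) t =
    row 0 T 0 i + edge1 T 0 i * t.1 + edge2 T 0 i * t.2.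
  rewrite pev_sum -[RHS](_ : ref_map T t 0 i = _); last first.
    by rewrite ref_map_edge !mxE; ring.
  rewrite -(lagr_reproduce T t k0) summxE; apply: eq_bigr => al _.
  by rewrite [RHS]mxE mulrC lagr_coefE.
split; apply/rowP => i.
- rewrite paramE // -(lagr_reproduce T s k0) -sumrB !summxE; apply: eq_bigr => al _.
  by rewrite -scalerBr lagr_coefE.
- have [h _] := pev_affine_derive (aff i); have := h s; rewrite pev_sum => hs.
  rewrite [LHS]mxE [X in X + _]mxE [X in _ + X]mxE -hs pev_sum -sumrB summxE.
  by apply: eq_bigr => al _; rewrite !mxE; ring.
- have [_ h] := pev_affine_derive (aff i); have := h s; rewrite pev_sum => hs.
  rewrite [LHS]mxE [X in X + _]mxE [X in _ + X]mxE -hs pev_sum -sumrB summxE.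
  by apply: eq_bigr => al _; rewrite !mxE; ring.
Qed.

End Faces.

(** * Estimates on one face *)

Section FaceEstimates.
Context {R : realType}.
Local Notation pt := 'rV[R]_3.
Local Notation triangle := 'M[R]_3.
Implicit Types (T : triangle) (s : R * R) (l x y : pt).

Lemma tri_row T i : tri T (row i T).
Proof.
exists (basis_vec i); last by rewrite -rowE.
split.
- by rewrite sum3E !basis_vecE; case: (ord3P i) => -> /=; ring.
- by move=> j; rewrite basis_vecE.
- by move=> j /(_ I).
Qed.

Lemma enorm_le_diam T x y : tri T x -> tri T y -> enorm (x - y) <= diam T.
Proof.
move=> Tx Ty; apply: ub_le_sup; last by exists x => //; exists y.
exists (2 * (3 * `|edge1 T| + 3 * `|edge2 T|)) => _ [x' /triP[s rs ->]] [y' /triP[t rt ->]] <-.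
apply: le_trans (enorm_le_normv _) _; rewrite ler_wpM2l //.
have -> : ref_map T s - ref_map T t =
    (s.1 - t.1) *: edge1 T + (s.2 - t.2) *: edge2 T.
  by rewrite !ref_map_edge; apply/rowP => i; rewrite !mxE; ring.
have bd (a b : R) : 0 <= a <= 1 -> 0 <= b <= 1 -> `|a - b| <= 3.
  by move=> /andP[a0 a1] /andP[b0 b1]; rewrite ler_norml; apply/andP; split; lra.
case: rs => s1 s2 s3; case: rt => t1 t2 t3.
apply: le_trans (ler_normD _ _) _; rewrite !normrZ.
by apply: lerD; rewrite ler_wpM2r //; apply: bd; apply/andP; split; lra.
Qed.

Lemma diam_le_meshsize (Ts : seq triangle) T : T \in Ts -> diam T <= meshsize Ts.
Proof. by move=> TTs; rewrite /meshsize; exact: le_bigmax_seq. Qed.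

(* Moving the centre of an inscribed disc along [u] changes the barycentric
   coordinates affinely, and these stay between 0 and 1. *)
Lemma inscribed_disc_edges T (c : pt) (rho : R) : nondegenerate T -> 0 < rho ->
  plane T c -> [set x | plane T x /\ enorm (x - c) <= rho] `<=` tri T ->
  forall w1 w2 : R, let u := w1 *: edge1 T + w2 *: edge2 T in
    rho * `|w1| <= enorm u /\ rho * `|w2| <= enorm u.
Proof.
move=> nT rho0 [l l1 cE] sub w1 w2 u.
pose om : pt := (- (w1 + w2)) *: basis_vec 0 + w1 *: basis_vec 1 + w2 *: basis_vec 2%:R.
have omE : (om 0 0 = - (w1 + w2)) * (om 0 1 = w1) * (om 0 2%:R = w2).
  by rewrite !mxE /=; do !split; ring.
have omT : om *m T = u.
  rewrite mulmx_rows !omE /u; apply/rowP => i; rewrite !mxE; ring.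
have pos (t : R) : `|t| * enorm u <= rho -> forall i, 0 <= (l + t *: om) 0 i.
  move=> ht.
  have sum1 : \sum_i (l + t *: om) 0 i = 1.
    move: l1; rewrite /= !sum3E !mxE /= => l1; lra.
  have xE : (l + t *: om) *m T = c + t *: u by rewrite mulmxDl -scalemxAl omT cE.
  have [|l' [l'1 l'0 _] e] := sub ((l + t *: om) *m T).
    split; first by exists (l + t *: om).
    rewrite xE addrAC subrr add0r; apply: le_trans ht.
    by rewrite /enorm dotZl dotZr mulrA -expr2 sqrtrM ?sqr_ge0 // sqrtr_sqr.
  by rewrite -(mulmx_face_inj nT l'1 sum1 e).
have coE (t : R) j : (l + t *: om) 0 j = l 0 j + t * om 0 j.
  by rewrite mxE [X in _ + X]mxE.
(* Otherwise steps of both signs with t = 1 / om_i keep the point in the disc. The i-th coordinate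
   changes by 1 and by -1, which forces l_i = 1, and after the positive step the other two
   coordinates would have sum -1. *)
have key i : om 0 i != 0 -> rho * `|om 0 i| <= enorm u.
  move=> om0; rewrite leNgt; apply/negP => lt.
  pose t := (om 0 i)^-1.
  have ht : `|t| * enorm u <= rho.
    have : 0 < `|om 0 i| by rewrite normr_gt0.
    move=> h; rewrite normfV mulrC ler_pdivrMr //; exact: ltW.
  have ht' : `|- t| * enorm u <= rho by rewrite normrN.
  have tom : t * om 0 i = 1 by rewrite mulVf.
  have := pos t ht i; have := pos (- t) ht' i.
  rewrite !coE mulNr tom => a b.
  have l1' : l 0 i <= 1 - \sum_(j | j != i) l 0 j.
    by move: l1 => /=; rewrite (bigD1 i) //=; lra.
  have oth : 0 <= \sum_(j | j != i) l 0 j.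
    apply: sumr_ge0 => j _.
    have l0 := pos 0; rewrite scale0r addr0 normr0 mul0r in l0.
    exact: l0 (ltW rho0) j.
  have l1'' : l 0 i = 1 by lra.
  have o0 j : j != i -> l 0 j = 0.
    move=> ji; apply/eqP; rewrite eq_le; apply/andP; split.
      have e0 : \sum_(j | j != i) l 0 j = 0 by lra.
      rewrite -e0 (bigD1 j) //= lerDl; apply: sumr_ge0 => m _.
      have l0 := pos 0; rewrite scale0r addr0 normr0 mul0r in l0.
      exact: l0 (ltW rho0) m.
    have l0 := pos 0; rewrite scale0r addr0 normr0 mul0r in l0.
    exact: l0 (ltW rho0) j.
  have : 0 <= \sum_(j | j != i) (l + t *: om) 0 j.
    by apply: sumr_ge0 => j _; exact: pos.
  have : \sum_(j | j != i) (l + t *: om) 0 j = - 1.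
    have : \sum_j (l + t *: om) 0 j = 1.
      by move: l1; rewrite /= !sum3E !mxE /= => l1; lra.
    by rewrite (bigD1 i) //= coE tom; lra.
  by lra.
have u0 := enorm_ge0 u.
split.
  by have := key 1; rewrite omE; case: (eqVneq w1 0) => [->|_ /(_ isT)] //; rewrite normr0 mulr0.
by have := key 2%:R; rewrite omE; case: (eqVneq w2 0) => [->|_ /(_ isT)] //; rewrite normr0 mulr0.
Qed.

Variables (Gamma : set pt) (delta : R) (H : set R) (Th : R -> seq triangle).
Hypotheses (surfG : smooth_closed_surface Gamma) (tubeG : tubular Gamma delta)
  (meshG : mesh_family Gamma H Th).

(** Shape regularity bounds the inradius from below by the diameter, quasi-uniformity the diameter
    by h; [kap] is the product of the two constants. The last clause says that the edges, divided by
    h, are uniformly linearly independent. *)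
Lemma mesh_faces : exists2 kap : R, 0 < kap & forall h, H h -> forall T, T \in Th h ->
  [/\ nondegenerate T, forall i, Gamma (row i T),
      `|edge1 T| <= h, `|edge2 T| <= h &
      forall w1 w2 : R, let u := w1 *: edge1 T + w2 *: edge2 T in
        kap * h * `|w1| <= enorm u /\ kap * h * `|w2| <= enorm u].
Proof.
case: meshG => poly [sig sig0 hsig] [c c0 hc].
exists (sig * c) => [|h Hh T TTh]; first exact: mulr_gt0.
have [h0 [_ _ nd Gv] ms] := poly h Hh.
have nT := nd T TTh.
have dh : diam T <= h by rewrite -ms diam_le_meshsize.
have edge i : `|row i T - row 0 T| <= h.
  apply: le_trans (normv_le_enorm _) _; apply: le_trans dh.
  exact: enorm_le_diam (tri_row _ _) (tri_row _ _).
split=> //; [by move=> i; exact: Gv|exact: (edge 1)|exact: (edge 2%:R)|].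
have [z [pz disc]] := hsig h Hh T TTh.
have ch := hc h Hh T TTh.
have d0 : 0 < diam T by apply: lt_le_trans ch; exact: mulr_gt0.
move=> w1 w2 u.
have [e1 e2] := inscribed_disc_edges nT (mulr_gt0 sig0 d0) pz disc w1 w2.
have le : sig * c * h <= sig * diam T by rewrite -mulrA ler_pM2l.
by split; [apply: le_trans e1|apply: le_trans e2]; rewrite ler_wpM2r.
Qed.

Local Notation n := (normal Gamma).
Local Notation d := (sdist Gamma).

(** The vertex lies on [Gamma]; its normal is the fixed direction to which everything on the face is
    compared. *)
Definition vnormal T : pt := n (row 0 T).

Definition face_est (C h : R) T : Prop :=
  [/\ `|edge1 T| <= h, `|edge2 T| <= h, `|dot (vnormal T) (edge1 T)| <= C * h ^+ 2,
      `|dot (vnormal T) (edge2 T)| <= C * h ^+ 2 & `|vnormal T| <= C].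

(* [b] differs from [a] by a multiple of the normal at a vertex, up to a term
   that is smaller by one order of [h]. *)
Definition normal_shift (C h : R) T (a b : pt) : Prop :=
  exists c r, [/\ b = a + c *: vnormal T + r, `|c| <= C * h ^+ 2 & `|r| <= C * h ^+ 3].

Definition param_est (C h : R) k T s : Prop :=
  [/\ normal_shift C h T (edge1 T) (dparam1 Gamma k T s),
      normal_shift C h T (edge2 T) (dparam2 Gamma k T s),
      U_ Gamma delta (param Gamma k T s),
      `|n (param Gamma k T s) - vnormal T| <= C * h &
      `|d (param Gamma k T s)| <= C * h /\
        forall w, `|dclosest Gamma (param Gamma k T s) w - w| <=
          C * (`|dot (n (param Gamma k T s)) w| + `|d (param Gamma k T s)| * `|w|)].

(** The vertices lie on [Gamma], so the linear part of d vanishes on the edges up to O(h^2), and d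
    is O(h^2) at all nodes. A node is displaced by -d n, and replacing n by the normal at the vertex
    costs a further factor h. Derivatives of the basis functions are bounded on the reference
    triangle, so the tangent vectors inherit these orders. *)
Lemma face_estimates k : (0 < k)%N -> exists2 h0 : R, 0 < h0 <= 1 & exists2 C : R, 1 <= C &
  forall h, H h -> h < h0 -> forall T, T \in Th h ->
    face_est C h T /\ forall s, cref_tri s -> param_est C h k T s.
Proof.
move=> k0.
have [r r0 [G G0 hG]] := tube_geometry surfG tubeG.
have [K K0 hK] := @lagr_bounded R k.
have [kap _ hF] := mesh_faces.
pose M : R := #|{: {ffun 'I_3 -> 'I_k.+1}}|%:R.
have M0 : 0 <= M by exact: ler0n.
pose D := 1 + M * K * (2 * G * G).
have E0 : 0 <= M * K * (2 * G * G) by rewrite !mulr_ge0 // ltW.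
have D1 : 1 <= D by rewrite /D; lra.
pose C := 1 + G + M * K * (2 * G) + M * K * (2 * G * G) + G * D + 3 * G * D + G * D ^+ 2.
have C1 : [/\ 0 <= M * K * (2 * G), 0 <= G * D & 0 <= G * D ^+ 2].
  by split; rewrite !mulr_ge0 ?exprn_ge0 //; lra.
have [t1 t2 t3] := C1.
have [CG CMG CMGG CD CDD] : [/\ G <= C, M * K * (2 * G) <= C,
    M * K * (2 * G * G) <= C, G * D <= C & 3 * G * D + G * D ^+ 2 <= C].
  by rewrite /C; split; lra.
have C10 : 1 <= C by rewrite /C; lra.
have D0 : 0 < D by lra.
have C1' : 0 <= C by lra.
(* [D * h] will bound the distance of the points of the curved face from the vertex, so this
   threshold keeps them within the radius [r] of the uniform estimates. *)
exists (Num.min 1 (r / D)).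
  by rewrite lt_min ltr01 divr_gt0 ?ge_min ?lexx.
exists C => //.
move=> h Hh; rewrite lt_min => /andP[h1]; rewrite ltr_pdivlMr // => hr T TTh.
have [nT Gv e1 e2 _] := hF h Hh T TTh.
have h0 : 0 <= h by apply: le_trans e1.
have hr' : h < r by apply: le_lt_trans hr; rewrite ler_peMr.
pose p := row 0 T; have Gp : Gamma p by exact: Gv.
have hh : 0 <= h ^+ 2 by exact: sqr_ge0.
have nrm x : `|x - p| <= h -> [/\ U_ Gamma delta x, `|n x| <= G, `|n x - n p| <= G * h,
    `|d x - dot (n p) (x - p)| <= G * h ^+ 2 &
    forall w, `|dclosest Gamma x w - w| <= G * (`|dot (n x) w| + `|d x| * `|w|)].
  move=> hx; have [Ux nx1 nx2 dx dc] := hG p x Gp (le_lt_trans hx hr').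
  split=> //; first by apply: le_trans nx2 _; rewrite ler_wpM2l // ltW.
  apply: le_trans dx _; rewrite ler_wpM2l ?(ltW G0) //.
  by rewrite lerXn2r // nnegrE.
have pp : `|p - p| <= h by rewrite subrr normr0.
have [_ np _ _ _] := nrm p pp.
(* Both ends of the edge lie on [Gamma], where the distance is 0, so only the quadratic remainder is
   left. *)
have de1 : `|dot (n p) (edge1 T)| <= G * h ^+ 2.
  have [_ _ _ + _] := nrm _ e1.
  by rewrite -/(edge1 T) (sdist0 (Gv 1)) sub0r normrN.
have de2 : `|dot (n p) (edge2 T)| <= G * h ^+ 2.
  have [_ _ _ + _] := nrm _ e2.
  by rewrite -/(edge2 T) (sdist0 (Gv 2%:R)) sub0r normrN.
have face : face_est C h T.
  split=> //; [apply: le_trans de1 _|apply: le_trans de2 _|exact: le_trans np CG];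
    by rewrite ler_wpM2r.
split=> // s rs.
have comb (a b : R) : 0 <= a -> 0 <= b -> a + b <= 1 ->
    `|a *: edge1 T + b *: edge2 T| <= h /\
    `|dot (n p) (a *: edge1 T + b *: edge2 T)| <= G * h ^+ 2.
  move=> a0 b0 ab; split.
    apply: le_trans (ler_normD _ _) _; rewrite !normrZ !ger0_norm //.
    apply: (@le_trans _ _ ((a + b) * h)); last by rewrite ler_piMl.
    by rewrite mulrDl lerD // ler_wpM2l.
  rewrite dotDr !dotZr; apply: le_trans (ler_normD _ _) _.
  rewrite !normrM (ger0_norm a0) (ger0_norm b0).
  have Gh : 0 <= G * h ^+ 2 by rewrite mulr_ge0 // ltW.
  apply: (@le_trans _ _ ((a + b) * (G * h ^+ 2))); last by rewrite ler_piMl.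
  by rewrite mulrDl lerD // ler_wpM2l.
pose X (al : {ffun 'I_3 -> 'I_k.+1}) := node al *m T.
have nodes (al : {ffun 'I_3 -> 'I_k.+1}) : (\sum_i al i == k)%N ->
    [/\ `|d (X al)| <= 2 * G * h ^+ 2, `|n (X al)| <= G & `|n (X al) - n p| <= G * h].
  move=> sal; have s1 := @node_sum R k al k0 sal.
  have XE : X al - p = node al 0 1 *: edge1 T + node al 0 2%:R *: edge2 T.
    rewrite /X (lam_surj s1) -ref_mapE ref_map_edge !lamE /=.
    by rewrite -/p addrAC subrr add0r.
  have [c1 c2] : `|X al - p| <= h /\ `|dot (n p) (X al - p)| <= G * h ^+ 2.
    rewrite XE; apply: comb; try exact: node_ge0.
    by move: s1; rewrite sum3E => <-; rewrite lerD2r lerDr node_ge0.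
  have [_ nX nXp dX _] := nrm _ c1; split => //.
  have := ler_normD (d (X al) - dot (n p) (X al - p)) (dot (n p) (X al - p)).
  rewrite subrK => /le_trans; apply; rewrite (_ : 2 * G * h ^+ 2 = G * h ^+ 2 + G * h ^+ 2).
    exact: lerD.
  by ring.
(* The displacement is split at the fixed normal of the face; the difference of the normals
   contributes the additional power of h. *)
have piX (al : {ffun 'I_3 -> 'I_k.+1}) : pi_node Gamma T al - X al =
    (- d (X al)) *: vnormal T + (- d (X al)) *: (n (X al) - vnormal T).
  rewrite -scalerDr [vnormal T + _]addrC subrK /pi_node /closest_pt -/(X al).
  by rewrite addrAC subrr add0r scaleNr.
have sumle (F : {ffun 'I_3 -> 'I_k.+1} -> R) (B : R) : 0 <= B ->
    (forall al : {ffun 'I_3 -> 'I_k.+1}, (\sum_i al i == k)%N -> F al <= B) ->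
    \sum_(al : {ffun 'I_3 -> 'I_k.+1} | (\sum_i al i == k)%N) F al <= M * B.
  move=> B0 hFB; apply: (@le_trans _ _ (\sum_(al : {ffun 'I_3 -> 'I_k.+1}) B)).
    rewrite [leRHS](bigID (fun al : {ffun 'I_3 -> 'I_k.+1} => (\sum_i al i == k)%N)) /=.
    by apply: ler_wpDr; [apply: sumr_ge0|apply: ler_sum].
  by rewrite sumr_const -mulr_natl.
have shift (Q : {ffun 'I_3 -> 'I_k.+1} -> R) (a b : pt) :
    (forall al, `|Q al| <= K) ->
    b - a = \sum_(al : {ffun 'I_3 -> 'I_k.+1} | (\sum_i al i == k)%N)
      Q al *: (pi_node Gamma T al - X al) -> normal_shift C h T a b.
  move=> hQ ba.
  exists (\sum_(al : {ffun 'I_3 -> 'I_k.+1} | (\sum_i al i == k)%N) Q al * - d (X al)).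
  exists (\sum_(al : {ffun 'I_3 -> 'I_k.+1} | (\sum_i al i == k)%N)
    Q al *: ((- d (X al)) *: (n (X al) - vnormal T))).
  split.
  - rewrite -addrA scaler_suml -big_split /= -[LHS](subrK a) ba addrC; congr (_ + _).
    by apply: eq_bigr => al _; rewrite piX scalerDr scalerA.
  - apply: le_trans (ler_norm_sum _ _ _) _.
    apply: (@le_trans _ _ (M * (K * (2 * G * h ^+ 2)))).
      apply: sumle => [|al sal]; first by rewrite !mulr_ge0 // ltW.
      by have [dX _ _] := nodes al sal; rewrite normrM normrN ler_pM.
    rewrite (_ : M * _ = (M * K * (2 * G)) * h ^+ 2); last by ring.
    by rewrite ler_wpM2r.
  - apply: le_trans (ler_norm_sum _ _ _) _.
    apply: (@le_trans _ _ (M * (K * (2 * G * h ^+ 2 * (G * h))))).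
      apply: sumle => [|al sal]; first by rewrite !mulr_ge0 // ltW.
      have [dX _ nX] := nodes al sal; rewrite !normrZ normrN ler_pM ?mulr_ge0 //.
      by rewrite ler_pM.
    rewrite (_ : M * _ = (M * K * (2 * G * G)) * h ^+ 3); last by ring.
    by rewrite ler_wpM2r ?exprn_ge0.
have [E1 E2 E3] := param_sub_affine Gamma s k0 nT.
pose y := param Gamma k T s.
have yp : `|y - p| <= D * h.
  have -> : y - p = (s.1 *: edge1 T + s.2 *: edge2 T) + (y - ref_map T s).
    by rewrite ref_map_edge -/p; apply/rowP => i; rewrite !mxE; ring.
  apply: le_trans (ler_normD _ _) _.
  have [s1 s2 s3] := rs; have [c1 _] := comb s.1 s.2 s1 s2 s3.
  rewrite /D mulrDl mul1r; apply: lerD => //.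
  rewrite E1; apply: le_trans (ler_norm_sum _ _ _) _.
  apply: (@le_trans _ _ (M * (K * (2 * G * h * G)))); last first.
    by rewrite le_eqVlt; apply/orP; left; apply/eqP; ring.
  apply: sumle => [|al sal]; first by rewrite !mulr_ge0 // ltW.
  have [dX nX _] := nodes al sal; have [hQ _ _] := hK al s rs.
  rewrite /pi_node /closest_pt -/(X al) addrAC subrr add0r normrZ normrN normrZ.
  rewrite ler_pM // ler_pM //; apply: le_trans dX _.
  rewrite -!mulrA ler_wpM2l // ler_wpM2l ?(ltW G0) // expr2 ler_piMl //; exact: ltW.
have [|Uy _ ny dy dc] := hG p y Gp.
  by apply: le_lt_trans yp _; rewrite mulrC.
split => //.
- by apply: (shift (fun al => pev1 (lagr_coef al) s)) => // al; have [] := hK al s rs.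
- by apply: (shift (fun al => pev2 (lagr_coef al) s)) => // al; have [] := hK al s rs.
- apply: le_trans ny _; apply: (@le_trans _ _ (G * D * h)).
    by rewrite -mulrA ler_wpM2l // ltW.
  by rewrite ler_wpM2r.
split; last first.
  by move=> w; apply: le_trans (dc w) _; rewrite ler_wpM2r.
have := ler_normD (d y - dot (n p) (y - p)) (dot (n p) (y - p)); rewrite subrK => d1.
have d2 := normr_dot_le (n p) (y - p).
have d3 : 3 * `|n p| * `|y - p| <= 3 * G * (D * h) by rewrite ler_pM // ?mulr_ge0 // ler_wpM2l.
have d4 : G * `|y - p| ^+ 2 <= G * (D ^+ 2 * h).
  rewrite ler_wpM2l ?(ltW G0) //; apply: (@le_trans _ _ ((D * h) ^+ 2)).
    by rewrite lerXn2r // nnegrE // mulr_ge0 // ltW.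
  by rewrite exprMn ler_wpM2l ?sqr_ge0 // expr2 ler_piMl // ltW.
have : (3 * G * D + G * D ^+ 2) * h <= C * h by rewrite ler_wpM2r.
apply: le_trans; rewrite mulrDl; apply: le_trans d1 _; rewrite addrC; apply: lerD.
  by apply: le_trans d2 _; rewrite mulrA in d3.
by apply: le_trans dy _; rewrite mulrA in d4.
Qed.

End FaceEstimates.

(** * Conformity and charts *)

Section Conformity.
Context {R : realType}.
Local Notation pt := 'rV[R]_3.
Local Notation triangle := 'M[R]_3.
Implicit Types (T : triangle) (s : R * R) (l : pt) (Gamma : set pt).

(** A new point is added to the domain by composing the permutation with one transposition. *)
Lemma perm_extend (A : finType) (f : A -> A) (r : seq A) :
  {in r &, injective f} -> exists p : {perm A}, {in r, forall i, p i = f i}.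
Proof.
elim: r => [|i r IH] inj; first by exists 1%g.
have [|p hp] := IH; first by move=> a b ar br; apply: inj; rewrite inE ?ar ?br orbT.
have [ir|ir] := boolP (i \in r).
  by exists p => j; rewrite inE => /orP[/eqP ->|]; exact: hp.
exists (p * tperm (p i) (f i))%g => j; rewrite inE permM => /orP[/eqP ->|jr].
  by rewrite tpermL.
have ji : j != i by apply: contraNneq ir => <-.
rewrite (hp j jr) tpermD //.
  by apply: contra ji; rewrite -(hp j jr) => /eqP e; apply/eqP; exact: esym (perm_inj e).
by apply: contra ji => /eqP e; apply/eqP/inj; rewrite ?inE ?eqxx ?jr ?orbT.
Qed.

Lemma row_face_inj T i j : nondegenerate T -> row i T = row j T -> i = j.
Proof.
move=> nT; rewrite !rowE => e.
have s1 m : \sum_a (delta_mx 0 m : pt) 0 a = 1.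
  by rewrite (bigD1 m) //= big1 ?mxE ?eqxx ?addr0 // => a /negbTE am; rewrite mxE am andbF.
have := congr1 (fun v : pt => v 0 i) (mulmx_face_inj nT (s1 i) (s1 j) e).
by rewrite !mxE !eqxx /=; case: eqP => // _ /eqP; rewrite oner_eq0.
Qed.

(** Two faces may number their common vertices differently. The permutation translates one numbering
    into the other on these vertices and is arbitrary elsewhere. *)
Lemma face_matching T T' : nondegenerate T ->
  exists p : {perm 'I_3}, forall i, (exists j, row i T = row j T') ->
    row i T = row (p i) T'.
Proof.
move=> nT; pose I := [set i | `[< exists j, row i T = row j T' >]]%SET.
have ch i : exists j, i \in I -> row i T = row j T'.
  have [|] := boolP (i \in I); last by exists i.
  by rewrite inE => /asboolP[j e]; exists j.
have [f hf] := choice ch.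
have [|p hp] := @perm_extend _ f (enum I).
  move=> a b; rewrite !mem_enum => aI bI e; apply: (row_face_inj nT).
  by rewrite (hf a aI) (hf b bI) e.
exists p => i hi; have iI : i \in I by rewrite inE; exact/asboolP.
by rewrite (hf i iI) hp // mem_enum.
Qed.

Lemma mulmx_perm l T T' (p : {perm 'I_3}) :
  (forall i, l 0 i != 0 -> row i T = row (p i) T') ->
  l *m T = (\row_j l 0 (p^-1%g j)) *m T'.
Proof.
move=> h; rewrite !mulmx_sum_row [RHS](reindex_inj (@perm_inj _ p)) /=.
apply: eq_bigr => i _; rewrite mxE permK.
have [->|/h ->] := eqVneq (l 0 i) 0; last by [].
by rewrite !scale0r.
Qed.

Lemma sum_perm l (p : {perm 'I_3}) : \sum_j (\row_j l 0 (p^-1%g j) : pt) 0 j = \sum_i l 0 i.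
Proof.
rewrite (reindex_inj (@perm_inj _ p)) /=; apply: eq_bigr => i _.
by rewrite mxE permK.
Qed.

(** For [al i] positive the product contains the factor with j = 0, which vanishes together with
    [l i]. Hence on a common edge or vertex only the nodes that lie there contribute. *)
Lemma lagrange_basis_support k (al : 'I_3 -> nat) l i :
  lagrange_basis k al l != 0 -> l 0 i = 0 -> al i = 0%N.
Proof.
move=> L0 li; case E: (al i) => [//|a]; case/eqP: L0.
rewrite lagrange_basisE (bigD1 i) //= E li mulr0 /gbinom big_ord_recl /= subr0.
by rewrite !mul0r.
Qed.

(** At a point of the common part the nodes off it have vanishing basis functions, and the
    permutation of the numbering matches the remaining nodes and basis functions of the two
    faces. *)
Lemma proj_face_conforming Gamma k (Ts : seq triangle) T T' x : conforming Ts ->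
  (forall T, T \in Ts -> nondegenerate T) -> T \in Ts -> T' \in Ts ->
  tri T x -> tri T' x -> proj_face Gamma k T x = proj_face Gamma k T' x.
Proof.
move=> conf nd TTs T'Ts Tx T'x.
have [->//|TT'] := eqVneq T T'.
have [_ cap] := conf T T' TTs T'Ts TT'.
have [nT nT'] := (nd T TTs, nd T' T'Ts).
have [l [l1 l0 lI] xE] : hull T [set i | exists j, row i T = row j T'] x.
  by rewrite -cap.
have [p hp] := @face_matching T T' nT.
have hl i : l 0 i != 0 -> row i T = row (p i) T'.
  by move=> li; apply: hp; apply: contrapT => ni; rewrite lI ?eqxx in li.
pose l' : pt := \row_j l 0 (p^-1%g j).
have xE' : l' *m T' = x by rewrite -(mulmx_perm hl).
have l'1 : \sum_i l' 0 i = 1 by rewrite sum_perm.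
have e1 := proj_faceE Gamma k nT l1; have e2 := proj_faceE Gamma k nT' l'1.
rewrite xE in e1; rewrite xE' in e2; rewrite {}e1 {}e2.
pose g (al : {ffun 'I_3 -> 'I_k.+1}) : {ffun 'I_3 -> 'I_k.+1} := [ffun j => al (p^-1%g j)].
have gi : injective g.
  move=> a b e; apply/ffunP => i; have := congr1 (fun f : {ffun 'I_3 -> 'I_k.+1} => f (p i)) e.
  by rewrite !ffunE permK.
rewrite [RHS](reindex_inj gi) /=.
have sg (al : {ffun 'I_3 -> 'I_k.+1}) : (\sum_i g al i = \sum_i al i)%N.
  rewrite (reindex_inj (@perm_inj _ p)) /=; apply: eq_bigr => i _.
  by rewrite ffunE permK.
apply: eq_big => al; first by rewrite sg.
move=> _; have LE : lagrange_basis k (fun i => g al i) l' =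
    lagrange_basis k (fun i => al i) l.
  rewrite !lagrange_basisE (reindex_inj (@perm_inj _ p)) /=.
  by apply: eq_bigr => i _; rewrite mxE ffunE permK.
rewrite {}LE {xE xE'}; set L := lagrange_basis _ _ l.
have [L0|L0] := eqVneq L 0.
  have z v : L *: v = 0 :> pt by rewrite L0 scale0r.
  exact: etrans (z _) (esym (z _)).
congr (_ *: closest_pt _ _); rewrite (mulmx_perm (T' := T') (p := p)).
  by congr (_ *m _); apply/rowP => j; rewrite !mxE ffunE.
move=> i ni; apply: hl; apply: contraNneq ni => li.
by rewrite mxE (lagrange_basis_support L0 li) mul0r.
Qed.

(** The barycentric coordinates of an interior point are all positive. If the faces were distinct,
    conformity would make all three vertices common, and the two triangles would be the same set,
    which [conforming] excludes. *)
Lemma interior_face (Ts : seq triangle) T T' s s' : conforming Ts ->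
  (forall T, T \in Ts -> nondegenerate T) -> T \in Ts -> T' \in Ts ->
  ref_tri s -> cref_tri s' -> ref_map T s = ref_map T' s' -> T = T' /\ s = s'.
Proof.
move=> conf nd TTs T'Ts rs rs' e.
have [nT nT'] := (nd T TTs, nd T' T'Ts).
have [TT'|TT'] := eqVneq T T'.
  by split=> //; apply: (ref_map_inj nT); rewrite e TT'.
have [neq cap] := conf T T' TTs T'Ts TT'.
have Tx : tri T (ref_map T s) by apply/triP; exists s => //; exact: sub_ref_tri.
have T'x : tri T' (ref_map T s) by apply/triP; exists s'.
have [l [l1 l0 lI] xE] : hull T [set i | exists j, row i T = row j T'] (ref_map T s).
  by rewrite -cap.
have lE : l = lam s by apply: (mulmx_face_inj nT l1 (lam_sum s)); rewrite xE ref_mapE.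
have all i : exists j, row i T = row j T'.
  apply: contrapT => ni; have /ref_lam/(_ i) := rs.
  by rewrite -lE lI ?ltxx.
have [p hp] := @face_matching T T' nT.
case: neq; apply/seteqP; split=> x [m [m1 m0 _] <-].
  rewrite (@mulmx_perm _ _ T' p) => [|i _]; last exact: hp.
  exists (\row_j m 0 (p^-1%g j)) => //.
  split=> [|i|i /(_ I)] //; first by rewrite sum_perm.
  by rewrite mxE.
rewrite (@mulmx_perm _ _ T (p^-1)%g) => [|i _]; last by rewrite (hp _ (all _)) permKV.
exists (\row_j m 0 ((p^-1)^-1%g j)) => //.
split=> [|i|i /(_ I)] //; first by rewrite sum_perm.
by rewrite mxE.
Qed.

End Conformity.

(** * Charts of the curved surface over the open reference triangle *)

Section SurfaceCharts.
Context {R : realType}.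
Local Notation pt := 'rV[R]_3.
Local Notation triangle := 'M[R]_3.
Implicit Types (T : triangle) (s : R * R) (x y : pt).
Variables (Gamma : set pt) (delta : R) (k : nat) (Ts : seq triangle).
Hypotheses (tubeG : tubular Gamma delta) (polyG : polyhedral Gamma Ts)
  (admG : admissible Gamma delta k Ts).

Local Notation U := (U_ Gamma delta).
Local Notation pi := (closest_pt Gamma).
Local Notation par := (param Gamma k).

Lemma face_nondegenerate T : T \in Ts -> nondegenerate T.
Proof. by case: polyG => _ _ nd _; exact: nd. Qed.

Lemma proj_k_face T x : T \in Ts -> tri T x ->
  proj_k Gamma k Ts x = proj_face Gamma k T x.
Proof.
case: polyG => _ conf nd _ TTs Tx; rewrite /proj_k.
have [T'Ts T'x] := @xgetPex _ 0 [set T | T \in Ts /\ tri T x] (ex_intro _ T (conj TTs Tx)).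
exact: proj_face_conforming conf nd T'Ts TTs T'x Tx.
Qed.

Lemma proj_k_ref_map T s : T \in Ts -> cref_tri s ->
  proj_k Gamma k Ts (ref_map T s) = par T s.
Proof. by move=> TTs rs; rewrite (proj_k_face TTs) //; apply/triP; exists s. Qed.

Lemma polysurfP x : polysurf Ts x <-> exists T s, [/\ T \in Ts, cref_tri s & x = ref_map T s].
Proof.
split=> [[T TTs /triP[s rs ->]]|[T [s [TTs rs ->]]]]; first by exists T, s.
by exists T => //; apply/triP; exists s.
Qed.

Lemma surf_kP y : surf_k Gamma k Ts y <->
  exists T s, [/\ T \in Ts, cref_tri s & y = par T s].
Proof.
split=> [[x /polysurfP[T [s [TTs rs ->]]] <-]|[T [s [TTs rs ->]]]].
  by exists T, s; rewrite proj_k_ref_map.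
exists (ref_map T s); last exact: proj_k_ref_map.
by apply/polysurfP; exists T, s.
Qed.

Lemma closest_ptE x : pi x = x - sdist Gamma x *: normal Gamma x.
Proof. by []. Qed.

Local Opaque param surf_k closest_pt polysurf proj_k ref_map.

Lemma surf_k_param T s : T \in Ts -> cref_tri s -> surf_k Gamma k Ts (par T s).
Proof. by move=> TTs rs; apply/surf_kP; exists T, s. Qed.

Lemma param_tube T s : T \in Ts -> cref_tri s -> U (par T s).
Proof. by move=> TTs rs; case: admG => sub _ _; apply/sub/surf_k_param. Qed.

(** Injectivity of the two projections in [admissible] brings the question back to the flat faces,
    where one interior point is enough to identify face and parameter. *)
Lemma closest_pt_param_inj T T' s s' : T \in Ts -> T' \in Ts -> ref_tri s -> cref_tri s' ->
  pi (par T s) = pi (par T' s') -> T = T' /\ s = s'.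
Proof.
case: admG => _ [_ pinj _] [_ cinj _]; case: polyG => _ conf nd _.
move=> TTs T'Ts rs rs' e; have crs := sub_ref_tri rs.
apply: (interior_face conf nd TTs T'Ts rs rs').
have poly T0 s0 : T0 \in Ts -> cref_tri s0 -> ref_map T0 s0 \in polysurf Ts.
  move=> h1 h2; apply/mem_set/polysurfP; exists T0, s0.
  by split; [exact: h1|exact: h2|reflexivity].
apply: pinj; [exact: poly|exact: poly|].
rewrite (proj_k_ref_map TTs crs) (proj_k_ref_map T'Ts rs').
apply: cinj; [exact: mem_set (surf_k_param TTs crs)|exact: mem_set (surf_k_param T'Ts rs')|].
exact: e.
Qed.

Lemma normal_kE T s : T \in Ts -> ref_tri s ->
  normal_k Gamma k Ts (par T s) =
  (enorm (param_cross Gamma k T s))^-1 *: param_cross Gamma k T s.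
Proof.
move=> TTs rs; rewrite /normal_k.
set A := [set z : triangle * (R * R) | _].
have ex : A (T, s) by split.
have := @xgetPex _ (0, (0, 0)) A (ex_intro _ _ ex).
case: xget => T' s' [/= T'Ts rs' e].
by have [-> ->] := closest_pt_param_inj TTs T'Ts rs (sub_ref_tri rs') (congr1 pi (esym e)).
Qed.

Lemma normal_ext_param q T s x : T \in Ts -> ref_tri s ->
  pi (par T s) = pi x -> normal_ext Gamma k Ts q x = q (par T s).
Proof.
move=> TTs rs e; rewrite /normal_ext; congr q.
set A := [set y | _].
have Sp : surf_k Gamma k Ts (par T s) by exact: surf_k_param TTs (sub_ref_tri rs).
have ex : A (par T s) := conj Sp e.
have [Sy ey] := @xgetPex _ 0 A (ex_intro _ _ ex).
case: admG => _ _ [_ cinj _]; apply: cinj; [exact: mem_set Sy|exact: mem_set Sp|].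
by rewrite ey; exact: esym e.
Qed.

Lemma compact_cref_tri : compact (@cref_tri R).
Proof.
have -> : @cref_tri R = (`[(0:R), 1]%classic `*` `[(0:R), 1]%classic) `&`
    (fun s : R * R => s.1 + s.2) @^-1` [set x | x <= 1].
  apply/seteqP; split=> s /=.
    by move=> [h1 h2 h3]; rewrite /= !in_itv /=; repeat split => //; apply/andP; split; lra.
  by rewrite /= !in_itv /= => -[[/andP[h1 h2] /andP[h3 h4]] h5].
apply: compact_closedI; first by apply: compact_setX; exact: segment_compact.
apply: preimage_closed => [s _|]; last exact: closed_le.
by apply: cvgD; [exact: cvg_fst|exact: cvg_snd].
Qed.

Lemma continuous_rV3 {X : topologicalType} (f : X -> pt) (x : X) :
  (forall i, {for x, continuous (fun z => f z 0 i)}) -> {for x, continuous f}.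
Proof.
move=> h; apply/cvgrPdistC_lt => e e0.
have FF : Filter (nbhs x) by typeclasses eauto.
have e2 : 0 < e / 2 by rewrite divr_gt0.
have hi i : \forall z \near x, `|f z 0 i - f x 0 i| < e / 2.
  by have /cvgrPdistC_lt := h i; exact.
have := @near_ord3 _ _ FF _ hi; apply: filterS => z hz.
apply: (@le_lt_trans _ _ (e / 2)); last by lra.
apply: normv_le => [|i]; first exact: ltW.
by have := hz i; rewrite !mxE => /ltW.
Qed.

Lemma continuous_param T s : nondegenerate T -> {for s, continuous (par T)}.
Proof.
move=> nT; apply: continuous_rV3 => i.
rewrite (_ : (fun z => _) = pev (param_coef Gamma k T i)).
  exact: continuous_pev.
by apply/funext => t; rewrite param_coefE.
Qed.

Lemma continuous_closest x : U x -> {for x, continuous pi}.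
Proof.
move=> Ux; have Cd : {for x, continuous (sdist Gamma)}.
  by case: tubeG => _ /(_ 0%N)[c _] _; exact: c.
apply: continuous_rV3 => i.
rewrite (_ : (fun z => _) = (fun z : pt => z 0 i - sdist Gamma z * normal Gamma z 0 i)).
  apply: continuousB; first exact: coord_continuous.
  by apply: continuousM; [exact: Cd|exact: (continuous_normal tubeG)].
by apply/funext => z; rewrite closest_ptE !mxE.
Qed.

(* The images of all the faces, a neighbourhood of [s0] in the face [T] being
   removed, form a closed set that misses [pi (par T s0)]. *)
Lemma near_chart T s0 (e : R) : T \in Ts -> ref_tri s0 -> 0 < e ->
  \forall x \near par T s0, exists s, [/\ ref_tri s, `|s - s0| < e & pi (par T s) = pi x].
Proof.
move=> TTs rs0 e0.
have crs0 := sub_ref_tri rs0.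
have /nbhs_normP[e1 /= e10 he1] : nbhs s0 (@ref_tri R).
  by apply: open_nbhs_nbhs; split => //; exact: open_ref_tri.
pose e' := Num.min e e1.
have e'0 : 0 < e' by rewrite lt_min e0.
pose K T' : set (R * R) := cref_tri `&` [set s | T' = T -> e' <= `|s - s0|].
have cK T' : compact (K T').
  have [->|ne] := eqVneq T' T; last first.
    rewrite (_ : K T' = cref_tri); first exact: compact_cref_tri.
    by apply/seteqP; split=> [s []|s rs] //; split=> // eq; rewrite eq eqxx in ne.
  rewrite (_ : K T = cref_tri `&` (fun s => `|s - s0|) @^-1` [set r | e' <= r]).
    apply: compact_closedI; first exact: compact_cref_tri.
    apply: preimage_closed => [s _|]; last exact: closed_ge.
    apply: (@continuous_comp _ _ _ (fun s => s - s0) (fun v : R * R => `|v|)).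
      by apply: cvgB => //; exact: cvg_cst.
    exact: norm_continuous.
  apply/seteqP; split=> s [rs h]; (split; first exact: rs); first exact: h.
  by move=> _; exact: h.
pose W := \big[setU/set0]_(T' <- Ts) ((pi \o par T') @` K T').
have cW : closed W.
  apply: compact_closed; first exact: Rhausdorff_pt || exact: norm_hausdorff.
  rewrite /W big_seq; apply: bigsetU_compact => T' T'Ts.
  apply: continuous_compact; last exact: cK.
  apply: continuous_in_subspaceT => s; rewrite inE => -[rs _].
  apply: continuous_comp; first exact/continuous_param/face_nondegenerate.
  exact/continuous_closest/param_tube.
have WP z : W z <-> exists T' s, [/\ T' \in Ts, K T' s & z = pi (par T' s)].
  rewrite /W -bigcup_seq; split.
    by move=> [T' /= T'Ts [s Ks <-]]; exists T', s.
  by move=> [T' [s [T'Ts Ks ->]]]; exists T' => //; exists s.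
have nW : ~ W (pi (par T s0)).
  move=> /WP[T' [s [T'Ts [rs hs] e2]]].
  have [TT' ss] := closest_pt_param_inj TTs T'Ts rs0 rs e2.
  by have := hs (esym TT'); rewrite ss subrr normr0 leNgt e'0.
have Uy := param_tube TTs crs0.
have n1 : \forall x \near par T s0, ~ W (pi x).
  have c : forall A, nbhs (pi (par T s0)) A -> nbhs (par T s0) (pi @^-1` A) :=
    continuous_closest Uy.
  apply: c (~` W) _.
  by apply: open_nbhs_nbhs; split=> //; exact: closed_openC.
have n2 : \forall x \near par T s0, U x.
  by apply: open_nbhs_nbhs; split => //; exact: open_tube tubeG.
near=> x.
have Ux : U x by near: x.
have nWx : ~ W (pi x) by near: x.
have Gx := closest_pt_mem tubeG Ux.
(* Surjectivity onto [Gamma] provides some parameter over [pi x]; since [pi x] avoids [W], it can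
   only lie in the neighbourhood that was removed. *)
case: admG => _ _ [_ _ /(_ _ Gx)[y Sy ex]].
have [T' [s [T'Ts rs yE]]] := (surf_kP y).1 Sy.
rewrite {}yE {Sy} in ex.
have KW : K T' s -> False.
  by move=> Ks; apply: nWx; apply/WP; exists T', s; split; [exact: T'Ts|exact: Ks|exact: esym ex].
have TT' : T' = T.
  apply: contrapT => ne; apply: KW; split; first exact: rs.
  by move=> eq; case: (ne eq).
have se : `|s - s0| < e'.
  by rewrite ltNge; apply/negP => le; apply: KW; split; [exact: rs|move=> _; exact: le].
move: se; rewrite lt_min => /andP[se se1].
exists s; split; [|exact: se|by rewrite -TT'; exact: ex].
by apply: he1; rewrite /= distrC; exact: se1.
Unshelve. all: by end_near. Qed.

End SurfaceCharts.

(** * Surface gradients *)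

Section SurfaceGradient.
Context {R : realType}.
Local Notation pt := 'rV[R]_3.
Local Notation triangle := 'M[R]_3.

(** The Gram determinant, by [dot_cross] the squared area of the parallelogram. *)
Definition gram (a b : pt) : R := dot a a * dot b b - dot a b ^+ 2.

(* The vector of the plane spanned by [a] and [b] whose inner products with [a]
   and [b] are [g1] and [g2]. *)
Definition gradv (a b : pt) (g1 g2 : R) : pt :=
  (gram a b)^-1 *: ((dot b b * g1 - dot a b * g2) *: a + (dot a a * g2 - dot a b * g1) *: b).

Lemma combE (v u : pt) (x y : R) i :
  ((x *: v + y *: u) 0 i = x * v 0 i + y * u 0 i) *
  ((x *: v - y *: u) 0 i = x * v 0 i - y * u 0 i).
Proof. by rewrite !mxE. Qed.

(** A vector of the tangent plane is determined by its inner products with [a] and [b]. Hence the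
    projected gradient depends only on the derivatives along the two tangent vectors. *)
Lemma tangent_part (a b v : pt) (N := cross a b) : gram a b != 0 ->
  v - (dot v N / dot N N) *: N = gradv a b (dot v a) (dot v b).
Proof.
move=> g0; have NN : dot N N = gram a b by exact: dot_cross.
rewrite NN; apply: (scalerI g0); rewrite /gradv scalerA divff // scale1r.
rewrite scalerBr scalerA mulrCA divff // mulr1 /gram.
by apply: rV3P; rewrite !combE !dotE !crossE; ring.
Qed.

Lemma approx_lin_diff {V W : normedModType R} (f : V -> W) x (L : V -> W) :
  is_diff x f L -> approx_lin f x L.
Proof.
move=> [df <-] e e0.
have := (diff_locallyP x f).1 df => -[_] /eqaddoP /(_ e e0) /nbhs_normP[r /= r0 hr].
near=> z.
have zr : `|z - x| < r by near: z; exact: near_dist_lt.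
have := hr (z - x); rewrite /= sub0r normrN => /(_ zr).
by rewrite !fctE /= subrK opprD addrA.
Unshelve. all: by end_near. Qed.

Lemma approx_lin_comp {V W Z : normedModType R} (f : V -> W) (g : W -> Z) x Lf Lg (K : R) :
  0 <= K -> approx_lin f x Lf -> approx_lin g (f x) Lg ->
  (forall v, `|Lf v| <= K * `|v|) -> (forall v, `|Lg v| <= K * `|v|) ->
  (forall a b, Lg (a + b) = Lg a + Lg b) ->
  approx_lin (g \o f) x (Lg \o Lf).
Proof.
move=> K0 hf hg bf bg add e e0.
(* The outer approximation contributes K + 1 and the inner one K times [d], whence 2 K + 1. *)
pose d := Num.min 1 (e / (2 * K + 1)).
have K1 : 0 < 2 * K + 1 by lra.
have d0 : 0 < d by rewrite lt_min ltr01 divr_gt0.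
have [d1 d2] : d <= 1 /\ d * (2 * K + 1) <= e.
  by split; [rewrite ge_min lexx|rewrite -ler_pdivlMr // ge_min lexx orbT].
have /nbhs_normP[r /= r0 hr] := hg d d0.
have cE : 0 < r / (K + 1) by rewrite divr_gt0 //; lra.
near=> z.
have h1 : `|f z - f x - Lf (z - x)| <= d * `|z - x| by near: z; exact: hf.
have zr : `|z - x| < r / (K + 1) by near: z; exact: near_dist_lt.
have z0 := normr_ge0 (z - x).
have h2 : `|f z - f x| <= (K + 1) * `|z - x|.
  have := ler_normD (f z - f x - Lf (z - x)) (Lf (z - x)); rewrite subrK.
  have := bf (z - x); have : d * `|z - x| <= 1 * `|z - x| by rewrite ler_wpM2r.
  lra.
have h3 : `|g (f z) - g (f x) - Lg (f z - f x)| <= d * `|f z - f x|.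
  apply: hr; rewrite /= distrC; apply: le_lt_trans h2 _.
  by rewrite mulrC -ltr_pdivlMr //; lra.
have h4 : `|Lg (f z - f x - Lf (z - x))| <= K * (d * `|z - x|).
  by apply: le_trans (bg _) _; rewrite ler_wpM2l.
have sp : Lg (f z - f x) = Lg (f z - f x - Lf (z - x)) + Lg (Lf (z - x)).
  by rewrite -add subrK.
have -> : (g \o f) z - (g \o f) x - (Lg \o Lf) (z - x) =
    (g (f z) - g (f x) - Lg (f z - f x)) + Lg (f z - f x - Lf (z - x)).
  rewrite sp /=; move: (g (f z) - g (f x)) (Lg (f z - f x - _)) (Lg (Lf _)) => X A B.
  by rewrite opprD (addrC (- A)) addrA subrK.
apply: le_trans (ler_normD _ _) _.
have : d * `|f z - f x| <= d * ((K + 1) * `|z - x|) by rewrite ler_wpM2l // ltW.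
have : d * (2 * K + 1) * `|z - x| <= e * `|z - x| by rewrite ler_wpM2r.
lra.
Unshelve. all: by end_near. Qed.

Lemma approx_lin_derive {V W : normedModType R} (f : V -> W) x (L : V -> W) v :
  approx_lin f x L -> (forall (c : R) w, L (c *: w) = c *: L w) -> 'D_v f x = L v.
Proof.
move=> hf hL; apply: cvg_lim => //; apply/cvgrPdistC_le => e e0.
pose d := e / (`|v| + 1).
have v1 : 0 < `|v| + 1 by rewrite ltr_wpDl.
have d0 : 0 < d by rewrite divr_gt0.
have /nbhs_normP[r /= r0 hr] := hf d d0.
have rv : 0 < r / (`|v| + 1) by rewrite divr_gt0.
near=> h.
have h0 : h != 0 by near: h; exact: nbhs_dnbhs_neq.
have hn : 0 < `|h| by rewrite normr_gt0.
have hlt : `|h| < r / (`|v| + 1).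
  by near: h; apply: dnbhs0_lt.
have hv : `|h| * `|v| < r.
  apply: (@le_lt_trans _ _ (`|h| * (`|v| + 1))); first by rewrite ler_wpM2l //; lra.
  by rewrite -ltr_pdivlMr.
have := hr (h *: v + x); rewrite /= distrC addrK normrZ => /(_ hv).
rewrite hL => le1.
have -> : h^-1 *: ((f \o shift x) (h *: v) - f x) - L v =
    h^-1 *: (f (h *: v + x) - f x - h *: L v).
  by rewrite [RHS]scalerBr scalerA mulVf // scale1r.
rewrite normrZ normfV mulrC ler_pdivrMr //; apply: le_trans le1 _.
rewrite mulrCA [leRHS]mulrC ler_wpM2l //.
by rewrite /d mulrAC ler_pdivrMr // ler_wpM2l ?(ltW e0) //; lra.
Unshelve. all: by end_near. Qed.

Lemma norm_fst_le (v : R * R) : `|v.1| <= `|v|.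
Proof. by rewrite [leRHS]prod_normE le_max lexx. Qed.

Lemma norm_snd_le (v : R * R) : `|v.2| <= `|v|.
Proof. by rewrite [leRHS]prod_normE le_max lexx orbT. Qed.

Lemma norm_pair_le (v : R * R) c : `|v.1| <= c -> `|v.2| <= c -> `|v| <= c.
Proof. by move=> h1 h2; rewrite prod_normE ge_max h1. Qed.

(* If [f] is obtained from [Q] by a continuous solution [s] of [G s = pi x], and
   the differential of [G] is injective with left inverse [(dot d1, dot d2)], then
   [f] is differentiable. *)
Lemma approx_lin_implicit (pi P : pt -> pt) (G : R * R -> pt) (Q : R * R -> R)
    (f : pt -> R) (s0 : R * R) (y q1 q2 d1 d2 : pt) (g1 g2 K : R) :
  0 <= K -> (forall v, `|P v| <= K * `|v|) -> approx_lin pi y P ->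
  approx_lin G s0 (fun v => v.1 *: q1 + v.2 *: q2) ->
  approx_lin Q s0 (fun v => g1 * v.1 + g2 * v.2) ->
  dot d1 q1 = 1 -> dot d1 q2 = 0 -> dot d2 q1 = 0 -> dot d2 q2 = 1 ->
  G s0 = pi y -> f y = Q s0 ->
  (forall e : R, 0 < e -> \forall x \near y, exists s,
     [/\ `|s - s0| < e, G s = pi x & f x = Q s]) ->
  approx_lin f y (fun v => g1 * dot d1 (P v) + g2 * dot d2 (P v)).
Proof.
move=> K0 hK hp hG hQ d11 d12 d21 d22 Gs0 fy hf.
pose A := 3 * `|d1| + 3 * `|d2| + 1.
have A1 := normr_ge0 d1; have A2 := normr_ge0 d2.
have A0 : 0 < A by rewrite /A; lra.
have bd v : `|dot d1 v| <= A * `|v| /\ `|dot d2 v| <= A * `|v|.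
  by split; apply: le_trans (normr_dot_le _ _) _; rewrite ler_wpM2r // /A; lra.
pose B := 2 * A * (K + 1).
have B0 : 0 <= B by rewrite !mulr_ge0 //; [exact: ltW|lra].
pose E := B + (`|g1| + `|g2|) * A * (1 + B) + 1.
have G0 : 0 <= `|g1| + `|g2| by rewrite addr_ge0.
have E1 : 0 <= (`|g1| + `|g2|) * A * (1 + B).
  by rewrite !mulr_ge0 //; [exact: ltW|lra].
have E0 : 0 < E by rewrite /E; lra.
move=> e e0.
(* The condition [eta * A <= 1 / 2] absorbs |s - s0| into the left-hand side and yields the
   Lipschitz bound [sB] for the chosen parameter; [E] collects the coefficients of the remaining
   errors. *)
pose eta := Num.min 1 (Num.min (2 * A)^-1 (e / E)).
have eta0 : 0 < eta by rewrite !lt_min ltr01 invr_gt0 divr_gt0 // mulr_gt0.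
have [eta1 eta2 eta3] : [/\ eta <= 1, eta * A <= 1 / 2 & eta * E <= e].
  split; first by rewrite ge_min lexx.
    have : eta <= (2 * A)^-1 by rewrite ge_min ge_min lexx !orbT.
    by rewrite invfM -ler_pdivlMr // => /le_trans; apply; rewrite mul1r.
  by rewrite -ler_pdivlMr // ge_min ge_min lexx !orbT.
have /nbhs_normP[r1 /= r10 hr1] := hG eta eta0.
have /nbhs_normP[r2 /= r20 hr2] := hQ eta eta0.
pose r := Num.min r1 r2.
have r0 : 0 < r by rewrite lt_min r10.
near=> x.
have [s [sr pis fx]] : exists s, [/\ `|s - s0| < r, G s = pi x & f x = Q s].
  by near: x; exact: hf.
have hx : `|pi x - pi y - P (x - y)| <= eta * `|x - y| by near: x; exact: hp.
move: sr; rewrite lt_min => /andP[sr1 sr2].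
have {}hr1 := hr1 s; rewrite /= distrC in hr1; have {}hr1 := hr1 sr1.
have {}hr2 := hr2 s; rewrite /= distrC in hr2; have {}hr2 := hr2 sr2.
rewrite fx fy.
pose D1 := (s - s0).1; pose D2 := (s - s0).2.
pose e1 := G s - G s0 - (D1 *: q1 + D2 *: q2).
pose e2 := pi x - pi y - P (x - y).
have e12 : D1 *: q1 + D2 *: q2 = P (x - y) + (e2 - e1).
  rewrite /e1 /e2 pis Gs0; by apply/rowP => i; rewrite !mxE; ring.
have z0 := normr_ge0 (x - y).
have he1 : `|e1| <= eta * `|s - s0| := hr1.
have he2 : `|e2| <= eta * `|x - y| := hx.
have he : `|e2 - e1| <= eta * (`|x - y| + `|s - s0|).
  by apply: le_trans (ler_normB _ _) _; rewrite mulrDr lerD.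
have D1E : D1 = dot d1 (P (x - y)) + dot d1 (e2 - e1).
  by rewrite -dotDr -e12 dotDr !dotZr d11 d12; ring.
have D2E : D2 = dot d2 (P (x - y)) + dot d2 (e2 - e1).
  by rewrite -dotDr -e12 dotDr !dotZr d21 d22; ring.
have bde j : j = d1 \/ j = d2 -> `|dot j (e2 - e1)| <= A * eta * (`|x - y| + `|s - s0|).
  move=> hj; have : `|dot j (e2 - e1)| <= A * `|e2 - e1|.
    by case: hj => ->; [exact: (bd _).1|exact: (bd _).2].
  by move=> /le_trans; apply; rewrite -mulrA ler_wpM2l // ltW.
have bdc j : j = d1 \/ j = d2 -> `|dot j (P (x - y))| <= A * (K * `|x - y|).
  move=> hj; have : `|dot j (P (x - y))| <= A * `|P (x - y)|.
    by case: hj => ->; [exact: (bd _).1|exact: (bd _).2].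
  by move=> /le_trans; apply; rewrite ler_wpM2l // ltW.
have j1 : d1 = d1 \/ d1 = d2 by left.
have j2 : d2 = d1 \/ d2 = d2 by right.
have small (u v : R) : `|u| <= A * (K * `|x - y|) ->
    `|v| <= A * eta * (`|x - y| + `|s - s0|) ->
    `|u + v| <= A * (K + 1) * `|x - y| + 1 / 2 * `|s - s0|.
  move=> hu hv; apply: le_trans (ler_normD _ _) _.
  have c1 : eta * A * `|s - s0| <= 1 / 2 * `|s - s0| by rewrite ler_wpM2r.
  have c2 : A * eta * `|x - y| <= A * 1 * `|x - y|.
    by rewrite ler_wpM2r // ler_wpM2l // ltW.
  by lra.
have sB : `|s - s0| <= B * `|x - y|.
  have : `|s - s0| <= A * (K + 1) * `|x - y| + 1 / 2 * `|s - s0|.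
    apply: norm_pair_le; rewrite -/D1 -/D2.
      by rewrite D1E; apply: small; [exact: bdc j1|exact: bde j1].
    by rewrite D2E; apply: small; [exact: bdc j2|exact: bde j2].
  by rewrite /B; lra.
have fin j : j = d1 \/ j = d2 -> `|dot j (e2 - e1)| <= eta * (A * (1 + B) * `|x - y|).
  move=> hj; apply: le_trans (bde j hj) _.
  rewrite (_ : eta * _ = A * eta * (`|x - y| + B * `|x - y|)); last by ring.
  by rewrite ler_wpM2l ?lerD2l // mulr_ge0 // ltW.
have f1 := fin d1 j1; have f2 := fin d2 j2.
have -> : Q s - Q s0 - (g1 * dot d1 (P (x - y)) +
    g2 * dot d2 (P (x - y))) =
    (Q s - Q s0 - (g1 * D1 + g2 * D2)) +
    (g1 * dot d1 (e2 - e1) + g2 * dot d2 (e2 - e1)).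
  by rewrite D1E D2E; ring.
apply: le_trans (ler_normD _ _) _.
apply: (@le_trans _ _ (eta * (B * `|x - y|) + eta * ((`|g1| + `|g2|) * A * (1 + B) * `|x - y|))).
  apply: lerD.
    apply: (@le_trans _ _ (eta * `|s - s0|)); first exact: hr2.
    by rewrite ler_wpM2l // ltW.
  apply: le_trans (ler_normD _ _) _; rewrite !normrM.
  rewrite (_ : eta * _ = `|g1| * (eta * (A * (1 + B) * `|x - y|)) +
    `|g2| * (eta * (A * (1 + B) * `|x - y|))); last by ring.
  by apply: lerD; rewrite ler_wpM2l.
have ez : 0 <= eta * `|x - y| by rewrite mulr_ge0 // ltW.
have : eta * E * `|x - y| <= e * `|x - y| by rewrite ler_wpM2r.
rewrite /E => hE; apply: le_trans hE; rewrite [leRHS](_ : _ =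
  eta * (B * `|x - y|) + eta * ((`|g1| + `|g2|) * A * (1 + B) * `|x - y|) + eta * `|x - y|).
  by rewrite lerDl.
by ring.
Unshelve. all: by end_near. Qed.

Lemma dclosest_bounded (Gamma : set pt) y : exists2 K : R, 0 <= K &
  forall w, `|dclosest Gamma y w| <= K * `|w|.
Proof.
pose n := normal Gamma y.
pose g i := grad (fun z => normal Gamma z 0 i) y.
pose K := 1 + 3 * `|n| * `|n| + `|sdist Gamma y| * (3 * \sum_i `|g i|).
have K1 : 0 <= 3 * `|n| * `|n| by rewrite !mulr_ge0.
have S0 : 0 <= \sum_i `|g i| by apply: sumr_ge0.
have K2 : 0 <= `|sdist Gamma y| * (3 * \sum_i `|g i|) by rewrite !mulr_ge0.
exists K => [|w]; first by rewrite /K; lra.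
have w0 := normr_ge0 w.
apply: normv_le => [|i]; first by rewrite mulr_ge0 // /K; lra.
rewrite !mxE -![normal Gamma y]/n -[grad _ y]/(g i).
have -> : 'D_(basis_vec i) (sdist Gamma) y = n 0 i by rewrite mxE.
have h1 := normv_coord w i.
have h2 : `|dot n w * n 0 i| <= 3 * `|n| * `|n| * `|w|.
  rewrite normrM mulrAC; apply: ler_pM => //; [|exact: normv_coord].
  by have := normr_dot_le n w.
have h3 : `|sdist Gamma y * dot (g i) w| <= `|sdist Gamma y| * (3 * \sum_i `|g i|) * `|w|.
  rewrite normrM -mulrA ler_wpM2l //; apply: le_trans (normr_dot_le _ _) _.
  rewrite ler_wpM2r // ler_wpM2l // (bigD1 i) //= lerDl; exact: sumr_ge0.
have := ler_normB (w 0 i - dot n w * n 0 i) (sdist Gamma y * dot (g i) w).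
have := ler_normB (w 0 i) (dot n w * n 0 i).
rewrite /K; lra.
Qed.

Variables (Gamma : set pt) (delta : R) (k : nat) (Ts : seq triangle).
Hypotheses (tubeG : tubular Gamma delta) (polyG : polyhedral Gamma Ts)
  (admG : admissible Gamma delta k Ts).

Local Notation pi := (closest_pt Gamma).
Local Notation par := (param Gamma k).

Local Opaque sdist.

Lemma approx_lin_param T s : nondegenerate T ->
  approx_lin (par T) s (fun v => v.1 *: dparam1 Gamma k T s + v.2 *: dparam2 Gamma k T s).
Proof.
move=> nT; apply: approx_lin_row => i.
rewrite (_ : (fun z => _) = pev (param_coef Gamma k T i)); last first.
  by apply/funext => t; rewrite param_coefE.
apply: approx_lin_diff; apply: is_diff_eq (is_diff_pev (param_coef Gamma k T i) s) _.
by apply/funext => v; rewrite !mxE [X in X + _]mulrC [X in _ + X]mulrC.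
Qed.

Local Opaque param surf_k closest_pt polysurf proj_k ref_map dparam1 dparam2 dclosest.

(** Near [y] the extension is [q] in the chart, composed with a local inverse of pi o param and with
    pi; [near_chart] supplies this inverse. The vectors [d1] and [d2] are the dual basis of the
    projected tangent vectors [q1] and [q2] in their plane. *)
Lemma normal_ext_approx T s0 N (w : 'rV[R]_(N.+1 * N.+1)) (q : pt -> R)
    (y := par T s0) (q1 := dclosest Gamma y (dparam1 Gamma k T s0))
    (q2 := dclosest Gamma y (dparam2 Gamma k T s0)) :
  T \in Ts -> ref_tri s0 -> gram q1 q2 != 0 ->
  (forall s, ref_tri s -> q (par T s) = pev w s) ->
  exists d1 d2 : pt, [/\ dot d1 q1 = 1, dot d1 q2 = 0, dot d2 q1 = 0, dot d2 q2 = 1 &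
    approx_lin (normal_ext Gamma k Ts q) y (fun v =>
      pev1 w s0 * dot d1 (dclosest Gamma y v) + pev2 w s0 * dot d2 (dclosest Gamma y v))].
Proof.
move=> TTs rs0 g0 hq.
have nT := face_nondegenerate polyG TTs.
have Uy : U_ Gamma delta y := param_tube polyG admG TTs (sub_ref_tri rs0).
pose D := (gram q1 q2)^-1.
pose d1 : pt := D *: (dot q2 q2 *: q1 - dot q1 q2 *: q2).
pose d2 : pt := D *: (dot q1 q1 *: q2 - dot q1 q2 *: q1).
have gE : dot q1 q1 * dot q2 q2 - dot q1 q2 ^+ 2 != 0 := g0.
have d11 : dot d1 q1 = 1.
  by rewrite dotZl dotBl !dotZl (dotC q2 q1) /D /gram; field.
have d12 : dot d1 q2 = 0 by rewrite dotZl dotBl !dotZl; ring.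
have d21 : dot d2 q1 = 0 by rewrite dotZl dotBl !dotZl (dotC q2 q1); ring.
have d22 : dot d2 q2 = 1.
  by rewrite dotZl dotBl !dotZl /D /gram; field.
exists d1, d2; split=> //.
have [K K0 hK] := dclosest_bounded Gamma y.
pose p1 := dparam1 Gamma k T s0; pose p2 := dparam2 Gamma k T s0.
have hp := approx_lin_closest tubeG Uy.
have hG : approx_lin (pi \o par T) s0 (fun v : R * R => v.1 *: q1 + v.2 *: q2).
  pose K' := K + `|p1| + `|p2|.
  have n1 := normr_ge0 p1; have n2 := normr_ge0 p2.
  have -> : (fun v : R * R => v.1 *: q1 + v.2 *: q2) =
      dclosest Gamma y \o (fun v : R * R => v.1 *: p1 + v.2 *: p2).
    by apply/funext => v; rewrite /= dclosestD !dclosestZ.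
  apply: (approx_lin_comp (K := K')).
  - by rewrite !addr_ge0.
  - exact: approx_lin_param.
  - exact: hp.
  - move=> v; apply: le_trans (ler_normD _ _) _; rewrite !normrZ.
    rewrite /K' 2!mulrDl -addrA ler_wpDl ?mulr_ge0 //.
    rewrite ![`|_| * `|v|]mulrC.
    by apply: lerD; rewrite ler_wpM2r ?norm_fst_le ?norm_snd_le.
  - by move=> v; apply: le_trans (hK v) _; rewrite ler_wpM2r // /K' -addrA lerDl addr_ge0.
  - by move=> a b; rewrite dclosestD.
have hQ := approx_lin_diff (is_diff_pev w s0).
apply: (approx_lin_implicit K0 hK hp hG hQ d11 d12 d21 d22 erefl).
  by rewrite (normal_ext_param polyG admG q TTs rs0 erefl) hq.
move=> e e0; have := near_chart tubeG polyG admG TTs rs0 e0.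
apply: filterS => x [s [rs se pis]]; exists s; split; [exact: se|exact: pis|].
by rewrite (normal_ext_param polyG admG q TTs rs pis) hq.
Qed.

(** On the tangent vectors of the curved face the dual basis returns 1 and 0, so the differential of
    the extension returns the partial derivatives of [pev w]; [tangent_part] then determines the
    projected gradient. *)
Lemma surf_grad_param T s0 N (w : 'rV[R]_(N.+1 * N.+1)) (q : pt -> R)
    (p1 := dparam1 Gamma k T s0) (p2 := dparam2 Gamma k T s0) :
  T \in Ts -> ref_tri s0 -> gram p1 p2 != 0 ->
  gram (dclosest Gamma (par T s0) p1) (dclosest Gamma (par T s0) p2) != 0 ->
  (forall s, ref_tri s -> q (par T s) = pev w s) ->
  surf_grad Gamma k Ts q (par T s0) = gradv p1 p2 (pev1 w s0) (pev2 w s0).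
Proof.
move=> TTs rs0 gp gq hq.
have nT := face_nondegenerate polyG TTs.
have [d1 [d2 [d11 d12 d21 d22 hf]]] := normal_ext_approx TTs rs0 gq hq.
set y := par T s0 in hf d11 d12 d21 d22 *.
set g1 := pev1 w s0; set g2 := pev2 w s0.
pose L v := g1 * dot d1 (dclosest Gamma y v) + g2 * dot d2 (dclosest Gamma y v).
have LZ (c : R) v : L (c *: v) = c *: L v.
  by rewrite /L dclosestZ !dotZr -[_ *: _]/(_ * _); ring.
have LD u v : L (u + v) = L u + L v.
  by rewrite /L dclosestD !dotDr; ring.
pose gam := grad (normal_ext Gamma k Ts q) y.
have gamE i : gam 0 i = L (basis_vec i).
  by rewrite mxE (approx_lin_derive _ hf LZ).
have gamL v : dot gam v = L v.
  rewrite [in RHS](rV3_basis v) !LD !LZ dotE !gamE -![_ *: _]/(_ * _); ring.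
have gam1 : dot gam p1 = g1 by rewrite gamL /L d11 d21; ring.
have gam2 : dot gam p2 = g2 by rewrite gamL /L d12 d22; ring.
rewrite /surf_grad -/gam /tangent_proj (normal_kE polyG admG TTs rs0).
rewrite (param_crossE Gamma k s0 nT) -/p1 -/p2.
set n := (enorm (cross p1 p2))^-1; set v := cross p1 p2.
have vv : dot v v = gram p1 p2 by exact: dot_cross.
rewrite mulmxBr mulmx1 -gam1 -gam2 -(tangent_part gam gp) -/v; congr (_ - _).
have n2 : n * n = (dot v v)^-1.
  by rewrite -invfM -expr2 enorm_sq.
have mE : gam *m (n *: v)^T = (n * dot gam v)%:M.
  apply/matrixP => i j; rewrite (ord1 i) (ord1 j) mxE [RHS]mxE eqxx mulr1n.
  rewrite -dotZr; apply: eq_bigr => a _; congr (_ * _); exact: mxE.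
rewrite mulmxA mE mul_scalar_mx scalerA mulrAC n2; congr (_ *: _).
by rewrite mulrC.
Qed.

End SurfaceGradient.

(** * Perturbation of quadratic forms *)

Section MetricEstimates.
Context {R : realType}.
Local Notation pt := 'rV[R]_3.
Local Notation triangle := 'M[R]_3.

(** The perturbation costs at most 2 e, hence c / 2, times the larger of the two coefficients; the
    bound for the smaller one follows. *)
Lemma lower_bound_perturb (a b a' b' : pt) (c e : R) : 0 < c -> 4 * e <= c ->
  (forall w1 w2 : R, c * `|w1| <= `|w1 *: a + w2 *: b| /\ c * `|w2| <= `|w1 *: a + w2 *: b|) ->
  `|a' - a| <= e -> `|b' - b| <= e ->
  forall w1 w2 : R, c / 2 * `|w1| <= `|w1 *: a' + w2 *: b'| /\
    c / 2 * `|w2| <= `|w1 *: a' + w2 *: b'|.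
Proof.
move=> c0 ec lb ha hb w1 w2.
have e0 : 0 <= e by apply: le_trans ha.
have [h1 h2] := lb w1 w2.
have split : `|w1 *: a + w2 *: b| <= `|w1 *: a' + w2 *: b'| + e * (`|w1| + `|w2|).
  have -> : w1 *: a + w2 *: b = (w1 *: a' + w2 *: b') - (w1 *: (a' - a) + w2 *: (b' - b)).
    by apply/rowP => i; rewrite !mxE; ring.
  apply: le_trans (ler_normB _ _) _; rewrite lerD2l.
  apply: le_trans (ler_normD _ _) _; rewrite !normrZ mulrDr.
  by rewrite ![e * _]mulrC; apply: lerD; rewrite ler_wpM2l.
have [w12|w21] := leP `|w1| `|w2|.
- have m1 : e * `|w1| <= e * `|w2| by rewrite ler_wpM2l.
  have m2 : 4 * e * `|w2| <= c * `|w2| by rewrite ler_wpM2r.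
  have m3 : c * `|w1| <= c * `|w2| by rewrite ler_wpM2l // ltW.
  by split; lra.
- have m1 : e * `|w2| <= e * `|w1| by rewrite ler_wpM2l // ltW.
  have m2 : 4 * e * `|w1| <= c * `|w1| by rewrite ler_wpM2r.
  have m3 : c * `|w2| <= c * `|w1| by rewrite ler_wpM2l // ltW.
  by split; lra.
Qed.

(** The form is the squared length of g1 b - g2 a. It is the cofactor form of the Gram matrix, which
    [gradv_sq] identifies with the squared gradient times the determinant. *)
Lemma lower_bound_form (a b : pt) (c : R) : 0 < c ->
  (forall w1 w2 : R, c * `|w1| <= `|w1 *: a + w2 *: b| /\ c * `|w2| <= `|w1 *: a + w2 *: b|) ->
  forall g1 g2 : R, c ^+ 2 / 2 * (g1 ^+ 2 + g2 ^+ 2) <=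
    dot b b * g1 ^+ 2 - 2 * dot a b * g1 * g2 + dot a a * g2 ^+ 2.
Proof.
move=> c0 lb g1 g2; have [h2 h1] := lb (- g2) g1.
set u := _ + _ in h1 h2.
have -> : dot b b * g1 ^+ 2 - 2 * dot a b * g1 * g2 + dot a a * g2 ^+ 2 = dot u u.
  by rewrite /u dotDl !dotDr !dotZl !dotZr (dotC b a); ring.
have sq x : c * `|x| <= `|u| -> c ^+ 2 * x ^+ 2 <= dot u u.
  move=> hx; apply: le_trans (normv_sq_le_dot u).
  rewrite -[x ^+ 2]real_normK ?num_real // -exprMn lerXn2r ?nnegrE //.
  by rewrite mulr_ge0 // ltW.
by rewrite normrN in h2; have := sq _ h1; have := sq _ h2; lra.
Qed.

(** At g1 = a.a and g2 = a.b the form equals a.a times the Gram determinant. *)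
Lemma gram_lower (a b : pt) (mu : R) : 0 < mu ->
  (forall g1 g2 : R, mu * (g1 ^+ 2 + g2 ^+ 2) <=
    dot b b * g1 ^+ 2 - 2 * dot a b * g1 * g2 + dot a a * g2 ^+ 2) ->
  mu ^+ 2 <= gram a b.
Proof.
move=> mu0 lb; set aa := dot a a; set ab := dot a b; set bb := dot b b.
have a1 : mu <= aa by have := lb 0 1; rewrite -/aa -/ab -/bb; lra.
have a0 : 0 < aa by lra.
have h : mu * (aa ^+ 2 + ab ^+ 2) <= aa * gram a b.
  apply: le_trans (lb aa ab) _; rewrite -/aa -/ab -/bb /gram -/aa -/ab -/bb.
  by rewrite le_eqVlt; apply/orP; left; apply/eqP; ring.
have h2 : mu * aa * aa <= gram a b * aa.
  have : 0 <= mu * ab ^+ 2 by rewrite mulr_ge0 ?sqr_ge0 // ltW.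
  by lra.
rewrite ler_pM2r // in h2; apply: le_trans h2.
by rewrite expr2 ler_wpM2l // ltW.
Qed.

Lemma mul_diff_le (x x' y y' A B e f : R) : `|x - x'| <= e -> `|y - y'| <= f ->
  `|y| <= A -> `|x'| <= B -> `|x * y - x' * y'| <= e * A + B * f.
Proof.
move=> h1 h2 h3 h4; have -> : x * y - x' * y' = (x - x') * y + x' * (y - y') by ring.
by apply: le_trans (ler_normD _ _) _; rewrite !normrM; apply: lerD; apply: ler_pM.
Qed.

(** The difference is that of the squares divided by S S' (S + S'), which is at least 2 c^3. *)
Lemma inv_sqrt_diff (S S' G G' c e : R) : 0 < c -> c <= S -> c <= S' ->
  S ^+ 2 = G -> S' ^+ 2 = G' -> `|G - G'| <= e ->
  `|S^-1 - S'^-1| <= e / (2 * c ^+ 3).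
Proof.
move=> c0 cS cS' <- <- he.
have S0 : 0 < S by lra.
have S'0 : 0 < S' by lra.
have -> : S^-1 - S'^-1 = (S' - S) / (S * S') by field; rewrite !gt_eqF.
have SS : c ^+ 2 <= S * S' by rewrite expr2; apply: ler_pM => //; exact: ltW.
have SS0 : 0 < S * S' by exact: mulr_gt0.
have d1 : `|S' - S| * (2 * c) <= e.
  apply: le_trans he; rewrite subr_sqr normrM distrC ler_wpM2l //.
  by rewrite ger0_norm; lra.
rewrite normrM normfV (gtr0_norm SS0).
rewrite ler_pdivrMr // mulrAC ler_pdivlMr ?mulr_gt0 ?exprn_gt0 //.
have e0 : 0 <= e by apply: le_trans he.
have : `|S' - S| * (2 * c) * c ^+ 2 <= e * (S * S').
  by apply: ler_pM => //; [rewrite !mulr_ge0 //; lra|exact: sqr_ge0].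
by rewrite exprS; lra.
Qed.

(** The integrand of [b_form] scaled to unit size: the a's and b's are Gram entries, the x's and y's
    the inner products of [v] with the tangent vectors, [S] and [S'] the Jacobians, and [V] is |v|.
    A change [eta] of the metric is always multiplied by [V], and eta V is at most the change [del]
    of the inner products; in the application [eta] is h^2. *)
Lemma quotient_form_diff (K c : R) : 1 <= K -> 0 < c -> exists2 K' : R, 0 <= K' &
  forall (a11 a12 a22 b11 b12 b22 x1 x2 y1 y2 g1 g2 S S' V g eta del : R),
  `|a11| <= K -> `|a12| <= K -> `|a22| <= K ->
  `|b11| <= K -> `|b12| <= K -> `|b22| <= K ->
  `|b11 - a11| <= K * eta -> `|b12 - a12| <= K * eta -> `|b22 - a22| <= K * eta ->
  `|x1| <= K * V -> `|x2| <= K * V -> `|y1| <= K * V -> `|y2| <= K * V ->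
  `|y1 - x1| <= K * del -> `|y2 - x2| <= K * del -> eta * V <= del ->
  `|g1| <= g -> `|g2| <= g -> c <= S -> c <= S' ->
  S ^+ 2 = b11 * b22 - b12 ^+ 2 -> S' ^+ 2 = a11 * a22 - a12 ^+ 2 ->
  `|((b22 * g1 - b12 * g2) * y1 + (b11 * g2 - b12 * g1) * y2) / S -
    ((a22 * g1 - a12 * g2) * x1 + (a11 * g2 - a12 * g1) * x2) / S'| <= K' * del * g.
Proof.
move=> K1 c0; have K0 : 0 <= K by lra.
exists (4 * K ^+ 2 * (4 * K ^+ 2) / (2 * c ^+ 3) + 8 * K ^+ 2 / c).
  by rewrite addr_ge0 // divr_ge0 ?mulr_ge0 ?exprn_ge0 //; exact: ltW.
move=> a11 a12 a22 b11 b12 b22 x1 x2 y1 y2 g1 g2 S S' V g eta del.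
move=> a11K a12K a22K b11K b12K b22K d11 d12 d22 x1V x2V y1V y2V d1 d2 eV g1g g2g cS cS' SE S'E.
have g0 : 0 <= g by apply: le_trans g1g.
have Ke : 0 <= K * eta by apply: le_trans d11.
have KV : 0 <= K * V by apply: le_trans x1V.
have Kd : 0 <= K * del by apply: le_trans d1.
have lin (p q : R) P : `|p| <= P -> `|q| <= P -> 0 <= P ->
    `|p * g1 - q * g2| <= 2 * P * g /\ `|p * g2 - q * g1| <= 2 * P * g.
  move=> hp hq P0; split; apply: le_trans (ler_normB _ _) _; rewrite !normrM.
    have : `|p| * `|g1| <= P * g by apply: ler_pM.
    have : `|q| * `|g2| <= P * g by apply: ler_pM.
    lra.
  have : `|p| * `|g2| <= P * g by apply: ler_pM.
  have : `|q| * `|g1| <= P * g by apply: ler_pM.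
  lra.
have [al _] := lin _ _ _ a22K a12K K0.
have [_ be] := lin _ _ _ a11K a12K K0.
have [bl _] := lin _ _ _ b22K b12K K0.
have [_ bbe] := lin _ _ _ b11K b12K K0.
have [dal _] := lin _ _ _ d22 d12 Ke.
have [_ dbe] := lin _ _ _ d11 d12 Ke.
set Nb := (b22 * g1 - b12 * g2) * y1 + (b11 * g2 - b12 * g1) * y2.
set Na := (a22 * g1 - a12 * g2) * x1 + (a11 * g2 - a12 * g1) * x2.
have KgKV : 0 <= 2 * K * g by rewrite !mulr_ge0.
have hNb : `|Nb| <= 4 * K ^+ 2 * V * g.
  apply: le_trans (ler_normD _ _) _; rewrite !normrM.
  have : `|b22 * g1 - b12 * g2| * `|y1| <= 2 * K * g * (K * V) by apply: ler_pM.
  have : `|b11 * g2 - b12 * g1| * `|y2| <= 2 * K * g * (K * V) by apply: ler_pM.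
  lra.
have hd : `|Nb - Na| <= 8 * K ^+ 2 * del * g.
  have -> : Nb - Na = ((b22 * g1 - b12 * g2) * y1 - (a22 * g1 - a12 * g2) * x1) +
     ((b11 * g2 - b12 * g1) * y2 - (a11 * g2 - a12 * g1) * x2) by rewrite /Nb /Na; ring.
  have p1 : `|(b22 * g1 - b12 * g2) * y1 - (a22 * g1 - a12 * g2) * x1| <=
      2 * (K * eta) * g * (K * V) + 2 * K * g * (K * del).
    apply: mul_diff_le => //; apply: le_trans dal.
    by rewrite le_eqVlt; apply/orP; left; apply/eqP; congr (`|_|); ring.
  have p2 : `|(b11 * g2 - b12 * g1) * y2 - (a11 * g2 - a12 * g1) * x2| <=
      2 * (K * eta) * g * (K * V) + 2 * K * g * (K * del).
    apply: mul_diff_le => //; apply: le_trans dbe.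
    by rewrite le_eqVlt; apply/orP; left; apply/eqP; congr (`|_|); ring.
  apply: le_trans (ler_normD _ _) _.
  have : (K ^+ 2 * g) * (eta * V) <= (K ^+ 2 * g) * del.
    by rewrite ler_wpM2l // mulr_ge0 // sqr_ge0.
  lra.
have hG : `|(b11 * b22 - b12 ^+ 2) - (a11 * a22 - a12 ^+ 2)| <= 4 * K ^+ 2 * eta.
  have -> : (b11 * b22 - b12 ^+ 2) - (a11 * a22 - a12 ^+ 2) =
    (b11 * b22 - a11 * a22) - (b12 * b12 - a12 * a12) by ring.
  have p1 : `|b11 * b22 - a11 * a22| <= K * eta * K + K * (K * eta) by exact: mul_diff_le.
  have p2 : `|b12 * b12 - a12 * a12| <= K * eta * K + K * (K * eta) by exact: mul_diff_le.
  by apply: le_trans (ler_normB _ _) _; lra.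
have hS := inv_sqrt_diff c0 cS cS' SE S'E hG.
have S'0 : 0 < S' by lra.
have -> : Nb / S - Na / S' = Nb * (S^-1 - S'^-1) + (Nb - Na) / S'.
  by rewrite mulrBl mulrBr addrA subrK.
apply: le_trans (ler_normD _ _) _; rewrite !normrM normfV (gtr0_norm S'0).
have i1 : S'^-1 <= c^-1 by rewrite lef_pV2 ?posrE.
have t2 : `|Nb - Na| * S'^-1 <= 8 * K ^+ 2 * del * g * c^-1.
  by apply: ler_pM => //; rewrite invr_ge0 ltW.
have t1 : `|Nb| * `|S^-1 - S'^-1| <= 4 * K ^+ 2 * V * g * (4 * K ^+ 2 * eta / (2 * c ^+ 3)).
  by apply: ler_pM.
have t3 : (4 * K ^+ 2 * (4 * K ^+ 2) / (2 * c ^+ 3) * g) * (eta * V) <=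
    (4 * K ^+ 2 * (4 * K ^+ 2) / (2 * c ^+ 3) * g) * del.
  rewrite ler_wpM2l // mulr_ge0 // divr_ge0 ?mulr_ge0 ?exprn_ge0 //; exact: ltW.
by move: t1 t2 t3; set Q := (2 * c ^+ 3)^-1; set Z := c^-1; lra.
Qed.

End MetricEstimates.

(** * The metric of a curved face *)

Section ParamMetric.
Context {R : realType}.
Local Notation pt := 'rV[R]_3.
Local Notation triangle := 'M[R]_3.

(** The second clause concerns every [v]. Tested with the tangent vectors, which are almost
    orthogonal to the normal, it says that the Gram entries change only by O(h^4), that is by h^2
    relative to their size. The last clause is uniform ellipticity. *)
Definition metric_est (Gamma : set pt) (K h : R) (T : triangle) (b1 b2 : pt) : Prop :=
  [/\ `|b1| <= K * h /\ `|b2| <= K * h,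
      forall v, let B := K * h * (h * `|dot v (vnormal Gamma T)| + h ^+ 2 * `|v|) in
        `|dot v b1 - dot v (edge1 T)| <= B /\ `|dot v b2 - dot v (edge2 T)| <= B,
      `|dot (vnormal Gamma T) b1| <= K * h ^+ 2 /\ `|dot (vnormal Gamma T) b2| <= K * h ^+ 2 &
      forall g1 g2 : R, K^-1 * h ^+ 2 * (g1 ^+ 2 + g2 ^+ 2) <=
        dot b2 b2 * g1 ^+ 2 - 2 * dot b1 b2 * g1 * g2 + dot b1 b1 * g2 ^+ 2].

Lemma metric_gram (Gamma : set pt) K h T b1 b2 : 0 < K -> 0 < h ->
  metric_est Gamma K h T b1 b2 -> (K^-1 * h ^+ 2) ^+ 2 <= gram b1 b2.
Proof.
by move=> K0 h0 [_ _ _ lb]; apply: gram_lower lb; rewrite mulr_gt0 ?invr_gt0 ?exprn_gt0.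
Qed.

(** All is read off from b - a = c n0 + r: tested with [v], the first term gives v.n0 at order h^2
    and the second |v| at order h^3. *)
Lemma shift_estimates (n0 a b : pt) (C h : R) : 1 <= C -> 0 < h -> h <= 1 ->
  `|n0| <= C -> `|a| <= h -> `|dot n0 a| <= C * h ^+ 2 ->
  (exists c r, [/\ b = a + c *: n0 + r, `|c| <= C * h ^+ 2 & `|r| <= C * h ^+ 3]) ->
  [/\ `|b - a| <= 2 * C ^+ 2 * h ^+ 2, `|b| <= 3 * C ^+ 2 * h,
      forall v, `|dot v b - dot v a| <= 3 * C * h * (h * `|dot v n0| + h ^+ 2 * `|v|) &
      `|dot n0 b| <= 13 * C ^+ 3 * h ^+ 2].
Proof.
move=> C1 h0 h1 nC ah na [c [r [bE cC rC]]].
have hh : 0 <= h by exact: ltW.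
have CC : C <= C ^+ 2 by rewrite expr2 ler_peMl //; lra.
have CCC : C ^+ 2 <= C ^+ 3 by rewrite [leRHS]exprS ler_peMl ?sqr_ge0.
have h2 : h ^+ 2 <= h by rewrite expr2 ler_piMl.
have h3 : h ^+ 3 <= h ^+ 2 by rewrite [leLHS]exprS ler_piMl ?sqr_ge0.
have h20 : 0 <= h ^+ 2 by exact: sqr_ge0.
have C0 : 0 <= C by lra.
have d1 : `|b - a| <= 2 * C ^+ 2 * h ^+ 2.
  have -> : b - a = c *: n0 + r by rewrite bE; apply/rowP => i; rewrite !mxE; ring.
  apply: le_trans (ler_normD _ _) _; rewrite normrZ.
  have : `|c| * `|n0| <= C * h ^+ 2 * C by apply: ler_pM.
  have : C * h ^+ 3 <= C ^+ 2 * h ^+ 2 by apply: ler_pM => //; rewrite exprn_ge0.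
  lra.
have dv v : `|dot v b - dot v a| <= 3 * C * h * (h * `|dot v n0| + h ^+ 2 * `|v|).
  have -> : dot v b - dot v a = c * dot v n0 + dot v r.
    by rewrite bE !dotDr dotZr; ring.
  apply: le_trans (ler_normD _ _) _; rewrite normrM.
  have : `|c| * `|dot v n0| <= C * h ^+ 2 * `|dot v n0| by rewrite ler_wpM2r.
  have : `|dot v r| <= 3 * `|v| * (C * h ^+ 3).
    by apply: le_trans (normr_dot_le _ _) _; rewrite ler_wpM2l ?mulr_ge0.
  have : 0 <= C * h ^+ 2 * `|dot v n0| by rewrite !mulr_ge0.
  lra.
split=> //.
- have := ler_normD (b - a) a; rewrite subrK.
  have : C ^+ 2 * h ^+ 2 <= C ^+ 2 * h by rewrite ler_wpM2l ?sqr_ge0.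
  have : 1 * h <= C ^+ 2 * h by rewrite ler_wpM2r //; lra.
  lra.
- have := ler_normD (dot n0 b - dot n0 a) (dot n0 a); rewrite subrK.
  have := dv n0.
  have nn : `|dot n0 n0| <= 3 * C * C.
    by apply: le_trans (normr_dot_le _ _) _; rewrite -!mulrA ler_wpM2l // ler_pM.
  have : 3 * C * h * (h * `|dot n0 n0| + h ^+ 2 * `|n0|) <= 
      3 * C * h * (h * (3 * C * C) + h * C).
    rewrite ler_wpM2l ?mulr_ge0 // lerD //; first by rewrite ler_wpM2l.
    by rewrite ler_pM.
  have : C * h ^+ 2 <= C ^+ 3 * h ^+ 2 by rewrite ler_wpM2r //; lra.
  have : C ^+ 2 * h ^+ 2 <= C ^+ 3 * h ^+ 2 by rewrite ler_wpM2r //; lra.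
  lra.
Qed.

(** The projection changes a tangent vector only at second order, because its normal component is
    O(h^2) and d is O(h). This keeps the projected tangent vectors independent, as the chart
    argument requires. *)
Lemma closest_shift_le (n0 ny b q : pt) (C h dy : R) : 1 <= C -> 0 <= h ->
  `|ny - n0| <= C * h -> `|dy| <= C * h -> `|b| <= 3 * C ^+ 2 * h ->
  `|dot n0 b| <= 13 * C ^+ 3 * h ^+ 2 ->
  `|q - b| <= C * (`|dot ny b| + `|dy| * `|b|) -> `|q - b| <= 25 * C ^+ 4 * h ^+ 2.
Proof.
move=> C1 h0 hn hd hb hnb /le_trans; apply.
have C0 : 0 <= C by lra.
have x1 : `|dot ny b| <= 22 * C ^+ 3 * h ^+ 2.
  have -> : dot ny b = dot n0 b + dot (ny - n0) b by rewrite dotBl addrC subrK.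
  apply: le_trans (ler_normD _ _) _.
  have : `|dot (ny - n0) b| <= 3 * (C * h) * (3 * C ^+ 2 * h).
    by apply: le_trans (normr_dot_le _ _) _; apply: ler_pM => //; rewrite ?mulr_ge0 ?ler_wpM2l.
  lra.
have x2 : `|dy| * `|b| <= C * h * (3 * C ^+ 2 * h) by apply: ler_pM.
have : C * (`|dot ny b| + `|dy| * `|b|) <=
    C * (22 * C ^+ 3 * h ^+ 2 + C * h * (3 * C ^+ 2 * h)).
  by rewrite ler_wpM2l // lerD.
lra.
Qed.

Variables (Gamma : set pt) (delta : R) (H : set R) (Th : R -> seq triangle).
Hypotheses (surfG : smooth_closed_surface Gamma) (tubeG : tubular Gamma delta)
  (meshG : mesh_family Gamma H Th).

Local Notation n := (normal Gamma).

Definition param_metric_at (K h : R) k T s : Prop :=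
  let y := param Gamma k T s in
  [/\ metric_est Gamma K h T (dparam1 Gamma k T s) (dparam2 Gamma k T s),
      gram (dclosest Gamma y (dparam1 Gamma k T s))
           (dclosest Gamma y (dparam2 Gamma k T s)) != 0,
      U_ Gamma delta y & `|n y - vnormal Gamma T| <= K * h].

Lemma lower_bound_edges (kap h : R) (a b : pt) :
  (forall w1 w2 : R, let u := w1 *: a + w2 *: b in
     kap * h * `|w1| <= enorm u /\ kap * h * `|w2| <= enorm u) ->
  forall w1 w2 : R, kap * h / 2 * `|w1| <= `|w1 *: a + w2 *: b| /\
    kap * h / 2 * `|w2| <= `|w1 *: a + w2 *: b|.
Proof.
move=> lb w1 w2; have [h1 h2] := lb w1 w2.
by have := enorm_le_normv (w1 *: a + w2 *: b); split; lra.
Qed.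

Local Opaque param dparam1 dparam2 dclosest normal sdist.

(** The independence of the edges survives two perturbations of size O(h^2), to the tangent vectors
    and then to their images under [dclosest]; each halves the lower bound. *)
Lemma param_metric k : (0 < k)%N -> exists2 h0 : R, 0 < h0 <= 1 & exists2 K : R, 1 <= K &
  forall h, H h -> h < h0 -> forall T, T \in Th h ->
    [/\ 0 < h, `|vnormal Gamma T| <= K, metric_est Gamma K h T (edge1 T) (edge2 T) &
        forall s, cref_tri s -> param_metric_at K h k T s].
Proof.
move=> k0.
have [h0 /andP[h00 h01] [C C1 hF]] := face_estimates surfG tubeG meshG k0.
have [kap kap0 hM] := mesh_faces meshG.
have C0 : 0 < C by lra.
have C40 : 0 < 400 * C ^+ 4 by apply: mulr_gt0; [rewrite ltr0n|exact: exprn_gt0].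
(* The second perturbation is the critical one: its size 25 C^4 h^2, taken four times, must not
   exceed kap h / 4. *)
exists (Num.min h0 (kap / (400 * C ^+ 4))).
  by rewrite lt_min ge_min h00 h01 divr_gt0.
(* The summand 32 / kap^2 is the inverse of the ellipticity constant that [lower_bound_form] gives
   for the bound kap h / 4. *)
pose K := 13 * C ^+ 4 + 32 / kap ^+ 2.
have K2 : 0 < 32 / kap ^+ 2 by rewrite divr_gt0 // exprn_gt0.
have pC i j : (i <= j)%N -> C ^+ i <= C ^+ j by move=> ij; exact: ler_weXn2l.
have [c1 c2 c3 c4] : [/\ 1 <= C ^+ 4, C <= C ^+ 4, C ^+ 2 <= C ^+ 4 & C ^+ 3 <= C ^+ 4].
  by split; [exact: (pC 0 4)|exact: (pC 1 4)|exact: pC|exact: pC].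
exists K; first by rewrite /K; lra.
move=> h Hh; rewrite lt_min => /andP[hh0]; rewrite ltr_pdivlMr // => hsmall T TTh.
have [h_gt0 _ _] : [/\ 0 < h, polyhedral Gamma (Th h) & meshsize (Th h) = h].
  by case: meshG => /(_ h Hh).
have h1 : h <= 1 by lra.
have hh : 0 <= h by exact: ltW.
have h2 : 0 <= h ^+ 2 by exact: sqr_ge0.
have [[e1h e2h n1 n2 nC] hP] := hF h Hh hh0 T TTh.
have [_ _ _ _ lbe] := hM h Hh T TTh.
have lb0 := lower_bound_edges lbe.
have kh : 0 < kap * h by exact: mulr_gt0.
have kh2 : 0 < kap * h / 2 by rewrite divr_gt0.
have kh4 : 0 < kap * h / 2 / 2 by rewrite divr_gt0.
have Kinv : K^-1 <= kap ^+ 2 / 32.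
  rewrite -[leRHS]invrK lef_pV2 ?posrE ?invr_gt0 ?divr_gt0 ?exprn_gt0 //; last first.
    by rewrite /K; lra.
  by rewrite invf_div /K; lra.
have est b1 b2 : `|b1| <= 3 * C ^+ 2 * h -> `|b2| <= 3 * C ^+ 2 * h ->
    (forall v, `|dot v b1 - dot v (edge1 T)| <=
       3 * C * h * (h * `|dot v (vnormal Gamma T)| + h ^+ 2 * `|v|)) ->
    (forall v, `|dot v b2 - dot v (edge2 T)| <=
       3 * C * h * (h * `|dot v (vnormal Gamma T)| + h ^+ 2 * `|v|)) ->
    `|dot (vnormal Gamma T) b1| <= 13 * C ^+ 3 * h ^+ 2 ->
    `|dot (vnormal Gamma T) b2| <= 13 * C ^+ 3 * h ^+ 2 ->
    (forall w1 w2 : R, kap * h / 2 / 2 * `|w1| <= `|w1 *: b1 + w2 *: b2| /\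
      kap * h / 2 / 2 * `|w2| <= `|w1 *: b1 + w2 *: b2|) ->
    metric_est Gamma K h T b1 b2.
  move=> n1' n2' d1 d2 m1 m2 lb.
  have k1 : 3 * C ^+ 2 * h <= K * h by rewrite ler_wpM2r // /K; lra.
  have k2 : 13 * C ^+ 3 * h ^+ 2 <= K * h ^+ 2 by rewrite ler_wpM2r // /K; lra.
  have k3 : 3 * C * h <= K * h by rewrite ler_wpM2r // /K; lra.
  split.
  - by split; [exact: le_trans n1' k1|exact: le_trans n2' k1].
  - move=> v B; have B0 : 0 <= h * `|dot v (vnormal Gamma T)| + h ^+ 2 * `|v|.
      by rewrite addr_ge0 // mulr_ge0.
    split; [apply: le_trans (d1 v) _|apply: le_trans (d2 v) _]; exact: ler_wpM2r.
  - by split; [exact: le_trans m1 k2|exact: le_trans m2 k2].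
  - move=> g1 g2; apply: le_trans (lower_bound_form kh4 lb g1 g2).
    rewrite ler_wpM2r ?addr_ge0 ?sqr_ge0 //.
    have -> : (kap * h / 2 / 2) ^+ 2 / 2 = kap ^+ 2 / 32 * h ^+ 2 by field.
    by rewrite ler_wpM2r.
have C2h : `|edge1 T| <= 3 * C ^+ 2 * h /\ `|edge2 T| <= 3 * C ^+ 2 * h.
  have : 1 * h <= C ^+ 2 * h by rewrite ler_wpM2r //; exact: (pC 0 2).
  by split; lra.
have B0 v : 0 <= 3 * C * h * (h * `|dot v (vnormal Gamma T)| + h ^+ 2 * `|v|).
  by rewrite !mulr_ge0 ?addr_ge0 ?mulr_ge0 // ltW.
have nC3 : C * h ^+ 2 <= 13 * C ^+ 3 * h ^+ 2.
  by rewrite ler_wpM2r //; have := pC 1%N 3%N isT; rewrite expr1; have := exprn_gt0 3 C0; lra.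
have face : metric_est Gamma K h T (edge1 T) (edge2 T).
  apply: est; [exact: C2h.1|exact: C2h.2| | | | |].
  - by move=> v; rewrite subrr normr0.
  - by move=> v; rewrite subrr normr0.
  - exact: le_trans n1 nC3.
  - exact: le_trans n2 nC3.
  - move=> w1 w2; have [l1 l2] := lb0 w1 w2.
    have : 0 <= kap * h / 2 / 2 * `|w1| by rewrite mulr_ge0 // ltW.
    have : 0 <= kap * h / 2 / 2 * `|w2| by rewrite mulr_ge0 // ltW.
    by split; lra.
split=> //; first by apply: le_trans nC _; rewrite /K; lra.
move=> s rs; have [sh1 sh2 Uy ny [dy dc]] := hP s rs.
have [f1 f2 f3 f4] := shift_estimates C1 h_gt0 h1 nC e1h n1 sh1.
have [g1 g2 g3 g4] := shift_estimates C1 h_gt0 h1 nC e2h n2 sh2.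
set b1 := dparam1 Gamma k T s in f1 f2 f3 f4 *.
set b2 := dparam2 Gamma k T s in g1 g2 g3 g4 *.
set y := param Gamma k T s in Uy ny dy dc *.
have small : 100 * C ^+ 4 * h ^+ 2 <= kap * h / 4.
  have : h * (400 * C ^+ 4) * h <= kap * h by rewrite ler_wpM2r // ltW.
  by rewrite expr2; lra.
have c2h : C ^+ 2 * h ^+ 2 <= C ^+ 4 * h ^+ 2 by rewrite ler_wpM2r.
have c4h : 0 <= C ^+ 4 * h ^+ 2 by rewrite mulr_ge0 // exprn_ge0 // ltW.
have lb1 := lower_bound_perturb kh2 _ lb0 f1 g1.
have {}lb1 := lb1 ltac:(lra).
have q_le b : `|b| <= 3 * C ^+ 2 * h -> `|dot (vnormal Gamma T) b| <= 13 * C ^+ 3 * h ^+ 2 ->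
    `|dclosest Gamma y b - b| <= 25 * C ^+ 4 * h ^+ 2.
  by move=> bh nb; exact: (closest_shift_le C1 hh ny dy bh nb (dc b)).
have lb2 := lower_bound_perturb kh4 _ lb1 (q_le b1 f2 f4) (q_le b2 g2 g4).
have {}lb2 := lb2 ltac:(lra).
have kh8 : 0 < kap * h / 2 / 2 / 2 by rewrite divr_gt0.
split=> //.
- exact: est.
- have mu0 : 0 < (kap * h / 2 / 2 / 2) ^+ 2 / 2 by rewrite divr_gt0 // exprn_gt0.
  have := gram_lower mu0 (lower_bound_form kh8 lb2).
  by move=> /(lt_le_trans (exprn_gt0 2 mu0)) /gt_eqF ->.
- by apply: le_trans ny _; rewrite ler_wpM2r // /K; lra.
Qed.

End ParamMetric.

(** * Jacobian, gradient energy and the density of the bilinear form *)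

Section MetricConsequences.
Context {R : realType}.
Local Notation pt := 'rV[R]_3.
Local Notation triangle := 'M[R]_3.

(** The Gram determinant in [gradv] is the square of the Jacobian. One factor cancels, which leaves
    the quotient treated by [quotient_form_diff]. *)
Lemma gradv_density (b1 b2 v : pt) g1 g2 : 0 < gram b1 b2 ->
  dot v (gradv b1 b2 g1 g2) * Num.sqrt (gram b1 b2) =
  ((dot b2 b2 * g1 - dot b1 b2 * g2) * dot v b1 +
   (dot b1 b1 * g2 - dot b1 b2 * g1) * dot v b2) / Num.sqrt (gram b1 b2).
Proof.
move=> g0; have s0 : 0 < Num.sqrt (gram b1 b2) by rewrite sqrtr_gt0.
have gE : gram b1 b2 = Num.sqrt (gram b1 b2) ^+ 2 by rewrite sqr_sqrtr // ltW.
rewrite /gradv dotZr dotDr !dotZr {1}gE.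
by field; rewrite gt_eqF.
Qed.

Lemma gradv_sq (b1 b2 : pt) g1 g2 : 0 < gram b1 b2 ->
  dot (gradv b1 b2 g1 g2) (gradv b1 b2 g1 g2) * gram b1 b2 =
  dot b2 b2 * g1 ^+ 2 - 2 * dot b1 b2 * g1 * g2 + dot b1 b1 * g2 ^+ 2.
Proof.
move=> g0; rewrite /gradv dotZl dotZr dotDl !dotDr !dotZl !dotZr (dotC b2 b1).
have : gram b1 b2 != 0 by rewrite gt_eqF.
rewrite /gram => g0'; by field.
Qed.

(** The gradient energy is scale invariant in two dimensions, hence no power of h in the third
    clause, whereas the area scales like h^2. *)
Definition metric_bounds Gamma (K1 h : R) T (b1 b2 : pt) : Prop :=
  let J := Num.sqrt (gram b1 b2) in
  [/\ 0 < gram b1 b2, K1^-1 * h ^+ 2 <= J <= K1 * h ^+ 2,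
      forall g1 g2, let u := gradv b1 b2 g1 g2 in
        K1^-1 * (g1 ^+ 2 + g2 ^+ 2) <= dot u u * J <= K1 * (g1 ^+ 2 + g2 ^+ 2) &
      forall v g1 g2, `|dot v (gradv b1 b2 g1 g2) * J -
          dot v (gradv (edge1 T) (edge2 T) g1 g2) * Num.sqrt (gram (edge1 T) (edge2 T))| <=
        K1 * h ^+ 2 * (`|dot v (vnormal Gamma T)| + h * `|v|) * (`|g1| + `|g2|)].

(** Gram entries and Jacobians are divided by h^2 and inner products with tangent vectors by h. All
    data then have unit size, and [quotient_form_diff] applies with eta = h^2 and del = h |v.n0| +
    h^2 |v|. In the constant, [K'] serves this difference and 9 K^4 the other bounds. *)
Lemma metric_consequences (Gamma : set pt) (K : R) : 1 <= K -> exists2 K1 : R, 1 <= K1 &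
  forall h T b1 b2, 0 < h -> h <= 1 ->
  metric_est Gamma K h T (edge1 T) (edge2 T) -> metric_est Gamma K h T b1 b2 ->
  metric_bounds Gamma K1 h T b1 b2.
Proof.
move=> K1; have K0 : 0 < K by lra.
have Kp i j : (i <= j)%N -> K ^+ i <= K ^+ j by move=> ij; exact: ler_weXn2l.
have [k1 k2] : K <= K ^+ 2 /\ 1 <= K ^+ 2 by split; [exact: (Kp 1 2)|exact: (Kp 0 2)].
have K6 : 1 <= 6 * K ^+ 2 by lra.
have Kinv0 : 0 < K^-1 by rewrite invr_gt0.
have [K' K'0 hQ] := quotient_form_diff K6 Kinv0.
exists (K' + 9 * K ^+ 4) => [|h T b1 b2 h0 h1 ma mb]; last pose J := Num.sqrt (gram b1 b2).
  by have := Kp 0%N 4%N isT; rewrite expr0; lra.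
have ga := metric_gram K0 h0 ma; have gb := metric_gram K0 h0 mb.
have pos : 0 < (K^-1 * h ^+ 2) ^+ 2 by rewrite exprn_gt0 // mulr_gt0 // exprn_gt0.
have ga0 := lt_le_trans pos ga; have gb0 := lt_le_trans pos gb.
have hh := ltW h0; have h2 : 0 < h ^+ 2 by rewrite exprn_gt0.
have sqrt_ge (x : R) : (K^-1 * h ^+ 2) ^+ 2 <= x -> K^-1 * h ^+ 2 <= Num.sqrt x.
  move=> hx; rewrite -[leLHS]ger0_norm ?mulr_ge0 ?(ltW Kinv0) ?(ltW h2) //.
  by rewrite -sqrtr_sqr ler_wsqrtr.
have Ja := sqrt_ge _ ga; have Jb : K^-1 * h ^+ 2 <= J := sqrt_ge _ gb.
have J0 : 0 < J by rewrite sqrtr_gt0.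
have JJ : J ^+ 2 = gram b1 b2 by rewrite sqr_sqrtr // ltW.
have dotb (u v : pt) : `|u| <= K * h -> `|v| <= K * h -> `|dot u v| <= 3 * K ^+ 2 * h ^+ 2.
  move=> hu hv; apply: le_trans (normr_dot_le _ _) _.
  rewrite (_ : 3 * K ^+ 2 * h ^+ 2 = 3 * (K * h) * (K * h)); last by ring.
  by apply: ler_pM => //; rewrite ?mulr_ge0 // ler_wpM2l.
have [[na1 na2] da [ma1 ma2] fa] := ma; have [[nb1 nb2] db [mb1 mb2] fb] := mb.
have Ka : K * K ^+ 2 <= K ^+ 4 by rewrite -exprS; exact: Kp.
have K4 : K <= K ^+ 4 by exact: (Kp 1%N 4%N).
have K24 : K ^+ 2 <= K ^+ 4 by exact: Kp.
have K40 : 0 <= K ^+ 4 by rewrite exprn_ge0 // ltW.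
have [B11 B12 B22] : [/\ `|dot b1 b1| <= 3 * K ^+ 2 * h ^+ 2,
  `|dot b1 b2| <= 3 * K ^+ 2 * h ^+ 2 & `|dot b2 b2| <= 3 * K ^+ 2 * h ^+ 2].
  by split; exact: dotb.
have gle : gram b1 b2 <= (3 * K ^+ 2 * h ^+ 2) ^+ 2.
  rewrite /gram; have : 0 <= dot b1 b2 ^+ 2 by exact: sqr_ge0.
  have : dot b1 b1 * dot b2 b2 <= (3 * K ^+ 2 * h ^+ 2) * (3 * K ^+ 2 * h ^+ 2).
    by apply: ler_pM; rewrite ?dot_ge0 //; exact: le_trans (ler_norm _) _.
  clear -K0; lra.
have Jle : J <= 3 * K ^+ 2 * h ^+ 2.
  have nn : 0 <= 3 * K ^+ 2 * h ^+ 2.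
    by apply: mulr_ge0; [apply: mulr_ge0; [exact: ler0n|exact: sqr_ge0]|exact: sqr_ge0].
  by rewrite -[leRHS](ger0_norm nn) -sqrtr_sqr ler_wsqrtr.
have Kbig : 9 * K ^+ 4 <= K' + 9 * K ^+ 4 by clear -K'0; lra.
have Kb0 : 0 < K' + 9 * K ^+ 4 by have := Kp 0%N 4%N isT; rewrite expr0; clear -K'0; lra.
have inv_le (x y : R) : 0 < x -> x <= K' + 9 * K ^+ 4 -> 0 <= y ->
    (K' + 9 * K ^+ 4)^-1 * y <= x^-1 * y.
  by move=> x0 hx y0; rewrite ler_wpM2r // lef_pV2 ?posrE.
split=> //.
- apply/andP; split.
    by apply: le_trans (inv_le K (h ^+ 2) K0 _ (ltW h2)) Jb; clear -K'0 K4 K40; lra.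
  by apply: le_trans Jle _; rewrite ler_wpM2r ?(ltW h2) //; clear -K'0 K24 K40; lra.
- move=> g1 g2 /=; set u := gradv _ _ _ _; have uE := gradv_sq g1 g2 gb0; rewrite -/u -JJ in uE.
  set q := _ + _ in uE; set gg := g1 ^+ 2 + g2 ^+ 2.
  have gg0 : 0 <= gg by rewrite addr_ge0 ?sqr_ge0.
  have uJ : dot u u * J = q / J by rewrite -uE expr2 mulrA mulfK // gt_eqF.
  have qle : q <= 6 * K ^+ 2 * h ^+ 2 * gg.
    have g12 : `|2 * g1 * g2| <= gg.
      by rewrite ler_norml /gg; have := sqr_ge0 (g1 - g2); have := sqr_ge0 (g1 + g2);
        move=> s1 s2; clear -s1 s2; apply/andP; split; lra.
    have m1 : dot b2 b2 * g1 ^+ 2 <= 3 * K ^+ 2 * h ^+ 2 * g1 ^+ 2.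
      by rewrite ler_wpM2r ?sqr_ge0 // (le_trans (ler_norm _)).
    have m2 : dot b1 b1 * g2 ^+ 2 <= 3 * K ^+ 2 * h ^+ 2 * g2 ^+ 2.
      by rewrite ler_wpM2r ?sqr_ge0 // (le_trans (ler_norm _)).
    have m3 : `|dot b1 b2 * (2 * g1 * g2)| <= 3 * K ^+ 2 * h ^+ 2 * gg.
      by rewrite normrM ler_pM.
    have := ler_norm (- (dot b1 b2 * (2 * g1 * g2))); rewrite normrN.
    rewrite /q /gg in m1 m2 m3 *; clear -m1 m2 m3; lra.
  have qge : K^-1 * h ^+ 2 * gg <= q by exact: fb.
  rewrite uJ; apply/andP; split.
    rewrite ler_pdivlMr //; apply: le_trans qge.
    have c1 : (K' + 9 * K ^+ 4)^-1 * gg * J <= (K' + 9 * K ^+ 4)^-1 * gg * (3 * K ^+ 2 * h ^+ 2).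
      by rewrite ler_wpM2l // mulr_ge0 // invr_ge0 ltW.
    apply: le_trans c1 _.
    have c2 : (K' + 9 * K ^+ 4)^-1 * (3 * K ^+ 2) <= K^-1.
      by rewrite mulrC ler_pdivrMr // [leRHS]mulrC ler_pdivlMr //; clear -Ka K'0 K40; lra.
    have : (K' + 9 * K ^+ 4)^-1 * (3 * K ^+ 2) * (h ^+ 2 * gg) <= K^-1 * (h ^+ 2 * gg).
      by rewrite ler_wpM2r // mulr_ge0 // ltW.
    by clear -K0; lra.
  rewrite ler_pdivrMr //; apply: le_trans qle _.
  have c1 : (K' + 9 * K ^+ 4) * gg * (K^-1 * h ^+ 2) <= (K' + 9 * K ^+ 4) * gg * J.
    by rewrite ler_wpM2l // mulr_ge0 // ltW.
  apply: le_trans c1.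
  have c2 : 6 * K ^+ 2 <= (K' + 9 * K ^+ 4) * K^-1.
    by rewrite ler_pdivlMr //; clear -Ka K'0 K40; lra.
  have : 6 * K ^+ 2 * (h ^+ 2 * gg) <= (K' + 9 * K ^+ 4) * K^-1 * (h ^+ 2 * gg).
    by rewrite ler_wpM2r // mulr_ge0 // ltW.
  by clear -K0; lra.
move=> v g1 g2; rewrite !gradv_density //.
set a1 := edge1 T in da db ma1 ma2 fa na1 na2 ga0 Ja *.
set a2 := edge2 T in da db ma1 ma2 fa na1 na2 ga0 Ja *.
set n0 := vnormal Gamma T in da db ma1 ma2 mb1 mb2 *.
set Sa := Num.sqrt (gram a1 a2) in Ja *.
have Sa0 : 0 < Sa by rewrite sqrtr_gt0.
have SSa : Sa ^+ 2 = gram a1 a2 by rewrite sqr_sqrtr // ltW.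
pose i2 := (h ^+ 2)^-1; pose i1 := h^-1.
have hne : h != 0 by rewrite gt_eqF.
have i20 : 0 <= i2 by rewrite invr_ge0 ltW.
have i10 : 0 <= i1 by rewrite invr_ge0.
have sc2 (x B : R) : `|x| <= B * h ^+ 2 -> `|i2 * x| <= B.
  by move=> hx; rewrite normrM (ger0_norm i20) mulrC ler_pdivrMr.
have sc1 (x B : R) : `|x| <= B * h -> `|i1 * x| <= B.
  by move=> hx; rewrite normrM (ger0_norm i10) mulrC ler_pdivrMr.
have relax (x B B' : R) : `|x| <= B -> B <= B' -> `|x| <= B' by exact: le_trans.
(* For a tangent vector [u] the product u.n0 is itself O(h^2), so the change of a Gram entry is
   O(h^4). *)
have e1 (u w c : pt) : `|u| <= K * h -> `|dot n0 u| <= K * h ^+ 2 ->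
    (`|dot u w - dot u c| <= K * h * (h * `|dot u n0| + h ^+ 2 * `|u|)) ->
    `|dot u w - dot u c| <= 2 * K ^+ 2 * h ^+ 2 * h ^+ 2.
  move=> hu hn; move=> /le_trans; apply; rewrite dotC.
  have p1 : h * `|dot n0 u| + h ^+ 2 * `|u| <= h * (K * h ^+ 2) + h ^+ 2 * (K * h).
    by apply: lerD; rewrite ler_wpM2l // ltW.
  have : K * h * (h * `|dot n0 u| + h ^+ 2 * `|u|) <=
      K * h * (h * (K * h ^+ 2) + h ^+ 2 * (K * h)).
    by rewrite ler_wpM2l // mulr_ge0 // ltW.
  clear -K0; lra.
have e2 (b b' a a' : pt) : `|dot b b' - dot b a'| <= 2 * K ^+ 2 * h ^+ 2 * h ^+ 2 ->
    `|dot a' b - dot a' a| <= 2 * K ^+ 2 * h ^+ 2 * h ^+ 2 ->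
    `|i2 * dot b b' - i2 * dot a a'| <= 6 * K ^+ 2 * h ^+ 2.
  move=> p q; rewrite -mulrBr; apply: sc2.
  have -> : dot b b' - dot a a' = (dot b b' - dot b a') + (dot a' b - dot a' a).
    by rewrite (dotC a' b) (dotC a' a); ring.
  apply: le_trans (ler_normD _ _) _.
  have : 0 <= K ^+ 2 * h ^+ 2 * h ^+ 2 by apply: mulr_ge0; [apply: mulr_ge0|]; exact: sqr_ge0.
  by clear -p q; lra.
have K20 : 0 <= K ^+ 2 by exact: sqr_ge0.
have le63 : 3 * K ^+ 2 <= 6 * K ^+ 2 by clear -K20; lra.
have sq3 : `|i2 * dot a1 a1| <= 6 * K ^+ 2 /\ `|i2 * dot a1 a2| <= 6 * K ^+ 2 /\
    `|i2 * dot a2 a2| <= 6 * K ^+ 2.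
  by do !split; apply: relax le63; apply: sc2; exact: dotb.
have sq3b : `|i2 * dot b1 b1| <= 6 * K ^+ 2 /\ `|i2 * dot b1 b2| <= 6 * K ^+ 2 /\
    `|i2 * dot b2 b2| <= 6 * K ^+ 2.
  by do !split; apply: relax le63; apply: sc2.
have lin (c : pt) : `|c| <= K * h -> `|i1 * dot v c| <= 6 * K ^+ 2 * `|v|.
  move=> hc; apply: sc1; apply: le_trans (normr_dot_le _ _) _.
  have : `|v| * `|c| <= `|v| * (K * h) by rewrite ler_wpM2l.
  have : K * (`|v| * h) <= K ^+ 2 * (`|v| * h) by rewrite ler_wpM2r // mulr_ge0.
  have : 0 <= K ^+ 2 * (`|v| * h) by apply: mulr_ge0; [exact: sqr_ge0|exact: mulr_ge0].
  by clear -K0; lra.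
pose del := h * `|dot v n0| + h ^+ 2 * `|v|.
have del0 : 0 <= del by rewrite addr_ge0 // mulr_ge0 // ltW.
have dl (b a : pt) : `|dot v b - dot v a| <= K * h * del ->
    `|i1 * dot v b - i1 * dot v a| <= 6 * K ^+ 2 * del.
  move=> p; rewrite -mulrBr; apply: sc1; apply: le_trans p _.
  rewrite -mulrA [h * del]mulrC mulrA ler_wpM2r // ler_wpM2r //; clear -k1 K20; lra.
have [db1 db2] := db v.
have eV : h ^+ 2 * `|v| <= del by rewrite /del lerDr mulr_ge0.
have Sb : K^-1 <= i2 * J by rewrite mulrC ler_pdivlMr.
have Sa' : K^-1 <= i2 * Sa by rewrite mulrC ler_pdivlMr.
have SE : (i2 * J) ^+ 2 = i2 * dot b1 b1 * (i2 * dot b2 b2) - (i2 * dot b1 b2) ^+ 2.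
  by rewrite exprMn JJ /gram; ring.
have SE' : (i2 * Sa) ^+ 2 = i2 * dot a1 a1 * (i2 * dot a2 a2) - (i2 * dot a1 a2) ^+ 2.
  by rewrite exprMn SSa /gram; ring.
have [x1 x2] := da b1; have [x3 x4] := da b2.
have := hQ _ _ _ _ _ _ _ _ _ _ g1 g2 _ _ `|v| (`|g1| + `|g2|) (h ^+ 2) del
  sq3.1 sq3.2.1 sq3.2.2 sq3b.1 sq3b.2.1 sq3b.2.2
  (e2 b1 b1 a1 a1 (e1 _ _ _ nb1 mb1 (db b1).1) (e1 _ _ _ na1 ma1 (db a1).1))
  (e2 b1 b2 a1 a2 (e1 _ _ _ nb1 mb1 (db b1).2) (e1 _ _ _ na2 ma2 (db a2).1))
  (e2 b2 b2 a2 a2 (e1 _ _ _ nb2 mb2 (db b2).2) (e1 _ _ _ na2 ma2 (db a2).2))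
  (lin a1 na1) (lin a2 na2) (lin b1 nb1) (lin b2 nb2) (dl b1 a1 db1) (dl b2 a2 db2) eV
  _ _ Sb Sa' SE SE'.
have g1le : `|g1| <= `|g1| + `|g2| by rewrite lerDl.
have g2le : `|g2| <= `|g1| + `|g2| by rewrite lerDr.
move=> /(_ g1le g2le) key.
have scale (b11 b12 b22 y1 y2 S : R) : 0 < S ->
  ((b22 * g1 - b12 * g2) * y1 + (b11 * g2 - b12 * g1) * y2) / S =
  h * (((i2 * b22 * g1 - i2 * b12 * g2) * (i1 * y1) +
    (i2 * b11 * g2 - i2 * b12 * g1) * (i1 * y2)) / (i2 * S)).
  move=> S0; rewrite /i2 /i1; field.
  by rewrite hne gt_eqF.
rewrite (scale _ _ _ _ _ J J0) (scale _ _ _ _ _ Sa Sa0) -mulrBr normrM (ger0_norm hh).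
apply: (@le_trans _ _ (h * (K' * del * (`|g1| + `|g2|)))); first by rewrite ler_wpM2l.
have -> : h * (K' * del * (`|g1| + `|g2|)) =
    K' * (h ^+ 2 * (`|dot v n0| + h * `|v|) * (`|g1| + `|g2|)).
  by rewrite /del; ring.
rewrite -!mulrA; apply: ler_wpM2r; last by rewrite lerDl mulr_ge0.
by rewrite !mulr_ge0 ?addr_ge0 ?mulr_ge0.
Qed.

End MetricConsequences.

(** * Sums over the faces *)

Section FaceSums.
Context {R : realType}.
Local Notation pt := 'rV[R]_3.
Local Notation triangle := 'M[R]_3.
Implicit Types (Ts : seq triangle) (F G : triangle -> R * R -> R).

Definition sint Ts F : R := \sum_(T <- Ts) rint (F T).

Lemma sint_le Ts F G : (forall T, T \in Ts -> regular (F T)) ->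
  (forall T, T \in Ts -> regular (G T)) ->
  (forall T s, T \in Ts -> ref_tri s -> F T s <= G T s) -> sint Ts F <= sint Ts G.
Proof.
move=> rF rG FG; rewrite /sint !big_seq; apply: ler_sum => T TTs.
by apply: rint_le; [exact: rF|exact: rG|move=> s; exact: FG].
Qed.

Lemma sint_eq Ts F G : (forall T s, T \in Ts -> ref_tri s -> F T s = G T s) ->
  sint Ts F = sint Ts G.
Proof.
by move=> FG; rewrite /sint !big_seq; apply: eq_bigr => T TTs; apply: rint_eq => s; exact: FG.
Qed.

Lemma sintD Ts F G : (forall T, T \in Ts -> regular (F T)) ->
  (forall T, T \in Ts -> regular (G T)) ->
  sint Ts (fun T s => F T s + G T s) = sint Ts F + sint Ts G.
Proof.
move=> rF rG; rewrite /sint !big_seq -big_split /=; apply: eq_bigr => T TTs.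
by rewrite rintD; [|exact: rF|exact: rG].
Qed.

Lemma sintZ Ts c F : (forall T, T \in Ts -> regular (F T)) ->
  sint Ts (fun T s => c * F T s) = c * sint Ts F.
Proof.
move=> rF; rewrite /sint !big_seq mulr_sumr; apply: eq_bigr => T TTs.
by rewrite rintZ; [|exact: rF].
Qed.

Lemma sintB Ts F G : (forall T, T \in Ts -> regular (F T)) ->
  (forall T, T \in Ts -> regular (G T)) ->
  sint Ts (fun T s => F T s - G T s) = sint Ts F - sint Ts G.
Proof.
move=> rF rG; rewrite -mulN1r -sintZ // -sintD //; last by move=> T /rG; exact: regularZ.
by apply: sint_eq => T s _ _; rewrite mulN1r.
Qed.

Lemma sint_ge0 Ts F : (forall T s, T \in Ts -> ref_tri s -> 0 <= F T s) -> 0 <= sint Ts F.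
Proof.
move=> F0; rewrite /sint big_seq; apply: sumr_ge0 => T TTs.
by apply: rint_ge0 => s; exact: F0.
Qed.

Lemma sint_norm_le Ts F : (forall T, T \in Ts -> regular (F T)) ->
  `|sint Ts F| <= sint Ts (fun T s => `|F T s|).
Proof.
move=> rF; rewrite /sint !big_seq; apply: le_trans (ler_norm_sum _ _ _) _.
by apply: ler_sum => T TTs; apply: rint_norm_le; exact: rF.
Qed.

(** Recovers the Cauchy-Schwarz form from Young's inequality with a parameter, so that only
    linearity and monotonicity of the integrals are used. The choice t = D / (2 A X) maximizes D t -
    A X t^2; for A X = 0 a large t contradicts D > 0. *)
Lemma young_optimal (D A X Y : R) : 0 <= A -> 0 <= X -> 0 <= Y -> 0 <= D ->
  (forall t : R, 0 < t -> D <= A * (t * X + Y / t)) -> D ^+ 2 <= 4 * A ^+ 2 * X * Y.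
Proof.
move=> A0 X0 Y0 D0 h.
have [->|Dn] := eqVneq D 0; first by rewrite expr0n /= !mulr_ge0 ?sqr_ge0.
have Dp : 0 < D by rewrite lt_neqAle eq_sym Dn.
have AX0 : 0 <= A * X by exact: mulr_ge0.
have AY0 : 0 <= A * Y by exact: mulr_ge0.
have ht (t : R) : 0 < t -> D * t <= A * X * t ^+ 2 + A * Y.
  move=> t0; have := h t t0; rewrite -(ler_pM2r t0) => /le_trans; apply.
  by rewrite le_eqVlt; apply/orP; left; apply/eqP; field; rewrite gt_eqF.
have [AX|AXn] := eqVneq (A * X) 0.
  have t0 : 0 < (A * Y + 1) / D by rewrite divr_gt0 //; lra.
  have := ht _ t0; rewrite AX mul0r add0r mulrCA divff // mulr1; lra.
have AXp : 0 < A * X by rewrite lt_neqAle eq_sym AXn.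
have t0 : 0 < D / (2 * (A * X)) by rewrite divr_gt0 // mulr_gt0.
have := ht _ t0; set t := D / _ => hh.
have tE : A * X * t = D / 2.
  by rewrite /t; move: AXn; set a := A * X => an; field.
have h3 : D * (A * X * t) <= A * X * t * (A * X * t) + A * X * (A * Y).
  have : A * X * (D * t) <= A * X * (A * X * t ^+ 2 + A * Y) by rewrite ler_wpM2l.
  by rewrite expr2; lra.
by rewrite tE in h3; rewrite !expr2; lra.
Qed.

End FaceSums.

(** * Norms and forms on the reference triangle, common to all degrees *)

Section DiscreteData.
Context {R : realType}.
Local Notation pt := 'rV[R]_3.
Local Notation triangle := 'M[R]_3.
Variable N : nat.
Local Notation coefs := 'rV[R]_(N.+1 * N.+1).
Implicit Types (Q : triangle -> coefs) (W : 'I_3 -> triangle -> coefs).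

Definition wvec W T s : pt := \row_i pev (W i T) s.

Definition S0 Ts Q : R := sint Ts (fun T s => pev (Q T) s ^+ 2).
Definition S1 Ts Q : R := sint Ts (fun T s => pev1 (Q T) s ^+ 2 + pev2 (Q T) s ^+ 2).
Definition Sn Gamma Ts W : R := sint Ts (fun T s => dot (vnormal Gamma T) (wvec W T s) ^+ 2).

(* Up to constants this is the square of [triple_norm], for every degree of the
   surface approximation. *)
Definition tnorm2 Gamma Ts (h : R) W : R :=
  \sum_i (h ^+ 2 * S0 Ts (W i) + S1 Ts (W i)) + Sn Gamma Ts W.

(** The integrand of [b_form] on the flat face. It does not contain the degree and is the
    intermediate term between the forms of two degrees. *)
Definition flat_density W Q T s : R :=
  dot (wvec W T s) (gradv (edge1 T) (edge2 T) (pev1 (Q T) s) (pev2 (Q T) s)) *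
  Num.sqrt (gram (edge1 T) (edge2 T)).

Lemma dot_regular (u v : R * R -> pt) : (forall i, regular (fun s => u s 0 i)) ->
  (forall i, regular (fun s => v s 0 i)) -> regular (fun s => dot (u s) (v s)).
Proof. by move=> ru rv; apply: regular_sum => i _; exact: regularM. Qed.

Lemma wvec_regular W T i : regular (fun s => wvec W T s 0 i).
Proof.
rewrite (_ : (fun s => _) = pev (W i T)); first exact: pev_regular.
by apply/funext => s; rewrite mxE.
Qed.

Lemma dot_cst_wvec_regular (v : pt) W T : regular (fun s => dot v (wvec W T s)).
Proof. by apply: dot_regular => i; [exact: regular_cst|exact: wvec_regular]. Qed.

Lemma S0_ge0 Ts Q : 0 <= S0 Ts Q.
Proof. by apply: sint_ge0 => T s _ _; exact: sqr_ge0. Qed.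

Lemma S1_ge0 Ts Q : 0 <= S1 Ts Q.
Proof. by apply: sint_ge0 => T s _ _; rewrite addr_ge0 ?sqr_ge0. Qed.

Lemma Sn_ge0 Gamma Ts W : 0 <= Sn Gamma Ts W.
Proof. by apply: sint_ge0 => T s _ _; exact: sqr_ge0. Qed.

Lemma tnorm2_ge Gamma Ts (h : R) W :
  h ^+ 2 * \sum_i S0 Ts (W i) + Sn Gamma Ts W <= tnorm2 Gamma Ts h W.
Proof.
rewrite /tnorm2 lerD2r big_split /= -mulr_sumr lerDl.
by apply: sumr_ge0 => i _; exact: S1_ge0.
Qed.

Lemma tnorm2_ge0 Gamma Ts (h : R) W : 0 <= tnorm2 Gamma Ts h W.
Proof.
apply: le_trans (tnorm2_ge _ _ _ _); rewrite addr_ge0 ?Sn_ge0 //.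
by rewrite mulr_ge0 ?sqr_ge0 //; apply: sumr_ge0 => i _; exact: S0_ge0.
Qed.

Lemma sum_S0 Ts W : \sum_i S0 Ts (W i) = sint Ts (fun T s => dot (wvec W T s) (wvec W T s)).
Proof.
have sE i : S0 Ts (W i) = sint Ts (fun T s => wvec W T s 0 i * wvec W T s 0 i).
  by apply: sint_eq => T s _ _; rewrite mxE expr2.
under eq_bigr do rewrite sE.
have rg i T : T \in Ts -> regular (fun s => wvec W T s 0 i * wvec W T s 0 i).
  by move=> _; apply: regularM; exact: wvec_regular.
rewrite sum3E -!sintD; try by move=> T TTs; rewrite ?(rg _ T TTs) //; try exact: rg;
  apply: regularD; exact: rg.
by apply: sint_eq => T s _ _; rewrite dotE.
Qed.

(** The inverse inequality summed over the faces; both sides are integrals over the reference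
    triangle, so no power of h appears. *)
Lemma S1_le_S0 : exists2 K : R, 0 < K & forall Ts Q, S1 Ts Q <= K * S0 Ts Q.
Proof.
have [K K0 hK] := @pev_inverse_inequality R N.
exists K => // Ts Q; rewrite /S1 /S0 /sint mulr_sumr; apply: ler_sum => T _.
have I0 : 0 <= K * rint (fun s => pev (Q T) s ^+ 2).
  by rewrite mulr_ge0 ?(ltW K0) //; apply: rint_ge0 => s _; exact: sqr_ge0.
apply: le_trans (rint_cst_le I0); apply: rint_le.
- by apply: regularD; apply: regularX; [exact: pev1_regular|exact: pev2_regular].
- exact: regular_cst.
- by move=> s rs; exact: hK.
Qed.

Lemma wvec_norm_le W T s : `|wvec W T s| ^+ 2 <= dot (wvec W T s) (wvec W T s).
Proof. exact: normv_sq_le_dot. Qed.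

(** Young's inequality is applied pointwise with one weight [t] for all faces, and [t] is optimized
    only after integration and summation. *)
Lemma perturbation_sum (Gamma : set pt) Ts (h A : R) W Q (D : triangle -> R * R -> R) :
  0 <= A -> 0 <= h -> (forall T, T \in Ts -> regular (D T)) ->
  (forall T s, T \in Ts -> ref_tri s -> `|D T s| <=
     A * (`|dot (wvec W T s) (vnormal Gamma T)| + h * `|wvec W T s|) *
     (`|pev1 (Q T) s| + `|pev2 (Q T) s|)) ->
  `|sint Ts D| ^+ 2 <= 4 * A ^+ 2 * tnorm2 Gamma Ts h W * S1 Ts Q.
Proof.
move=> A0 h0 rD hD.
apply: young_optimal; rewrite ?tnorm2_ge0 ?S1_ge0 ?normr_ge0 // => t t0.
apply: le_trans (sint_norm_le rD) _.
pose B1 T s := dot (vnormal Gamma T) (wvec W T s) ^+ 2.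
pose B2 T s := dot (wvec W T s) (wvec W T s).
pose B3 T s := pev1 (Q T) s ^+ 2 + pev2 (Q T) s ^+ 2.
have r1 T : T \in Ts -> regular (B1 T).
  by move=> _; apply: regularX; exact: dot_cst_wvec_regular.
have r2 T : T \in Ts -> regular (B2 T).
  by move=> _; apply: dot_regular => i; exact: wvec_regular.
have r3 T : T \in Ts -> regular (B3 T).
  by move=> _; apply: regularD; apply: regularX; [exact: pev1_regular|exact: pev2_regular].
have z T c (B : triangle -> R * R -> R) : (forall T, T \in Ts -> regular (B T)) ->
    T \in Ts -> regular (fun s => c * B T s).
  by move=> rB TTs; apply: regularZ; exact: rB.
apply: (@le_trans _ _ (sint Ts (fun T s =>
    (A * t) * B1 T s + ((A * t * h ^+ 2) * B2 T s + (A / t) * B3 T s)))).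
  apply: sint_le => [T TTs|T TTs|T s TTs rs].
  - exact/regular_norm/rD.
  - by apply: regularD; [exact: z|apply: regularD; exact: z].
  apply: le_trans (hD T s TTs rs) _; rewrite dotC -mulrA.
  have -> : A * t * B1 T s + (A * t * h ^+ 2 * B2 T s + A / t * B3 T s) =
    A * (t * (B1 T s + h ^+ 2 * B2 T s) + B3 T s / t) by field; rewrite gt_eqF.
  rewrite ler_wpM2l //.
  have w2 : h ^+ 2 * `|wvec W T s| ^+ 2 <= h ^+ 2 * B2 T s.
    by rewrite ler_wpM2l ?sqr_ge0 //; exact: wvec_norm_le.
  have b1 : B1 T s = `|dot (vnormal Gamma T) (wvec W T s)| ^+ 2.
    by rewrite real_normK ?num_real.
  have b3 : B3 T s = `|pev1 (Q T) s| ^+ 2 + `|pev2 (Q T) s| ^+ 2.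
    by rewrite !real_normK ?num_real.
  rewrite b1 b3; move: w2; set x := `|dot _ _|; set y := `|wvec _ _ _|.
  set p := `|pev1 _ _|; set q := `|pev2 _ _| => w2.
  apply: (@le_trans _ _ (t * (x ^+ 2 + h ^+ 2 * y ^+ 2) + (p ^+ 2 + q ^+ 2) / t)); last first.
    by rewrite lerD2r ler_wpM2l ?(ltW t0) // lerD2l.
  rewrite -subr_ge0 [leRHS](_ : _ =
      ((t * (x + h * y) - (p + q)) ^+ 2 + (t * (x - h * y)) ^+ 2 + (p - q) ^+ 2) / (2 * t)).
    by rewrite divr_ge0 ?addr_ge0 ?sqr_ge0 // mulr_ge0 // ltW.
  by field; rewrite gt_eqF.
rewrite sintD; [|by move=> T TTs; exact: z|by move=> T TTs; apply: regularD; exact: z].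
rewrite sintD; [|by move=> T TTs; exact: z|by move=> T TTs; exact: z].
rewrite !sintZ // -/(S1 Ts Q) -/(Sn Gamma Ts W) -sum_S0.
have := tnorm2_ge Gamma Ts h W; move=> hX.
have : (A * t) * (h ^+ 2 * \sum_i S0 Ts (W i) + Sn Gamma Ts W) <= (A * t) * tnorm2 Gamma Ts h W.
  by rewrite ler_wpM2l // mulr_ge0 // ltW.
move=> hX'; rewrite mulrDr; set x := _ * _ * tnorm2 _ _ _ _ in hX'.
rewrite (_ : A * (t * tnorm2 Gamma Ts h W) = x); last by rewrite /x mulrA.
rewrite (_ : A * (S1 Ts Q / t) = A / t * S1 Ts Q); last by ring.
rewrite addrA lerD2r; apply: le_trans hX'.
by rewrite le_eqVlt; apply/orP; left; apply/eqP; ring.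
Qed.

End DiscreteData.

(** * The bilinear form and the norms *)

Lemma sq_perturb (R : realFieldType) (a b c : R) : (a - b) ^+ 2 <= c ->
  a ^+ 2 <= 2 * b ^+ 2 + 2 * c /\ b ^+ 2 <= 2 * a ^+ 2 + 2 * c.
Proof.
have s1 := sqr_ge0 (a - 2 * b); have s2 := sqr_ge0 (b - 2 * a).
by split; lra.
Qed.

(** [d] and [e] stand for the H^1 parts on the reference triangle and on the surface, [n] and [z]
    for the corresponding normal parts. The weighted L2 part [x], contained in [d], pays for
    exchanging the two normals. *)
Lemma norm_equiv_combine (R : realFieldType) (d e n x z k c : R) :
  z <= c * (2 * n + 18 * k * x) -> n <= 2 * c * z + 18 * k * x -> x <= d ->
  e <= c * d -> d <= c * e -> 0 <= z -> 0 <= n -> 0 <= d -> 1 <= k -> 1 <= c ->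
  d + n <= 20 * k * c * (e + z) /\ e + z <= 20 * k * c * (d + n).
Proof.
move=> n1 n2 xd ed de z0 n0 d0 k1 c1.
have c0 : 0 <= c by lra.
have k0 : 0 <= k by lra.
have e0 : 0 <= c * e by lra.
have cz0 : 0 <= c * z by exact: mulr_ge0.
have p1 : k * x <= k * d by rewrite ler_wpM2l.
have p2 : 1 * d <= k * d by rewrite ler_wpM2r.
have p3 : 1 * n <= k * n by rewrite ler_wpM2r.
split.
  have p4 : k * d <= k * (c * e) by rewrite ler_wpM2l.
  have p5 : 1 * (c * z) <= k * (c * z) by rewrite ler_wpM2r.
  have p6 : 1 * (c * e) <= k * (c * e) by rewrite ler_wpM2r.
  by clear -n2 p1 p2 p3 p4 p5 p6 de cz0 e0; lra.
have q1 : c * (k * x) <= c * (k * d) by rewrite ler_wpM2l.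
have q2 : c * d <= c * (k * d) by rewrite ler_wpM2l //; rewrite mul1r in p2.
have q3 : c * n <= c * (k * n) by rewrite ler_wpM2l //; rewrite mul1r in p3.
have q4 : 0 <= c * (k * n) by rewrite !mulr_ge0.
have q5 : 0 <= c * (k * d) by rewrite !mulr_ge0.
by clear -n1 ed q1 q2 q3 q4 q5; lra.
Qed.

Section SurfaceForms.
Context {R : realType}.
Local Notation pt := 'rV[R]_3.
Local Notation triangle := 'M[R]_3.

Lemma gradv_regular (b1 b2 : R * R -> pt) (g1 g2 : R * R -> R) (c : R) : 0 < c ->
  (forall s, ref_tri s -> c <= gram (b1 s) (b2 s)) ->
  (forall i, regular (fun s => b1 s 0 i)) -> (forall i, regular (fun s => b2 s 0 i)) ->
  regular g1 -> regular g2 ->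
  forall i, regular (fun s => gradv (b1 s) (b2 s) (g1 s) (g2 s) 0 i).
Proof.
move=> c0 hc r1 r2 rg1 rg2 i.
have d11 := dot_regular r1 r1; have d12 := dot_regular r1 r2; have d22 := dot_regular r2 r2.
have rg : regular (fun s => gram (b1 s) (b2 s)).
  by apply: regularB; [exact: regularM|exact: regularX].
rewrite (_ : (fun s => _) = (fun s => (gram (b1 s) (b2 s))^-1 *
  ((dot (b2 s) (b2 s) * g1 s - dot (b1 s) (b2 s) * g2 s) * b1 s 0 i +
   (dot (b1 s) (b1 s) * g2 s - dot (b1 s) (b2 s) * g1 s) * b2 s 0 i))); last first.
  by apply/funext => s; rewrite /gradv !mxE.
apply: regularM; first exact: (regularV c0).
apply: regularD; apply: regularM => //; apply: regularB; exact: regularM.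
Qed.

Variables (Gamma : set pt) (delta : R) (k : nat) (Ts : seq triangle) (h K K1 : R).
Hypotheses (tubeG : tubular Gamma delta) (polyG : polyhedral Gamma Ts)
  (admG : admissible Gamma delta k Ts).
Hypotheses (h0 : 0 < h) (h1 : h <= 1) (K_ge1 : 1 <= K) (K1_ge1 : 1 <= K1).
Hypothesis faces : forall T, T \in Ts ->
  [/\ `|vnormal Gamma T| <= K, metric_est Gamma K h T (edge1 T) (edge2 T) &
      forall s, cref_tri s -> param_metric_at Gamma delta K h k T s].
Hypothesis consequences : forall T b1 b2,
  metric_est Gamma K h T (edge1 T) (edge2 T) -> metric_est Gamma K h T b1 b2 ->
  metric_bounds Gamma K1 h T b1 b2.

Variable N : nat.
Local Notation coefs := 'rV[R]_(N.+1 * N.+1).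

Local Notation par := (param Gamma k).
Local Notation b1 := (dparam1 Gamma k).
Local Notation b2 := (dparam2 Gamma k).

Definition jac T s : R := Num.sqrt (gram (b1 T s) (b2 T s)).

(** The closed triangle is used, so that the values on the edges are determined as well;
    [represents_within] derives continuity from this. *)
Definition represents (q : pt -> R) (Q : triangle -> coefs) : Prop :=
  forall T s, T \in Ts -> cref_tri s -> q (par T s) = pev (Q T) s.

Local Opaque param dparam1 dparam2 dclosest normal sdist surf_k closest_pt polysurf proj_k
  ref_map edge1 edge2 surf_grad.

Lemma face_consequences T s : T \in Ts -> cref_tri s ->
  metric_bounds Gamma K1 h T (b1 T s) (b2 T s).
Proof.
move=> TTs rs; have [_ me /(_ s rs)[mb _ _ _]] := faces TTs.
exact: (consequences me mb).
Qed.

Lemma enorm_param_cross T s : T \in Ts -> enorm (param_cross Gamma k T s) = jac T s.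
Proof.
move=> TTs; rewrite (param_crossE Gamma k s (face_nondegenerate polyG TTs)).
by rewrite /enorm dot_cross.
Qed.

Lemma surf_intE (f : pt -> R) (F : triangle -> R * R -> R) :
  (forall T s, T \in Ts -> ref_tri s -> f (par T s) = F T s) ->
  surf_int Gamma k Ts f = sint Ts (fun T s => F T s * jac T s).
Proof.
move=> fF; rewrite -[LHS]/(sint Ts (fun T s => f (par T s) * enorm (param_cross Gamma k T s))).
by apply: sint_eq => T s TTs rs; rewrite enorm_param_cross // fF.
Qed.

Lemma dparam1_regular T i : regular (fun s => b1 T s 0 i).
Proof.
rewrite (_ : (fun s => _) = pev1 (param_coef Gamma k T i)); first exact: pev1_regular.
by apply/funext => s; rewrite mxE.
Qed.

Lemma dparam2_regular T i : regular (fun s => b2 T s 0 i).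
Proof.
rewrite (_ : (fun s => _) = pev2 (param_coef Gamma k T i)); first exact: pev2_regular.
by apply/funext => s; rewrite mxE.
Qed.

Lemma jac_regular T : regular (jac T).
Proof.
have r1 := @dparam1_regular T; have r2 := @dparam2_regular T.
apply: regular_sqrt; apply: regularB.
  by apply: regularM; exact: dot_regular.
by apply: regularX; exact: dot_regular.
Qed.

Lemma surf_gradv_regular T (Q : triangle -> coefs) i : T \in Ts ->
  regular (fun s => gradv (b1 T s) (b2 T s) (pev1 (Q T) s) (pev2 (Q T) s) 0 i).
Proof.
move=> TTs; have K0 : 0 < K by apply: lt_le_trans K_ge1.
have c0 : 0 < (K^-1 * h ^+ 2) ^+ 2 by rewrite exprn_gt0 // mulr_gt0 ?invr_gt0 ?exprn_gt0.
apply: (gradv_regular c0); [|exact: dparam1_regular|exact: dparam2_regular|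
  exact: pev1_regular|exact: pev2_regular].
move=> s rs; have [_ _ /(_ s (sub_ref_tri rs))[mb _ _ _]] := faces TTs.
exact: metric_gram K0 h0 mb.
Qed.

Lemma flat_density_regular (W : 'I_3 -> triangle -> coefs) Q T : T \in Ts ->
  regular (flat_density W Q T).
Proof.
move=> TTs; have K0 : 0 < K by apply: lt_le_trans K_ge1.
have c0 : 0 < (K^-1 * h ^+ 2) ^+ 2 by rewrite exprn_gt0 // mulr_gt0 ?invr_gt0 ?exprn_gt0.
have [_ me _] := faces TTs.
apply: regularM; last exact: regular_cst.
apply: dot_regular; first exact: wvec_regular.
apply: (gradv_regular (b1 := fun=> edge1 T) (b2 := fun=> edge2 T) c0).
- by move=> s _; exact: metric_gram K0 h0 me.
- by move=> i; exact: regular_cst.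
- by move=> i; exact: regular_cst.
- exact: pev1_regular.
- exact: pev2_regular.
Qed.

Lemma surf_grad_represents q Q T s : represents q Q -> T \in Ts -> ref_tri s ->
  surf_grad Gamma k Ts q (par T s) =
  gradv (b1 T s) (b2 T s) (pev1 (Q T) s) (pev2 (Q T) s).
Proof.
move=> rq TTs rs; have crs := sub_ref_tri rs.
have [_ _ /(_ s crs)[_ gq _ _]] := faces TTs.
have [g0 _ _ _] := face_consequences TTs crs.
apply: (surf_grad_param tubeG polyG admG TTs rs _ gq); first by rewrite gt_eqF.
by move=> t rt; exact: rq TTs (sub_ref_tri rt).
Qed.

Lemma jac_weight (F : triangle -> R * R -> R) :
  (forall T, T \in Ts -> regular (F T)) ->
  (forall T s, T \in Ts -> ref_tri s -> 0 <= F T s) ->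
  K1^-1 * h ^+ 2 * sint Ts F <= sint Ts (fun T s => F T s * jac T s) <=
    K1 * h ^+ 2 * sint Ts F.
Proof.
move=> rF F0.
have rFj T : T \in Ts -> regular (fun s => F T s * jac T s).
  by move=> TTs; apply: regularM; [exact: rF|exact: jac_regular].
have rZ c T : T \in Ts -> regular (fun s => c * F T s).
  by move=> TTs; apply: regularZ; exact: rF.
have J T s : T \in Ts -> ref_tri s -> K1^-1 * h ^+ 2 <= jac T s <= K1 * h ^+ 2.
  by move=> TTs rs; have [_] := face_consequences TTs (sub_ref_tri rs).
rewrite -!sintZ //; apply/andP; split.
  apply: sint_le; [exact: rZ|exact: rFj|move=> T s TTs rs].
  by rewrite [leRHS]mulrC ler_wpM2r ?F0 //; case/andP: (J T s TTs rs).
apply: sint_le; [exact: rFj|exact: rZ|move=> T s TTs rs].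
by rewrite [leLHS]mulrC ler_wpM2r ?F0 //; case/andP: (J T s TTs rs).
Qed.

Lemma surf_int_sq_equiv q Q : represents q Q ->
  K1^-1 * h ^+ 2 * S0 Ts Q <= surf_int Gamma k Ts (fun y => q y ^+ 2) <=
    K1 * h ^+ 2 * S0 Ts Q.
Proof.
move=> rq; rewrite (surf_intE (F := fun T s => pev (Q T) s ^+ 2)).
  apply: jac_weight => [T _|T s _ _]; [exact/regularX/pev_regular|exact: sqr_ge0].
by move=> T s TTs rs; rewrite rq //; exact: sub_ref_tri.
Qed.

Lemma surf_int_grad_equiv q Q : represents q Q ->
  K1^-1 * S1 Ts Q <= surf_int Gamma k Ts (fun y => enorm (surf_grad Gamma k Ts q y) ^+ 2) <=
    K1 * S1 Ts Q.
Proof.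
move=> rq.
pose u T s := gradv (b1 T s) (b2 T s) (pev1 (Q T) s) (pev2 (Q T) s).
rewrite (surf_intE (F := fun T s => dot (u T s) (u T s))); last first.
  by move=> T s TTs rs; rewrite (surf_grad_represents rq TTs rs) enorm_sq.
have ru T : T \in Ts -> regular (fun s => dot (u T s) (u T s) * jac T s).
  move=> TTs; apply: regularM; last exact: jac_regular.
  by apply: dot_regular => i; exact: surf_gradv_regular.
have rS T : T \in Ts -> regular (fun s => pev1 (Q T) s ^+ 2 + pev2 (Q T) s ^+ 2).
  by move=> _; apply: regularD; apply: regularX; [exact: pev1_regular|exact: pev2_regular].
have rZ c T : T \in Ts -> regular (fun s => c * (pev1 (Q T) s ^+ 2 + pev2 (Q T) s ^+ 2)).
  by move=> TTs; apply: regularZ; exact: rS.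
have J T s : T \in Ts -> ref_tri s ->
    K1^-1 * (pev1 (Q T) s ^+ 2 + pev2 (Q T) s ^+ 2) <= dot (u T s) (u T s) * jac T s <=
    K1 * (pev1 (Q T) s ^+ 2 + pev2 (Q T) s ^+ 2).
  move=> TTs rs; have [_ _ B _] := face_consequences TTs (sub_ref_tri rs); exact: B.
rewrite /S1 -!sintZ //; apply/andP; split.
  apply: sint_le; [exact: rZ|exact: ru|move=> T s TTs rs].
  by case/andP: (J T s TTs rs).
apply: sint_le; [exact: ru|exact: rZ|move=> T s TTs rs].
by case/andP: (J T s TTs rs).
Qed.

Definition vrepresents (v : pt -> pt) (W : 'I_3 -> triangle -> coefs) : Prop :=
  forall i, represents (fun y => v y 0 i) (W i).

Lemma vrepresentsE v W T s : vrepresents v W -> T \in Ts -> cref_tri s ->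
  v (par T s) = wvec W T s.
Proof. by move=> rv TTs rs; apply/rowP => i; rewrite mxE; exact: rv. Qed.

(** In the charts both terms are integrals of densities in the same reference data, and the last
    clause of [metric_bounds] is exactly the pointwise hypothesis of [perturbation_sum]. *)
Lemma b_form_perturbation v W q Q : vrepresents v W -> represents q Q ->
  (b_form Gamma k Ts v q - sint Ts (flat_density W Q)) ^+ 2 <=
    4 * (K1 * h ^+ 2) ^+ 2 * tnorm2 Gamma Ts h W * S1 Ts Q.
Proof.
move=> rv rq.
pose u T s := gradv (b1 T s) (b2 T s) (pev1 (Q T) s) (pev2 (Q T) s).
have bE : b_form Gamma k Ts v q =
    sint Ts (fun T s => dot (wvec W T s) (u T s) * jac T s).
  apply: surf_intE => T s TTs rs.
  by rewrite (surf_grad_represents rq TTs rs) (vrepresentsE rv TTs (sub_ref_tri rs)).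
have ru T : T \in Ts -> regular (fun s => dot (wvec W T s) (u T s) * jac T s).
  move=> TTs; apply: regularM; last exact: jac_regular.
  by apply: dot_regular => i; [exact: wvec_regular|exact: surf_gradv_regular].
have rf T : T \in Ts -> regular (flat_density W Q T) by exact: flat_density_regular.
rewrite bE -sintB // -real_normK ?num_real //.
apply: perturbation_sum => [||T TTs|T s TTs rs].
- by rewrite mulr_ge0 ?sqr_ge0 // (le_trans ler01).
- exact: ltW.
- by apply: regularB; [exact: ru|exact: rf].
have [_ _ _ hd] := face_consequences TTs (sub_ref_tri rs).
exact: hd.
Qed.

Lemma normal_param_regular T i : T \in Ts ->
  regular (fun s => normal Gamma (par T s) 0 i).
Proof.
move=> TTs; split.
  move=> s rs; have Uy := param_tube polyG admG TTs (sub_ref_tri rs).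
  apply: (@continuous_comp _ _ _ (par T) (fun z : pt => normal Gamma z 0 i)).
    exact/continuous_param/(face_nondegenerate polyG).
  exact: (continuous_normal tubeG).
exists (K + K) => s rs.
have [nK _ /(_ s (sub_ref_tri rs))[_ _ _ ny]] := faces TTs.
apply: le_trans (normv_coord _ _) _.
have := ler_normD (normal Gamma (par T s) - vnormal Gamma T) (vnormal Gamma T).
rewrite subrK => /le_trans; apply; apply: lerD => //.
apply: le_trans ny _; rewrite ler_piMr //; exact: le_trans K_ge1.
Qed.

(* The normal of [Gamma] varies by O(h) on a face. *)
Lemma normal_sq_le T s (w : pt) : T \in Ts -> ref_tri s ->
  dot (normal Gamma (par T s)) w ^+ 2 <=
    2 * dot (vnormal Gamma T) w ^+ 2 + 18 * K ^+ 2 * h ^+ 2 * dot w w /\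
  dot (vnormal Gamma T) w ^+ 2 <=
    2 * dot (normal Gamma (par T s)) w ^+ 2 + 18 * K ^+ 2 * h ^+ 2 * dot w w.
Proof.
move=> TTs rs; have [_ _ /(_ s (sub_ref_tri rs))[_ _ _ ny]] := faces TTs.
set y := normal _ _ in ny *; set n0 := vnormal _ _ in ny *.
have hd : dot (y - n0) w ^+ 2 <= 9 * K ^+ 2 * h ^+ 2 * dot w w.
  have w2 := normv_sq_le_dot w.
  apply: (@le_trans _ _ ((3 * (K * h) * `|w|) ^+ 2)).
    rewrite -real_normK ?num_real // lerXn2r ?nnegrE //.
      by rewrite !mulr_ge0 // ?(ltW h0) // (le_trans ler01).
    apply: le_trans (normr_dot_le _ _) _; rewrite ler_wpM2r // ler_wpM2l //.
  rewrite (_ : (3 * (K * h) * `|w|) ^+ 2 = 9 * K ^+ 2 * h ^+ 2 * `|w| ^+ 2); last by ring.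
  by rewrite ler_wpM2l // mulr_ge0 ?sqr_ge0 // mulr_ge0 ?sqr_ge0.
have yE : dot (y - n0) w = dot y w - dot n0 w by exact: dotBl.
rewrite yE in hd; have [] := sq_perturb hd.
have -> : 2 * (9 * K ^+ 2 * h ^+ 2 * dot w w) = 18 * K ^+ 2 * h ^+ 2 * dot w w by ring.
move=> p1 p2; split; [exact: p1|exact: p2].
Qed.

(** The weight h^-2 cancels the h^2 of the Jacobian, so the reference normal part carries no weight.
    Exchanging the normals costs h^2 |v|^2, which the L2 part of the norm controls. *)
Lemma normal_equiv v W : vrepresents v W ->
  let Z := surf_int Gamma k Ts (fun y => dot (normal Gamma y) (v y) ^+ 2) in
  h ^- 2 * Z <= K1 * (2 * Sn Gamma Ts W + 18 * K ^+ 2 * (h ^+ 2 * \sum_i S0 Ts (W i))) /\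
  Sn Gamma Ts W <= 2 * K1 * (h ^- 2 * Z) + 18 * K ^+ 2 * (h ^+ 2 * \sum_i S0 Ts (W i)).
Proof.
move=> rv Z.
pose F T s := dot (normal Gamma (par T s)) (wvec W T s) ^+ 2.
pose n2 T s := dot (vnormal Gamma T) (wvec W T s) ^+ 2.
pose w2 T s := dot (wvec W T s) (wvec W T s).
have ZE : Z = sint Ts (fun T s => F T s * jac T s).
  by apply: surf_intE => T s TTs rs; rewrite (vrepresentsE rv TTs (sub_ref_tri rs)).
have rF T : T \in Ts -> regular (F T).
  move=> TTs; apply: regularX; apply: dot_regular => i.
    exact: normal_param_regular.
  exact: wvec_regular.
have rn T : T \in Ts -> regular (n2 T).
  by move=> _; apply: regularX; exact: dot_cst_wvec_regular.
have rw T : T \in Ts -> regular (w2 T).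
  by move=> _; apply: dot_regular => i; exact: wvec_regular.
have z (c : R) (B : triangle -> R * R -> R) : (forall T, T \in Ts -> regular (B T)) ->
    forall T, T \in Ts -> regular (fun s => c * B T s).
  by move=> rB T TTs; apply: regularZ; exact: rB.
have F0 T s : T \in Ts -> ref_tri s -> 0 <= F T s by move=> _ _; exact: sqr_ge0.
have /andP[lo up] := jac_weight rF F0; rewrite -ZE in lo up.
have u1 : sint Ts F <= 2 * Sn Gamma Ts W + 18 * K ^+ 2 * h ^+ 2 * \sum_i S0 Ts (W i).
  rewrite sum_S0 /Sn -!sintZ // -sintD; [|exact: z|exact: z].
  apply: sint_le; [exact: rF| |move=> T s TTs rs; exact: (normal_sq_le _ TTs rs).1].
  move=> T TTs; exact: (regularD (z 2 n2 rn T TTs) (z (18 * K ^+ 2 * h ^+ 2) w2 rw T TTs)).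
have u2 : Sn Gamma Ts W <= 2 * sint Ts F + 18 * K ^+ 2 * h ^+ 2 * \sum_i S0 Ts (W i).
  rewrite sum_S0 /Sn -!sintZ // -sintD; [|exact: z|exact: z].
  apply: sint_le; [exact: rn| |move=> T s TTs rs; exact: (normal_sq_le _ TTs rs).2].
  move=> T TTs; exact: (regularD (z 2 F rF T TTs) (z (18 * K ^+ 2 * h ^+ 2) w2 rw T TTs)).
have h2 : 0 < h ^+ 2 by exact: exprn_gt0.
have K10 : 0 < K1 by exact: lt_le_trans K1_ge1.
split.
  rewrite mulrC ler_pdivrMr //; apply: le_trans up _.
  rewrite [leRHS]mulrAC ler_wpM2l //; first by rewrite mulr_ge0 ?ltW.
  by rewrite [18 * _ * (_ * _)]mulrA; exact: u1.
apply: le_trans u2 _; rewrite [18 * _ * (_ * _)]mulrA; apply: lerD; last exact: lexx.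
rewrite -[leRHS]mulrA ler_wpM2l //.
rewrite [h ^- 2 * Z]mulrC [leRHS]mulrA ler_pdivlMr //.
have : K1 * (K1^-1 * h ^+ 2 * sint Ts F) <= K1 * Z by rewrite ler_wpM2l // ltW.
have -> : K1 * (K1^-1 * h ^+ 2 * sint Ts F) = sint Ts F * h ^+ 2.
  by move: (sint Ts F) => S; field; rewrite gt_eqF.
exact.
Qed.

Lemma triple_norm_equiv v W : vrepresents v W ->
  tnorm2 Gamma Ts h W <= 20 * K ^+ 2 * K1 * triple_norm Gamma k Ts h v ^+ 2 /\
  triple_norm Gamma k Ts h v ^+ 2 <= 20 * K ^+ 2 * K1 * tnorm2 Gamma Ts h W.
Proof.
move=> rv.
have K10 : 0 < K1 by exact: lt_le_trans K1_ge1.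
pose E i := surf_int Gamma k Ts (fun y => v y 0 i ^+ 2) +
  surf_int Gamma k Ts (fun y => enorm (surf_grad Gamma k Ts (fun z => v z 0 i) y) ^+ 2).
pose D i := h ^+ 2 * S0 Ts (W i) + S1 Ts (W i).
have D0 i : 0 <= D i by rewrite addr_ge0 ?S1_ge0 // mulr_ge0 ?sqr_ge0 ?S0_ge0.
have Ei i : K1^-1 * D i <= E i <= K1 * D i.
  have /andP[a1 a2] := surf_int_sq_equiv (rv i).
  have /andP[c1 c2] := surf_int_grad_equiv (rv i).
  have := lerD a2 c2; have := lerD a1 c1; rewrite -!(mulrA _ (h ^+ 2)) -!mulrDr => l1 l2.
  by apply/andP; split; [exact: l1|exact: l2].
have E0 i : 0 <= E i.
  by case/andP: (Ei i) => /(le_trans _) h2 _; apply: h2; rewrite mulr_ge0 ?invr_ge0 // ltW.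
have [n1 n2] := normal_equiv rv.
set Z := surf_int _ _ _ _ in n1 n2.
have Z0 : 0 <= Z.
  rewrite /Z (surf_intE (F := fun T s => dot (normal Gamma (par T s)) (v (par T s)) ^+ 2)) //.
  by apply: sint_ge0 => T s _ _; rewrite mulr_ge0 ?sqr_ge0 ?sqrtr_ge0.
have trE : triple_norm Gamma k Ts h v ^+ 2 = \sum_i E i + h ^- 2 * Z.
  rewrite sqr_sqrtr; last by rewrite addr_ge0 ?sqr_ge0 // mulr_ge0 ?sqr_ge0 // invr_ge0 sqr_ge0.
  have -> : H1norm Gamma k Ts v ^+ 2 = \sum_i E i.
    by apply: sqr_sqrtr; apply: sumr_ge0 => i _; exact: E0.
  by congr (_ + _ * _); exact: sqr_sqrtr.
rewrite trE.
have X1 : h ^+ 2 * \sum_i S0 Ts (W i) <= \sum_i D i.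
  by rewrite big_split /= -mulr_sumr lerDl sumr_ge0 // => i _; exact: S1_ge0.
have sE1 : \sum_i E i <= K1 * \sum_i D i.
  by rewrite mulr_sumr; apply: ler_sum => i _; case/andP: (Ei i).
have sE2 : \sum_i D i <= K1 * \sum_i E i.
  rewrite mulr_sumr; apply: ler_sum => i _; case/andP: (Ei i) => a _.
  by rewrite -ler_pdivrMl.
have Zh : 0 <= h ^- 2 * Z by rewrite mulr_ge0 // invr_ge0 sqr_ge0.
have Sn0 := Sn_ge0 Gamma Ts W.
have sD0 : 0 <= \sum_i D i by apply: sumr_ge0.
have KK : 1 <= K ^+ 2 by rewrite exprn_ege1.
rewrite /tnorm2 -/(D _); move: n1 n2 X1 sE1 sE2 Zh Sn0 sD0 KK K1_ge1.
have -> : \sum_i (h ^+ 2 * S0 Ts (W i) + S1 Ts (W i)) = \sum_i D i by [].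
exact: norm_equiv_combine.
Qed.

Lemma L2norm_sqE q Q : represents q Q ->
  L2norm Gamma k Ts q ^+ 2 = surf_int Gamma k Ts (fun y => q y ^+ 2).
Proof.
move=> rq; rewrite /L2norm sqr_sqrtr //.
rewrite (surf_intE (F := fun T s => q (par T s) ^+ 2)) //.
by apply: sint_ge0 => T s _ _; rewrite mulr_ge0 ?sqr_ge0 ?sqrtr_ge0.
Qed.

Lemma L2norm_equiv q Q : represents q Q ->
  K1^-1 * h ^+ 2 * S0 Ts Q <= L2norm Gamma k Ts q ^+ 2 <= K1 * h ^+ 2 * S0 Ts Q.
Proof. by move=> rq; rewrite (L2norm_sqE rq); exact: surf_int_sq_equiv. Qed.

(* A function of mean zero is orthogonal to the constants. *)
Lemma L2norm_mean0_le q Q c : represents q Q -> surf_int Gamma k Ts q = 0 ->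
  L2norm Gamma k Ts q <= L2norm Gamma k Ts (fun y => q y - c).
Proof.
move=> rq q0; rewrite /L2norm ler_sqrt; last first.
  rewrite (surf_intE (F := fun T s => (q (par T s) - c) ^+ 2)) //.
  by apply: sint_ge0 => T s _ _; rewrite mulr_ge0 ?sqr_ge0 ?sqrtr_ge0.
rewrite (surf_intE (F := fun T s => pev (Q T) s ^+ 2)); last first.
  by move=> T s TTs rs; rewrite rq //; exact: sub_ref_tri.
rewrite (surf_intE (F := fun T s => (pev (Q T) s - c) ^+ 2)); last first.
  by move=> T s TTs rs; rewrite rq //; exact: sub_ref_tri.
have q0' : sint Ts (fun T s => (2 * c) * (pev (Q T) s * jac T s)) = 0.
  rewrite sintZ => [|T _]; last by apply: regularM; [exact: pev_regular|exact: jac_regular].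
  rewrite -(surf_intE (f := q)) ?q0 ?mulr0 // => T s TTs rs.
  by rewrite rq //; exact: sub_ref_tri.
have rj T : regular (fun s => (pev (Q T) s - c) ^+ 2 * jac T s).
  apply: regularM; last exact: jac_regular.
  by apply/regularX/regularB; [exact: pev_regular|exact: regular_cst].
have rc T : regular (fun s => (2 * c) * (pev (Q T) s * jac T s)).
  by apply/regularZ/regularM; [exact: pev_regular|exact: jac_regular].
rewrite -[leRHS]addr0 -q0' -sintD //.
apply: sint_le => [T _|T _|T s _ _]; [|exact: regularD|].
  by apply: regularM; [exact/regularX/pev_regular|exact: jac_regular].
rewrite mulrA -mulrDl ler_wpM2r ?sqrtr_ge0 //.
have := sqr_ge0 c; move: (pev _ _) => x c2; rewrite -subr_ge0.
by rewrite [leRHS](_ : _ = c ^+ 2) //; ring.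
Qed.

(** The correction to mean zero divides by this area. *)
Lemma surf_area_gt0 T0 : T0 \in Ts -> 0 < sint Ts jac.
Proof.
move=> T0Ts; have K10 : 0 < K1 by exact: lt_le_trans K1_ge1.
have r1 T : T \in Ts -> regular (fun=> 1 : R) by move=> _; exact: regular_cst.
have /andP[+ _] := jac_weight r1 (fun _ _ _ _ => ler01).
rewrite (@sint_eq _ Ts (fun T s => 1 * jac T s) jac); last by move=> T s _ _; rewrite mul1r.
apply: lt_le_trans; rewrite mulr_gt0 //.
  by rewrite mulr_gt0 ?invr_gt0 ?exprn_gt0.
rewrite /sint (bigD1_seq T0) //=; last by case: polyG.
rewrite ltr_pwDl //; last first.
  by apply: sumr_ge0 => T _; apply: rint_ge0.
apply: (@rint_gt0 _ _ (4^-1, 4^-1)) => //; first exact: regular_cst.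
by split=> /=; lra.
Qed.

Lemma surf_int_subC q Q c : represents q Q ->
  surf_int Gamma k Ts (fun y => q y - c) = surf_int Gamma k Ts q - c * sint Ts jac.
Proof.
move=> rq; rewrite (surf_intE (F := fun T s => pev (Q T) s - c)); last first.
  by move=> T s TTs rs; rewrite rq //; exact: sub_ref_tri.
rewrite (surf_intE (F := fun T s => pev (Q T) s)); last first.
  by move=> T s TTs rs; rewrite rq //; exact: sub_ref_tri.
rewrite -sintZ => [|T _]; last exact: jac_regular.
rewrite -sintB; last 2 first.
- by move=> T _; apply: regularM; [exact: pev_regular|exact: jac_regular].
- by move=> T _; apply/regularZ/jac_regular.
by apply: sint_eq => T s _ _; rewrite mulrBl.
Qed.

End SurfaceForms.

(** * Transfer between degrees *)

Section FiniteElementTransfer.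
Context {R : realType}.
Local Notation pt := 'rV[R]_3.
Local Notation triangle := 'M[R]_3.

Lemma poly_on_pev j n (T : triangle) (f : pt -> R) : (j <= n)%N -> poly_on j (tri T) f ->
  exists u : 'rV[R]_(n.+1 * n.+1), forall s, cref_tri s -> f (ref_map T s) = pev u s.
Proof.
move=> jn [c fE].
have pcoord i : pfun 1 (fun s => ref_map T s 0 i).
  have := @pfun_sum R 1 'I_3 (index_enum _) xpredT (fun a s => T a i * lam s 0 a)
    (fun a _ => pfunZ (T a i) (lam_pfun a)).
  by apply: eq_pfun => s; rewrite ref_mapE mxE; apply: eq_bigr => a _; rewrite mulrC.
have [u uE] : pfun n (fun s => \sum_(al : {ffun 'I_3 -> 'I_j.+1} | (\sum_i al i <= j)%N)
    c al * \prod_i ref_map T s 0 i ^+ al i).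
  apply: pfun_sum => al al_le; apply: pfunZ.
  have := pfun_prod (index_enum _) (fun i => pfunX (al i) (pcoord i)).
  by apply: pfun_widen; under eq_bigr do rewrite mul1n; exact: leq_trans jn.
by exists u => s rs; rewrite fE ?uE //; apply/triP; exists s.
Qed.

Lemma pev_cst n (c : R) : exists e : 'rV[R]_(n.+1 * n.+1),
  [/\ forall s, pev e s = c, forall s, pev1 e s = 0 & forall s, pev2 e s = 0].
Proof.
have [e eE] := pfun_cst n c; have ec : pev e = cst c by apply/funext => s; rewrite -eE.
exists e; split=> s; first by rewrite ec.
  have := derive_pev e s (1, 0); rewrite ec derive_cst /= => ->; ring.
have := derive_pev e s (0, 1); rewrite ec derive_cst /= => ->; ring.
Qed.

Lemma pevB n (u v : 'rV[R]_(n.+1 * n.+1)) s :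
  [/\ pev (u - v) s = pev u s - pev v s, pev1 (u - v) s = pev1 u s - pev1 v s &
      pev2 (u - v) s = pev2 u s - pev2 v s].
Proof.
by split; rewrite -sumrB; apply: eq_bigr => a _; rewrite !mxE mulrBl.
Qed.

(** * Reference representation and continuity on one surface *)

Section OneDegree.
Variables (Gamma : set pt) (k : nat) (Ts : seq triangle).
Hypotheses (polyG : polyhedral Gamma Ts).

(** A pasting argument for finitely many closed pieces: the points where the value differs from
    [q y] by at least [e] form a finite union of compact images, and [y] is not among them. *)
Lemma represents_within N (q : pt -> R) (Q : triangle -> 'rV[R]_(N.+1 * N.+1)) :
  represents Gamma k Ts q Q -> {within surf_k Gamma k Ts, continuous q}.
Proof.
move=> rq; apply/subspace_continuousP => y Sy; apply/cvgrPdist_lt => e e0.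
pose B T := param Gamma k T @` (cref_tri `&` [set s | e <= `|q y - pev (Q T) s|]).
have cB T : T \in Ts -> closed (B T).
  move=> TTs; apply: compact_closed; first exact: norm_hausdorff.
  apply: continuous_compact.
    apply: continuous_subspaceT => s; exact/continuous_param/(face_nondegenerate polyG).
  apply: compact_closedI; first exact: compact_cref_tri.
  apply: (@preimage_closed _ _ (fun s => `|q y - pev (Q T) s|) [set x | e <= x]);
    last exact: closed_ge.
  move=> s _; apply: (@continuous_comp _ _ _ (fun s => q y - pev (Q T) s) (fun x : R => `|x|)).
    by apply: continuousB; [exact: cst_continuous|exact: continuous_pev].
  exact: norm_continuous.
pose F := \big[setU/set0]_(T <- Ts) B T.
have cF : closed F by exact: closed_bigsetU.
have nF : (~` F) y.
  rewrite /F -bigcup_seq => -[T /= TTs [s [rs /= es] ys]]; move: es.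
  by rewrite -rq // ys subrr normr0 leNgt e0.
have : nbhs y (~` F) by apply: open_nbhs_nbhs; split=> //; exact: closed_openC.
rewrite near_withinE; apply: filterS => x nFx Sx; rewrite ltNge; apply/negP => ex; apply: nFx.
have [T [s [TTs rs xE]]] := (surf_kP k polyG x).1 Sx.
by rewrite /F -bigcup_seq; exists T => //; exists s => //; split=> //=; rewrite -rq // -xE.
Qed.

Lemma vrepresents_within N (v : pt -> pt) (W : 'I_3 -> triangle -> 'rV[R]_(N.+1 * N.+1)) :
  vrepresents Gamma k Ts v W -> {within surf_k Gamma k Ts, continuous v}.
Proof.
by move=> rv x; apply: continuous_rV3 => i; exact: (represents_within (rv i)).
Qed.

Lemma Vscal_represents j n (q : pt -> R) : (j <= n)%N ->
  Vscal Ts j (fun x => q (proj_k Gamma k Ts x)) ->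
  exists Q : triangle -> 'rV[R]_(n.+1 * n.+1), represents Gamma k Ts q Q.
Proof.
move=> jn [_ hp].
have hT T : exists u : 'rV[R]_(n.+1 * n.+1), T \in Ts ->
    forall s, cref_tri s -> q (param Gamma k T s) = pev u s.
  case: (boolP (T \in Ts)) => [TTs|nT]; last by exists 0.
  have [u uE] := poly_on_pev jn (hp T TTs).
  exists u => _ s rs; rewrite -(uE s rs).
  by rewrite (proj_k_ref_map k polyG TTs rs).
have [Q QE] := choice hT.
by exists Q => T s TTs rs; exact: QE.
Qed.

Lemma VscalB j (f : pt -> R) c : Vscal Ts j f -> Vscal Ts j (fun x => f x - c).
Proof.
move=> [cf hp]; split.
  by move=> x; apply: cvgB; [exact: cf|exact: cvg_cst].
move=> T TTs; have [a aE] := hp T TTs.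
(* The constant is subtracted from the coefficient of the zero multi-index. *)
pose al0 : {ffun 'I_3 -> 'I_j.+1} := [ffun=> ord0].
exists (fun al => a al - (if al == al0 then c else 0)) => x Tx; rewrite aE //.
under [RHS]eq_bigr do rewrite mulrBl.
rewrite sumrB; congr (_ - _); rewrite (bigD1 al0) /=; last first.
  by rewrite big1 // => i _; rewrite ffunE.
rewrite eqxx big1 => [|i _]; last by rewrite ffunE expr0.
by rewrite mulr1 big1 ?addr0 // => al /andP[_ /negbTE ->]; rewrite mul0r.
Qed.

End OneDegree.

(** * Transfer of finite element functions between two surfaces *)

Section TwoDegrees.
Variables (Gamma : set pt) (delta : R) (k l m : nat) (Ts : seq triangle).
Hypotheses (polyG : polyhedral Gamma Ts) (adml : admissible Gamma delta l Ts).

Local Notation projk := (proj_k Gamma k Ts).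
Local Notation projl := (proj_k Gamma l Ts).

(** Composition of [f] with [proj_k] after the inverse of [proj_l], so that the pull-back to the
    polyhedral surface is unchanged. *)
Definition transfer (A : Type) (f : pt -> A) (y : pt) : A :=
  f (projk (xget 0 [set x | polysurf Ts x /\ projl x = y])).

Lemma transferE A (f : pt -> A) x : polysurf Ts x -> transfer f (projl x) = f (projk x).
Proof.
move=> Px; case: adml => _ [_ inj _] _; rewrite /transfer; congr (f (projk _)).
have [Pz zx] := @xgetPex _ 0 [set z | polysurf Ts z /\ projl z = projl x]
  (ex_intro _ x (conj Px erefl)).
by apply: inj; rewrite ?inE.
Qed.

Lemma Vscal_transfer j (f : pt -> R) : Vscal Ts j (fun x => f (projk x)) ->
  Vscal Ts j (fun x => transfer f (projl x)).
Proof.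
move=> [cf hp]; split.
  apply: subspace_eq_continuous cf => x; rewrite inE => Px.
  by rewrite /from_subspace transferE.
move=> T TTs; have [c cE] := hp T TTs; exists c => x Tx.
by rewrite transferE ?cE //; exists T.
Qed.

Lemma represents_transfer N (q : pt -> R) (Q : triangle -> 'rV[R]_(N.+1 * N.+1)) :
  represents Gamma k Ts q Q -> represents Gamma l Ts (transfer q) Q.
Proof.
move=> rq T s TTs rs; rewrite -(proj_k_ref_map l polyG TTs rs) transferE.
  by rewrite (proj_k_ref_map k polyG TTs rs) rq.
by apply/polysurfP; exists T, s.
Qed.

Lemma Qh_transfer q : Qh Gamma k m Ts q -> Qh Gamma l m Ts (transfer q).
Proof.
move=> [_ Vq]; have [Q rQ] := Vscal_represents polyG (leqnn _) Vq.
split; last exact: Vscal_transfer Vq.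
exact: (represents_within polyG (represents_transfer rQ)).
Qed.

Lemma Vh_represents v : Vh Gamma k m Ts v ->
  exists W : 'I_3 -> triangle -> 'rV[R]_(m.+1 * m.+1), vrepresents Gamma k Ts v W.
Proof.
move=> [_ Vv].
have hW i := @Vscal_represents Gamma k Ts polyG _ _ (fun y => v y 0 i) (leqnn m) (Vv i).
by have [W WE] := choice hW; exists W.
Qed.

Lemma vrepresents_transfer v (W : 'I_3 -> triangle -> 'rV[R]_(m.+1 * m.+1)) :
  vrepresents Gamma k Ts v W -> vrepresents Gamma l Ts (transfer v) W.
Proof.
by move=> rv i; exact: (@represents_transfer _ (fun y => v y 0 i) (W i) (rv i)).
Qed.

Lemma Vh_transfer v : Vh Gamma k m Ts v -> Vh Gamma l m Ts (transfer v).
Proof.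
move=> Vv; have [W rW] := Vh_represents Vv; split.
  exact: (vrepresents_within polyG (vrepresents_transfer rW)).
by move=> i; case: Vv => _ Vv; exact: (@Vscal_transfer _ (fun y => v y 0 i) (Vv i)).
Qed.

End TwoDegrees.
End FiniteElementTransfer.

(** * The inf-sup property *)

Lemma le_sqrX_bound (R : realFieldType) (x B : R) : 0 <= B -> x ^+ 2 <= B ^+ 2 -> `|x| <= B.
Proof. by move=> B0; rewrite -[x ^+ 2]real_normK ?num_real // ler_pXn2r ?nnegrE. Qed.

Lemma distr_le_double (R : realDomainType) (x y z b : R) :
  `|x - z| <= b -> `|y - z| <= b -> `|x - y| <= 2 * b.
Proof.
rewrite [`|y - z|]distrC => xz yz; have := ler_normD (x - z) (z - y).
by rewrite addrA subrK => /le_trans; apply; rewrite mulr_natl mulr2n lerD.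
Qed.

Lemma le_of_sq_chain (R : realFieldType) (a b c x : R) : 0 <= c -> 0 <= x ->
  a ^+ 2 <= c * b -> b <= c * x ^+ 2 -> a <= c * x.
Proof.
move=> c0 x0 ab bx; apply: le_trans (ler_norm _) _.
apply: le_sqrX_bound; first exact: mulr_ge0.
by apply: le_trans ab _; rewrite exprMn expr2 -mulrA ler_wpM2l.
Qed.

(** A quarter of [c] is given up because the supremum need not be attained, and another quarter pays
    for the difference of the forms, since 2 A h is at most c / 4. The remaining half is divided by
    [C] for the change of norm. If [nk] is 0, the quotient is 0 by convention and contradicts the
    lower bound. *)
Lemma quotient_transfer (R : realFieldType) (bk bl nk nl X A C h c : R) :
  0 <= nk -> 0 <= nl -> 0 < X -> 1 <= C -> 0 < c ->
  `|bk - bl| <= 2 * (A * h * nk * X) -> nl <= C * nk -> nk <= C * nl -> 8 * A * h <= c ->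
  3 / 4 * c * X < bk / nk -> c / 2 / C * X <= bl / nl.
Proof.
move=> nk0 nl0 X0 C1 c0 hb lk kl hh hq.
have C0 : 0 < C by lra.
have cX : 0 < 3 / 4 * c * X by rewrite !mulr_gt0.
have [nkE|nkn] := eqVneq nk 0; first by move: hq; rewrite nkE invr0 mulr0; lra.
have nkp : 0 < nk by rewrite lt_neqAle eq_sym nkn.
have nlp : 0 < nl.
  by rewrite -(pmulr_rgt0 _ C0); exact: lt_le_trans kl.
rewrite ltr_pdivlMr // in hq; rewrite ler_pdivlMr //.
have nX : 0 <= nk * X by rewrite mulr_ge0 // ltW.
have e1 : 8 * A * h * (nk * X) <= c * (nk * X) by rewrite ler_wpM2r.
have e2 : bk - bl <= 2 * (A * h * nk * X) by exact: le_trans (ler_norm _) hb.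
have e3 : c / 2 / C * X * nl <= c / 2 / C * X * (C * nk).
  by rewrite ler_wpM2l // !mulr_ge0 ?invr_ge0 // ltW.
have e4 : c / 2 / C * X * (C * nk) = c / 2 * (nk * X) by field; rewrite gt_eqF.
by rewrite e4 in e3; lra.
Qed.

(** For the degenerate case of a pressure with vanishing norm, where only nonnegativity of the
    supremum, up to any [e], is to be shown. A zero norm makes the quotient 0 by convention. *)
Lemma quotient_transfer0 (R : realFieldType) (b nk nl C e : R) :
  0 <= nk -> 0 <= nl -> 0 < C -> 0 < e -> nl <= C * nk -> nk <= C * nl ->
  - (e / C) < b / nk -> - e <= b / nl.
Proof.
move=> nk0 nl0 C0 e0 lk kl.
have [nlE|nln] := eqVneq nl 0; first by rewrite nlE invr0 mulr0 oppr_le0 ltW.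
have nlp : 0 < nl by rewrite lt_neqAle eq_sym nln.
have nkp : 0 < nk.
  have [nkE|nkn] := eqVneq nk 0; last by rewrite lt_neqAle eq_sym nkn.
  by move: lk nlp; rewrite nkE mulr0 ltNge => ->.
rewrite ltr_pdivlMr // ler_pdivlMr // => hq.
have : e / C * nk <= e / C * (C * nl) by rewrite ler_wpM2l // ltW // divr_gt0.
by rewrite mulrA divfK ?gt_eqF //; lra.
Qed.

Section InfSupTransfer.
Context {R : realType}.
Local Notation pt := 'rV[R]_3.
Local Notation triangle := 'M[R]_3.

(** All that the transfer has to know about one degree, with a single constant [C]. *)
Definition degree_est Gamma k (Ts : seq triangle) (h C : R) : Prop :=
  forall (N : nat) (v : pt -> pt) (W : 'I_3 -> triangle -> 'rV[R]_(N.+1 * N.+1))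
    (q : pt -> R) (Q : triangle -> 'rV[R]_(N.+1 * N.+1)),
  (vrepresents Gamma k Ts v W ->
     tnorm2 Gamma Ts h W <= C * triple_norm Gamma k Ts h v ^+ 2 /\
     triple_norm Gamma k Ts h v ^+ 2 <= C * tnorm2 Gamma Ts h W) /\
  (represents Gamma k Ts q Q ->
     [/\ h ^+ 2 * S0 Ts Q <= C * L2norm Gamma k Ts q ^+ 2,
         L2norm Gamma k Ts q ^+ 2 <= C * (h ^+ 2 * S0 Ts Q) &
         vrepresents Gamma k Ts v W ->
         (b_form Gamma k Ts v q - sint Ts (flat_density W Q)) ^+ 2 <=
           (C * h ^+ 2) ^+ 2 * tnorm2 Gamma Ts h W * S1 Ts Q]).

Section Mesh.
Variables (Gamma : set pt) (delta : R) (H : set R) (Th : R -> seq triangle).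
Hypotheses (surfG : smooth_closed_surface Gamma) (tubeG : tubular Gamma delta)
  (meshG : mesh_family Gamma H Th).

(** The empty maximum defaults to 0, whereas mesh sizes are positive. *)
Lemma mesh_neq0 h : H h -> exists T, T \in Th h.
Proof.
case: meshG => hm _ _ /hm[h0 _ hE].
case E : (Th h) => [|T Ts]; last by exists T; rewrite inE eqxx.
by move: h0; rewrite -hE E /meshsize big_nil ltxx.
Qed.

(** The estimates hold for every [C] above [C0], so that two degrees can share one constant. *)
Lemma degree_estimates k : (0 < k)%N -> exists2 h0 : R, 0 < h0 & exists2 C0 : R, 1 <= C0 &
  forall C h, C0 <= C -> H h -> h < h0 -> admissible Gamma delta k (Th h) ->
    degree_est Gamma k (Th h) h C /\ 0 < sint (Th h) (jac Gamma k).
Proof.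
move=> k0; have [h0 /andP[h00 h01] [K K1 hF]] := param_metric surfG tubeG meshG k0.
have [K' K'1 hC] := metric_consequences Gamma K1.
have KK : 1 <= K ^+ 2 by rewrite exprn_ege1.
have K'0 : 0 < K' by lra.
have KK' : K' <= K ^+ 2 * K' by rewrite -[leLHS]mul1r ler_wpM2r // ltW.
exists h0 => //; exists (20 * K ^+ 2 * K'); first by lra.
move=> C h CK Hh hh0 adm; have [h_gt0 polyG _] := (let: And3 a _ _ := meshG in a) h Hh.
have h1 : h <= 1 by rewrite (le_trans (ltW hh0)).
have faces T : T \in Th h ->
  [/\ `|vnormal Gamma T| <= K, metric_est Gamma K h T (edge1 T) (edge2 T) &
      forall s, cref_tri s -> param_metric_at Gamma delta K h k T s].
  by move=> TTs; have [] := hF h Hh hh0 T TTs.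
have cons T b1 b2 := hC h T b1 b2 h_gt0 h1.
have h20 : 0 <= h ^+ 2 by exact: sqr_ge0.
split; last first.
  have [T0 T0Th] := mesh_neq0 Hh.
  exact: (surf_area_gt0 polyG h_gt0 K'1 faces cons T0Th).
move=> N v W q Q; split=> [rv|rq].
  have [t1 t2] := triple_norm_equiv tubeG polyG adm h_gt0 h1 K1 K'1 faces cons rv.
  split; [apply: le_trans t1 _|apply: le_trans t2 _]; rewrite ler_wpM2r ?sqr_ge0 //.
  exact: tnorm2_ge0.
have /andP[l1 l2] := L2norm_equiv polyG faces cons rq.
split.
- have := l1; rewrite -mulrA -(ler_pM2l K'0) mulVKf ?gt_eqF // => /le_trans; apply.
  by rewrite ler_wpM2r ?sqr_ge0 //; lra.
- apply: le_trans l2 _; rewrite -mulrA ler_wpM2r //; last by lra.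
  by rewrite mulr_ge0 // S0_ge0.
move=> rv.
apply: le_trans (b_form_perturbation tubeG polyG adm h_gt0 K1 K'1 faces cons rv rq) _.
rewrite ler_wpM2r ?S1_ge0 // ler_wpM2r ?tnorm2_ge0 //.
rewrite (_ : 4 * (K' * h ^+ 2) ^+ 2 = (2 * K' * h ^+ 2) ^+ 2); last by ring.
have x0 : 0 <= 2 * K' by lra.
have xC : 2 * K' <= C by lra.
have p1 : 2 * K' * h ^+ 2 <= C * h ^+ 2 by rewrite ler_wpM2r.
have p0 : 0 <= 2 * K' * h ^+ 2 by exact: mulr_ge0.
rewrite ler_pXn2r ?nnegrE //; exact: le_trans p1.
Qed.

(** Of the h^2 in the perturbation bound, one power is spent on turning [S1] into the L2 norm of [q]
    by the inverse inequality, and one survives. The factor 1 + Ki replaces the square root of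
    [Ki]. *)
Lemma b_form_close k (Ts : seq triangle) (h C Ki X : R) N (v : pt -> pt) q
    (W : 'I_3 -> triangle -> 'rV[R]_(N.+1 * N.+1)) Q (n : R) :
  1 <= C -> 0 <= Ki -> 0 <= X -> 0 <= h -> 0 <= n ->
  degree_est Gamma k Ts h C -> vrepresents Gamma k Ts v W -> represents Gamma k Ts q Q ->
  h ^+ 2 * S1 Ts Q <= Ki * (C * X ^+ 2) -> tnorm2 Gamma Ts h W <= C * n ^+ 2 ->
  `|b_form Gamma k Ts v q - sint Ts (flat_density W Q)| <= C ^+ 2 * (1 + Ki) * h * n * X.
Proof.
move=> C1 Ki0 X0 h0 n0 est rv rq hS hn.
have C0 : 0 <= C by lra.
apply: le_sqrX_bound; first by rewrite !mulr_ge0 ?sqr_ge0 //; lra.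
have [_ /(_ rq)[_ _ /(_ rv) hb]] := est N v W q Q.
apply: le_trans hb _; move: (tnorm2_ge0 Gamma Ts h W) (S1_ge0 Ts Q) hS hn.
move: (tnorm2 _ _ _ _) (S1 _ _) => t s t0 s0 hS hn.
have -> : (C * h ^+ 2) ^+ 2 * t * s = C ^+ 2 * h ^+ 2 * (t * (h ^+ 2 * s)) by ring.
have h20 : 0 <= h ^+ 2 by exact: sqr_ge0.
have p1 : t * (h ^+ 2 * s) <= C * n ^+ 2 * (Ki * (C * X ^+ 2)).
  by apply: ler_pM => //; rewrite mulr_ge0.
apply: (@le_trans _ _ (C ^+ 2 * h ^+ 2 * (C * n ^+ 2 * (Ki * (C * X ^+ 2))))).
  by rewrite ler_wpM2l // mulr_ge0 // sqr_ge0.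
rewrite (_ : C ^+ 2 * h ^+ 2 * _ = Ki * (C ^+ 2 * h * n * X) ^+ 2); last by ring.
rewrite (_ : (C ^+ 2 * (1 + Ki) * h * n * X) ^+ 2 = (1 + Ki) ^+ 2 * (C ^+ 2 * h * n * X) ^+ 2);
  last by ring.
by rewrite ler_wpM2r ?sqr_ge0 //; have := sqr_ge0 Ki; lra.
Qed.

Lemma neq0_transfer k l (Ts : seq triangle) (v : pt -> pt) : admissible Gamma delta l Ts ->
  (exists2 y, surf_k Gamma k Ts y & v y != 0) ->
  exists2 y, surf_k Gamma l Ts y & transfer Gamma k l Ts v y != 0.
Proof.
move=> adml [_ [x Px <-] vx]; exists (proj_k Gamma l Ts x); first by exists x.
by rewrite (transferE k adml v Px).
Qed.

Lemma triple_norm_ge0 k (Ts : seq triangle) (h : R) (v : pt -> pt) :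
  0 <= triple_norm Gamma k Ts h v.
Proof. exact: sqrtr_ge0. Qed.

Lemma sup_quotient_ge k m (Ts : seq triangle) (h t : R) (v : pt -> pt) q :
  Vh Gamma k m Ts v -> (exists2 y, surf_k Gamma k Ts y & v y != 0) ->
  t <= b_form Gamma k Ts v q / triple_norm Gamma k Ts h v ->
  (t%:E <= sup_quotient Gamma k m Ts h q)%E.
Proof.
move=> Vv v_neq0; rewrite -lee_fin => /le_trans; apply.
by apply: ereal_sup_ubound; exists v.
Qed.

(** The supremum need not be attained, so for given [q] a test function is taken that reaches 3/4 of
    the constant for the mean-corrected transfer of [q], and it is transferred back. The forms are
    compared through their common flat density, the norms through the common reference norms. *)
Lemma inf_sup_transfer k l m : (0 < k)%N -> (0 < l)%N ->
  (exists2 h0 : R, 0 < h0 & forall h, H h -> h < h0 ->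
     admissible Gamma delta k (Th h) /\ admissible Gamma delta l (Th h)) ->
  inf_sup Gamma H Th k m -> inf_sup Gamma H Th l m.
Proof.
have lt34 : 3 / 4 < 1 :> R by lra.
move=> k0 l0 [ha ha0 adm] [c c0 [hi hi0 isk]].
have [hk hk0 [Ck Ck1 estk]] := degree_estimates k0.
have [hl hl0 [Cl Cl1 estl]] := degree_estimates l0.
have [Ki Ki0 inv] := @S1_le_S0 R m.
pose C := Ck + Cl; have CkC : Ck <= C by rewrite /C; lra.
have ClC : Cl <= C by rewrite /C; lra.
have C1 : 1 <= C by lra.
have C0 : 0 < C by lra.
pose A := C ^+ 2 * (1 + Ki).
have A0 : 0 < A by rewrite mulr_gt0 ?exprn_gt0 //; lra.
have c20 : 0 < c / 2 / C by rewrite !divr_gt0.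
(* One division by [C] is for the norms of the test function, the other for the L2 norms of [q]. *)
exists (c / 2 / C / C); first by rewrite divr_gt0.
(* The last threshold makes the difference of the forms at most c / 4 times the product of the
   norms. *)
exists (Num.min (Num.min ha hi) (Num.min (Num.min hk hl) (c / (8 * A)))).
  by rewrite !lt_min ha0 hi0 hk0 hl0 divr_gt0 // mulr_gt0.
move=> h Hh; rewrite !lt_min => /and3P[/andP[h_a h_i] /andP[h_k h_l] h_A] q [Qq q0].
have [admk adml] := adm h Hh h_a.
have [ek ak] := estk C h CkC Hh h_k admk.
have [el al] := estl C h ClC Hh h_l adml.
have [h_gt0 polyG _] := (let: And3 a _ _ := meshG in a) h Hh.
have A80 : 0 < 8 * A by exact: mulr_gt0.
have h8A : 8 * A * h <= c.
  by move: h_A; rewrite (ltr_pdivlMr _ _ A80) [h * _]mulrC => /ltW.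
move: (isk h Hh h_i) ek ak el al polyG admk adml Qq q0 => {isk}.
move: (Th h) => Ts isk ek ak el al polyG admk adml Qq q0; move: isk.
have Qk := Qh_transfer polyG admk Qq.
have [Q rQ] := Vscal_represents polyG (leq_pred m) Qq.2.
have rQk := represents_transfer polyG admk rQ.
set qk := transfer Gamma l k Ts q in Qk rQk.
(* The mean value on the surface of degree [k]; mean zero on degree [l] does not carry over, because
   the Jacobians differ. *)
pose a := surf_int Gamma k Ts qk / sint Ts (jac Gamma k).
pose r y := qk y - a.
have [e [ee e1 e2]] := pev_cst m a.
pose Qr T := Q T - e.
have rr : represents Gamma k Ts r Qr.
  move=> T s TTs rs; rewrite /r (rQk T s TTs rs); have [-> _ _] := pevB (Q T) e s.
  by rewrite ee.
have rr' : represents Gamma l Ts (fun y => q y - a) Qr.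
  move=> T s TTs rs; rewrite (rQ T s TTs rs); have [-> _ _] := pevB (Q T) e s.
  by rewrite ee.
have Q0r : Qh0 Gamma k m Ts r.
  split; last by rewrite /r (surf_int_subC polyG a rQk) /a divfK ?subrr // gt_eqF.
  by split; [exact: (represents_within polyG rr)|exact: VscalB Qk.2].
move=> /(_ r Q0r); set X := L2norm Gamma k Ts r => isk.
have X0 : 0 <= X by exact: sqrtr_ge0.
have [hS0 _ _] := (ek m (fun=> 0) (fun _ _ => 0) r Qr).2 rr.
have [_ hSl _] := (el m (fun=> 0) (fun _ _ => 0) (fun y => q y - a) Qr).2 rr'.
(* On degree [l] the function [q] has mean zero, so subtracting [a] can only increase its norm, and
   [q - a] has the same reference data as [r]. *)
have L2l : L2norm Gamma l Ts q <= C * X.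
  apply: le_trans (L2norm_mean0_le polyG a rQ q0) _.
  exact: le_of_sq_chain (ltW C0) X0 hSl hS0.
have S1E : S1 Ts Q = S1 Ts Qr.
  apply: sint_eq => T s _ _; have [_ -> ->] := pevB (Q T) e s.
  by rewrite e1 e2 !subr0.
have hS1 : h ^+ 2 * S1 Ts Qr <= Ki * (C * X ^+ 2).
  have := inv Ts Qr; rewrite -(ler_pM2l (exprn_gt0 2 h_gt0)) => /le_trans; apply.
  by rewrite mulrCA ler_wpM2l // ltW.
have fE (W : 'I_3 -> triangle -> 'rV[R]_(m.+1 * m.+1)) :
    sint Ts (flat_density W Qr) = sint Ts (flat_density W Q).
  apply: sint_eq => T s _ _; rewrite /flat_density; have [_ -> ->] := pevB (Q T) e s.
  by rewrite e1 e2 !subr0.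
have key v : Vh Gamma k m Ts v -> let v' := transfer Gamma k l Ts v in
    let nk := triple_norm Gamma k Ts h v in let nl := triple_norm Gamma l Ts h v' in
    [/\ Vh Gamma l m Ts v',
        `|b_form Gamma k Ts v r - b_form Gamma l Ts v' q| <= 2 * (A * h * nk * X),
        nl <= C * nk & nk <= C * nl].
  move=> Vv v' nk nl; have [W rW] := Vh_represents polyG Vv.
  have rW' := vrepresents_transfer polyG adml rW.
  have [tk1 tk2] := (ek m v W r Qr).1 rW; have [tl1 tl2] := (el m v' W q Q).1 rW'.
  have nk0 : 0 <= nk by exact: sqrtr_ge0.
  have nl0 : 0 <= nl by exact: sqrtr_ge0.
  have hb1 := b_form_close C1 (ltW Ki0) X0 (ltW h_gt0) nk0 ek rW rr hS1 tk1.
  have hS1' : h ^+ 2 * S1 Ts Q <= Ki * (C * X ^+ 2) by rewrite S1E.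
  (* The norm of [v] on degree [k] bounds the common reference norm, and therefore also serves in
     the estimate for degree [l]. *)
  have hb2 := b_form_close C1 (ltW Ki0) X0 (ltW h_gt0) nk0 el rW' rQ hS1' tk1.
  rewrite fE in hb1.
  split.
  - exact: (Vh_transfer polyG adml Vv).
  - exact: distr_le_double hb1 hb2.
  - exact: le_of_sq_chain (ltW C0) nk0 tl2 tk1.
  - exact: le_of_sq_chain (ltW C0) nl0 tk2 tl1.
have lift v t (Vv : Vh Gamma k m Ts v) (v_neq0 : exists2 y, surf_k Gamma k Ts y & v y != 0)
    (ht : t <= b_form Gamma l Ts (transfer Gamma k l Ts v) q /
      triple_norm Gamma l Ts h (transfer Gamma k l Ts v)) :
    (t%:E <= sup_quotient Gamma l m Ts h q)%E.
  exact: (sup_quotient_ge (Vh_transfer polyG adml Vv) (neq0_transfer adml v_neq0) ht).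
(* If [X] is 0, no positive lower bound is available to select a test function. The forms of the two
   degrees then coincide, since their difference has the factor [X], and it remains to show that the
   supremum is nonnegative. *)
have [Xz|Xn] := eqVneq X 0.
  apply: (@le_trans _ _ 0%:E).
    rewrite lee_fin; apply: mulr_ge0_le0; first by rewrite ltW // divr_gt0.
    by apply: le_trans L2l _; rewrite Xz mulr0.
  apply/lee_subgt0Pr => t t0.
  have : ((- (t / C))%:E < sup_quotient Gamma k m Ts h r)%E.
    apply: lt_le_trans isk; rewrite Xz mulr0 lte_fin oppr_lt0 divr_gt0 //.
  move=> /ereal_sup_gt[_ [v [Vv vn0] <-]]; rewrite lte_fin => hv.
  have [_ hb hn1 hn2] := key v Vv.
  have bE : b_form Gamma k Ts v r = b_form Gamma l Ts (transfer Gamma k l Ts v) q.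
    apply/eqP; rewrite -subr_eq0 -normr_le0; apply: le_trans hb _.
    by rewrite Xz !mulr0.
  rewrite bE in hv.
  have hq := quotient_transfer0 (triple_norm_ge0 _ _ _ _) (triple_norm_ge0 _ _ _ _)
    C0 t0 hn1 hn2 hv.
  by rewrite -EFinB sub0r; exact: (lift v (- t) Vv vn0 hq).
have Xp : 0 < X by rewrite lt_neqAle eq_sym Xn.
have : ((3 / 4 * c * X)%:E < sup_quotient Gamma k m Ts h r)%E.
  apply: lt_le_trans isk; rewrite lte_fin (ltr_pM2r Xp) gtr_pMl //; exact: lt34.
move=> /ereal_sup_gt[_ [v [Vv vn0] <-]]; rewrite lte_fin => hv.
have [_ hb hn1 hn2] := key v Vv.
have hq := quotient_transfer (triple_norm_ge0 _ _ _ _) (triple_norm_ge0 _ _ _ _)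
  Xp C1 c0 hb hn1 hn2 h8A hv.
apply: le_trans (lift v _ Vv vn0 hq); rewrite lee_fin.
rewrite -mulrA ler_wpM2l ?(ltW c20) // mulrC ler_pdivrMr // mulrC.
exact: L2l.
Qed.

End Mesh.
End InfSupTransfer.

Theorem corollary5p5 (R : realType) (Gamma : set 'rV[R]_3) (delta : R)
    (H : set R) (Th : R -> seq 'M[R]_3) (k m : nat) :
  smooth_closed_surface Gamma ->
  tubular Gamma delta ->
  mesh_family Gamma H Th ->
  (2 <= k)%N -> (2 <= m)%N ->
  (exists2 h0 : R, 0 < h0 & forall h : R, H h -> h < h0 ->
     admissible Gamma delta 1 (Th h) /\ admissible Gamma delta k (Th h)) ->
  (inf_sup Gamma H Th k m <-> inf_sup Gamma H Th 1 m).
Proof.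
move=> surfG tubeG meshG k2 m2 [h0 h00 adm]; have k0 : (0 < k)%N by exact: ltnW.
split.
  apply: (inf_sup_transfer surfG tubeG meshG k0 (ltn0Sn 0)); exists h0; first exact: h00.
  by move=> h Hh hh0; have [a1 ak] := adm h Hh hh0; split.
apply: (inf_sup_transfer surfG tubeG meshG (ltn0Sn 0) k0); exists h0; first exact: h00.
exact: adm.
Qed.
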